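(* Let $\Lambda$ be an artin algebra over a commutative artinian ring $R$, $n\ge1$ an integer, $\mathcal M$ an $n$-cluster tilting subcategory of $\mathrm{mod}\text{-}\Lambda$, and $F$ an additive subfunctor of $\mathrm{Ext}^n_{\mathcal M}(-,-)$ with enough projectives and enough injectives. There exists an equivalence $\tau_F:\underline{\mathcal M}_F\to\overline{\mathcal M}_F$, unique up to isomorphism, which for every $X,Y\in\mathcal M$ induces natural isomorphisms \[D\,\underline{\mathcal M}_F(\tau_F^{-1}Y,X)\simeq F(X,Y)\simeq D\,\overline{\mathcal M}_F(Y,\tau_FX).\]
   Context: $\Lambda$ is an artin algebra over a commutative artinian ring $R$; $\mathrm{mod}\text{-}\Lambda$ is the category of finitely generated right $\Lambda$-modules; $D=\mathrm{Hom}_R(-,E)$ with $E$ the injective envelope of $R/\mathrm{rad}\,R$. An $n$-cluster tilting subcategory $\mathcal M$ of $\mathrm{mod}\text{-}\Lambda$ is a full additive, functorially finite, generating and cogenerating subcategory with $\mathcal M=\{X\mid \mathrm{Ext}^i_\Lambda(\mathcal M,X)=0,\ 0<i<n\}=\{X\mid \mathrm{Ext}^i_\Lambda(X,\mathcal M)=0,\ 0<i<n\}$. Write $\mathcal M(X,Y)=\mathrm{Hom}_\Lambda(X,Y)$. An $n$-exact sequence in $\mathcal M$ is a sequence $0\to M^0\to M^1\to\cdots\to M^n\to M^{n+1}\to 0$ in $\mathcal M$ such that for all $X\in\mathcal M$ the sequences $0\to\mathcal M(X,M^0)\to\cdots\to\mathcal M(X,M^{n+1})$ and $0\to\mathcal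 M(M^{n+1},X)\to\cdots\to\mathcal M(M^0,X)$ are exact. $\mathrm{Ext}^n_{\mathcal M}(N,L)$ is the abelian group (under Baer sum) of Yoneda equivalence classes of $n$-exact sequences $0\to L\to M^1\to\cdots\to M^n\to N\to0$ (equivalence generated by morphisms of $n$-exact sequences that are identities on $L$ and $N$); it is an additive ($R$-linear) bifunctor via $n$-pullback and $n$-pushout. An additive subfunctor $F$ is an additive sub-bifunctor; it corresponds to a collection of $n$-exact sequences, called $F$-exact, closed under isomorphisms, direct sums, $n$-pullbacks and $n$-pushouts. $P\in\mathcal M$ is $F$-projective if $\mathcal M(P,\xi)$ is exact for every $F$-exact sequence $\xi$; $I\in\mathcal M$ is $F$-injective if $\mathcal M(\xi,I)$ is exact for every $F$-exact $\xi$. $\mathcal P(F)$ and $\mathcal I(F)$ are the full subcategories of $\mathcal M$ of $F$-projective and $F$-injective modules. $F$ has enough projectives if for every $M\in\mathcal M$ there is an $F$-exact sequence $0\to M^1\to\cdots\to M^n\to P\to M\to0$ with $P\in\mathcal P(F)$; dually, $F$ has enough injectives if for every $M\in\mathcal M$ there is an $F$-exact sequence $0\to M\to I\to M^1\to\cdots\to M^n\to0$ with $I\in\mathcal I(F)$. $\underline{\mathcal M}_F=\mathcal M/\mathcal P(F)$ and $\overline{\mathcal M}_F=\mathcal M/\mathcal I(F)$ are the additive quotient categories of $\mathcal M$ by the ideals of morphisms factoring through objects of $\mathcal P(F)$, respectively $\mathcal I(F)$; $\underline{\mathcal M}_F(-,-)$ and $\overline{\mathcal M}_F(-,-)$ denote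 their Hom-groups. $\tau_F^{-1}$ is a quasi-inverse of $\tau_F$. *)

(* Defs.v *)
From HB Require Import structures.
From Stdlib Require Import Relation_Operators.
From mathcomp Require Import all_boot all_order all_algebra.

Set Implicit Arguments.
Unset Strict Implicit.
Unset Printing Implicit Defensive.

Import GRing.Theory.
Local Open Scope ring_scope.

(* Linear maps are compared pointwise throughout. Right modules over an       *)
(* algebra Lam are left modules over the opposite ring, i.e. lmodType Lam^c.  *)

Section CommutativeRing.
Variable R : comNzRingType.

Definition is_ideal (I : R -> Prop) : Prop :=
  [/\ I 0, forall x y, I x -> I y -> I (x + y) & forall a x, I x -> I (a * x)].

Definition artinian : Prop :=
  forall I : nat -> R -> Prop, (forall i, is_ideal (I i)) ->
    (forall i x, I i.+1 x -> I i x) ->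
  exists k, forall i x, (k <= i)%N -> I k x -> I i x.

Definition is_maximal_ideal (I : R -> Prop) : Prop :=
  [/\ is_ideal I, ~ I 1 &
      forall J : R -> Prop, is_ideal J -> (forall x, I x -> J x) -> ~ J 1 ->
        forall x, J x -> I x].

Definition radical (x : R) : Prop :=
  forall I : R -> Prop, is_maximal_ideal I -> I x.

Definition is_quotient_by_radical (Q : lmodType R) : Prop :=
  exists q : {linear R^o -> Q},
    (forall y, exists x, q x = y) /\ (forall x, q x = 0 <-> radical x).

Definition injective_module (E : lmodType R) : Prop :=
  forall (V W : lmodType R) (i : {linear V -> W}) (f : {linear V -> E}),
    injective i -> exists g : {linear W -> E}, forall x, f x = g (i x).

Definition is_injective_envelope (V E : lmodType R) : Prop :=
  injective_module E /\
  exists j : {linear V -> E}, injective j /\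
    forall y : E, y <> 0 -> exists (a : R) (v : V), a *: y = j v /\ a *: y <> 0.

(* E represents the duality D = Hom_R(-, E) *)
Definition is_dualizing (E : lmodType R) : Prop :=
  exists2 Q : lmodType R, is_quotient_by_radical Q & is_injective_envelope Q E.

End CommutativeRing.

Definition fin_gen (S : pzRingType) (V : lmodType S) : Prop :=
  exists (m : nat) (e : 'I_m -> V), forall v, exists c : 'I_m -> S,
    v = \sum_i c i *: e i.

Section Modules.
Variable S : nzRingType.
Implicit Types L N P U V W X Y Z : lmodType S.

Definition zero_mod : lmodType S := 'rV[S]_0.

Record lin_iso V W := LinIso {
  iso_fun :> {linear V -> W};
  iso_inv : {linear W -> V};
  iso_funK : cancel iso_fun iso_inv;
  iso_invK : cancel iso_inv iso_fun }.

Section ProductMaps.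
Variables (V V1 V2 W1 W2 : lmodType S).

Definition inj1 (x : V1) : V1 * V2 := (x, 0).
Definition inj2 (y : V2) : V1 * V2 := (0, y).
Definition pair_map (f : V -> W1) (g : V -> W2) (x : V) : W1 * W2 := (f x, g x).
Definition copair_map (f : V1 -> V) (g : V2 -> V) (x : V1 * V2) : V :=
  f x.1 + g x.2.
Definition prod_map (f : V1 -> W1) (g : V2 -> W2) (x : V1 * V2) : W1 * W2 :=
  (f x.1, g x.2).

Fact inj1_linear : linear inj1.
Proof. by move=> a x y; congr pair; rewrite /= scaler0 addr0. Qed.
HB.instance Definition _ :=
  GRing.isLinear.Build S V1 (V1 * V2)%type _ inj1 inj1_linear.

Fact inj2_linear : linear inj2.
Proof. by move=> a x y; congr pair; rewrite /= scaler0 addr0. Qed.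
HB.instance Definition _ :=
  GRing.isLinear.Build S V2 (V1 * V2)%type _ inj2 inj2_linear.

Fact pair_map_linear (f : {linear V -> W1}) (g : {linear V -> W2}) :
  linear (pair_map f g).
Proof. by move=> a x y; rewrite /pair_map !linearP. Qed.
HB.instance Definition _ (f : {linear V -> W1}) (g : {linear V -> W2}) :=
  GRing.isLinear.Build S V (W1 * W2)%type _ (pair_map f g)
    (pair_map_linear f g).

Fact copair_map_linear (f : {linear V1 -> V}) (g : {linear V2 -> V}) :
  linear (copair_map f g).
Proof. by move=> a x y; rewrite /copair_map !linearP scalerDr addrACA. Qed.
HB.instance Definition _ (f : {linear V1 -> V}) (g : {linear V2 -> V}) :=
  GRing.isLinear.Build S (V1 * V2)%type V _ (copair_map f g)
    (copair_map_linear f g).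

Fact prod_map_linear (f : {linear V1 -> W1}) (g : {linear V2 -> W2}) :
  linear (prod_map f g).
Proof. by move=> a x y; rewrite /prod_map /= !linearP. Qed.
HB.instance Definition _ (f : {linear V1 -> W1}) (g : {linear V2 -> W2}) :=
  GRing.isLinear.Build S (V1 * V2)%type (W1 * W2)%type _ (prod_map f g)
    (prod_map_linear f g).

End ProductMaps.
Arguments inj1 {V1} V2 _.
Arguments inj2 V1 {V2} _.

Definition diag_map V : {linear V -> (V * V)%type} := pair_map idfun idfun.
Definition codiag_map V : {linear (V * V)%type -> V} := copair_map idfun idfun.

Lemma prod_decomp V W (x : V * W) : x = inj1 W x.1 + inj2 V x.2.
Proof. by case: x => a b; congr pair; rewrite /= ?addr0 ?add0r. Qed.

Section ProductIso.
Variables (V1 V2 W1 W2 : lmodType S) (f : lin_iso V1 W1) (g : lin_iso V2 W2).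

Fact prod_isoK : cancel (prod_map f g) (prod_map (iso_inv f) (iso_inv g)).
Proof. by case=> x y; rewrite /prod_map /= !iso_funK. Qed.

Fact prod_iso_invK : cancel (prod_map (iso_inv f) (iso_inv g)) (prod_map f g).
Proof. by case=> x y; rewrite /prod_map /= !iso_invK. Qed.

Definition prod_iso : lin_iso (V1 * V2)%type (W1 * W2)%type :=
  LinIso prod_isoK prod_iso_invK.
End ProductIso.

Record add_subcat := AddSubcat {
  in_subcat :> lmodType S -> Prop;
  subcat_zero : forall V, (forall x : V, x = 0) -> in_subcat V;
  subcat_prod : forall V W, in_subcat V -> in_subcat W ->
    in_subcat (V * W)%type;
  subcat_iso : forall V W, lin_iso V W -> in_subcat V -> in_subcat W }.

Definition projective_module V : Prop :=
  forall W U (p : {linear W -> U}) (f : {linear V -> U}),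
    (forall u, exists w, p w = u) ->
  exists g : {linear V -> W}, forall x, f x = p (g x).

Definition proj_resolution X (P : nat -> lmodType S)
    (d : forall i, {linear P i.+1 -> P i}) (e : {linear P 0%N -> X}) : Prop :=
  [/\ forall i, fin_gen (P i) /\ projective_module (P i),
      forall x, exists p, e p = x,
      forall p, e p = 0 <-> exists q, d 0%N q = p &
      forall i p, d i p = 0 <-> exists q, d i.+1 q = p].

(* vanishing of the i-th cohomology group of Hom(P_*, Y) *)
Definition ext_vanishes (i : nat) X Y : Prop :=
  forall (P : nat -> lmodType S) (d : forall i, {linear P i.+1 -> P i})
         (e : {linear P 0%N -> X}), proj_resolution d e ->
  forall f : {linear P i -> Y}, (forall x, f (d i x) = 0) ->
  match i return {linear P i -> Y} -> Prop with
  | 0%N => fun f => forall x, f x = 0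
  | j.+1 => fun f => exists g : {linear P j -> Y}, forall x, f x = g (d j x)
  end f.

Record is_cluster_tilting (n : nat) (M : lmodType S -> Prop) : Prop := {
  ct_fin_gen : forall X, M X -> fin_gen X;
  ct_contravariantly_finite : forall X, fin_gen X ->
    exists (C : lmodType S) (f : {linear C -> X}), M C /\
      forall (C' : lmodType S) (g : {linear C' -> X}), M C' ->
      exists h : {linear C' -> C}, forall x, g x = f (h x);
  ct_covariantly_finite : forall X, fin_gen X ->
    exists (C : lmodType S) (f : {linear X -> C}), M C /\
      forall (C' : lmodType S) (g : {linear X -> C'}), M C' ->
      exists h : {linear C -> C'}, forall x, g x = h (f x);
  ct_generating : forall X, fin_gen X ->
    exists (C : lmodType S) (f : {linear C -> X}),
      M C /\ forall x, exists c, f c = x;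
  ct_cogenerating : forall X, fin_gen X ->
    exists (C : lmodType S) (f : {linear X -> C}), M C /\ injective f;
  ct_ext_right : forall X, fin_gen X ->
    (M X <-> forall C i, M C -> (0 < i < n)%N -> ext_vanishes i C X);
  ct_ext_left : forall X, fin_gen X ->
    (M X <-> forall C i, M C -> (0 < i < n)%N -> ext_vanishes i X C) }.

(* Only finitely many terms of such a sequence are ever used: an n-exact      *)
(* sequence consists of the terms 0, ..., n+1.                                *)
Record complex := Complex {
  cx_ob :> nat -> lmodType S;
  cx_d : forall i, {linear cx_ob i -> cx_ob i.+1} }.

(* 0 -> Hom(Z, C_0) -> ... -> Hom(Z, C_{n+1}) is exact *)
Definition hom_left_exact (n : nat) (C : complex) Z : Prop :=
  (forall f : {linear Z -> C 0%N}, (forall x, cx_d C 0 (f x) = 0) ->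
     forall x, f x = 0) /\
  (forall i, (i < n)%N -> forall f : {linear Z -> C i.+1},
     (forall x, cx_d C i.+1 (f x) = 0) <->
     exists g : {linear Z -> C i}, forall x, f x = cx_d C i (g x)).

(* 0 -> Hom(C_{n+1}, Z) -> ... -> Hom(C_0, Z) is exact *)
Definition hom_right_exact (n : nat) (C : complex) Z : Prop :=
  (forall f : {linear C n.+1 -> Z}, (forall x, f (cx_d C n x) = 0) ->
     forall x, f x = 0) /\
  (forall i, (i < n)%N -> forall f : {linear C i.+1 -> Z},
     (forall x, f (cx_d C i x) = 0) <->
     exists g : {linear C i.+2 -> Z}, forall x, f x = g (cx_d C i.+1 x)).

(* 0 -> Hom(Z, C_0) -> ... -> Hom(Z, C_{n+1}) -> 0 is exact *)
Definition hom_from_exact (n : nat) (C : complex) Z : Prop :=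
  hom_left_exact n C Z /\
  forall f : {linear Z -> C n.+1},
    exists g : {linear Z -> C n}, forall x, f x = cx_d C n (g x).

(* 0 -> Hom(C_{n+1}, Z) -> ... -> Hom(C_0, Z) -> 0 is exact *)
Definition hom_to_exact (n : nat) (C : complex) Z : Prop :=
  hom_right_exact n C Z /\
  forall f : {linear C 0%N -> Z},
    exists g : {linear C 1%N -> Z}, forall x, f x = g (cx_d C 0 x).

Definition is_n_exact (n : nat) (M : lmodType S -> Prop) (C : complex) : Prop :=
  [/\ forall i, (i <= n.+1)%N -> M (C i),
      forall Z, M Z -> hom_left_exact n C Z &
      forall Z, M Z -> hom_right_exact n C Z].

Definition is_cx_morph (n : nat) (C D : complex)
    (g : forall i, {linear C i -> D i}) : Prop :=
  forall i, (i <= n)%N -> forall x, g i.+1 (cx_d C i x) = cx_d D i (g i x).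

Definition cx_sum (C D : complex) : complex :=
  @Complex (fun i => (C i * D i)%type) (fun i => prod_map (cx_d C i) (cx_d D i)).

(* C_1 -> C_2 -> ... *)
Definition cx_tail (C : complex) : complex :=
  @Complex (fun i => C i.+1) (fun i => cx_d C i.+1).

(* The cone C_0 -> C_1 + D_0 -> ... -> C_n + D_{n-1} -> D_n, with             *)
(* differential (x, y) |-> (- d x, g x + d y); its k-th term is written       *)
(* uniformly as C_k * D_{k-1} where D_{-1} and C_k for k > n are zero.        *)

Definition cut (b : bool) V : lmodType S := if b then V else zero_mod.

Definition uncut_map (b : bool) V : {linear cut b V -> V} :=
  if b return {linear cut b V -> V} then idfun else \0.

Definition cut_map (b : bool) V : {linear V -> cut b V} :=
  if b return {linear V -> cut b V} then idfun else \0.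

Definition pre_ob (D : complex) (k : nat) : lmodType S :=
  if k is j.+1 then D j else zero_mod.

Definition pre_d (D : complex) (k : nat) : {linear pre_ob D k -> D k} :=
  match k return {linear pre_ob D k -> D k} with
  | 0%N => \0
  | j.+1 => cx_d D j
  end.

Section Cone.
Variables (n : nat) (C D : complex) (g : forall i, {linear C i -> D i}).

Definition cone_ob (k : nat) : lmodType S :=
  (cut (k <= n)%N (C k) * pre_ob D k)%type.

Definition cone_d (k : nat) (z : cone_ob k) : cone_ob k.+1 :=
  (cut_map _ _ (- cx_d C k (uncut_map _ _ z.1)),
   g k (uncut_map _ _ z.1) + pre_d D k z.2).

Fact cone_d_linear k : linear (@cone_d k).
Proof.
move=> a x y; rewrite /cone_d; congr pair => /=.
  rewrite [in LHS]linearP [in LHS]linearP opprD -scalerN; exact: linearP.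
by rewrite !linearP scalerDr addrACA.
Qed.

HB.instance Definition _ k :=
  GRing.isLinear.Build S (cone_ob k) (cone_ob k.+1) _ (@cone_d k)
    (@cone_d_linear k).

Definition cone : complex := @Complex cone_ob (fun k => @cone_d k).
End Cone.

(* 0 -> L -> C_1 -> ... -> C_n -> N -> 0, the ends C_0 and C_{n+1} being      *)
(* identified with L and N *)
Record nseq (n : nat) (L N : lmodType S) := NSeq {
  ns_cx :> complex;
  ns_left : lin_iso L (ns_cx 0%N);
  ns_right : lin_iso (ns_cx n.+1) N }.

Section Extensions.
Variables (n : nat) (M : lmodType S -> Prop).

(* g : xi -> xi' restricts to l and r on the left and right ends *)
Definition is_nseq_morph L L' N N' (xi : nseq n L N) (xi' : nseq n L' N')
    (l : {linear L -> L'}) (r : {linear N -> N'})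
    (g : forall i, {linear xi i -> xi' i}) : Prop :=
  [/\ is_cx_morph n g,
      forall x, g 0%N (ns_left xi x) = ns_left xi' (l x) &
      forall x, ns_right xi' (g n.+1 x) = r (ns_right xi x)].

Definition yoneda_step L N (xi xi' : nseq n L N) : Prop :=
  [/\ is_n_exact n M xi, is_n_exact n M xi' &
      exists g : forall i, {linear xi i -> xi' i},
        is_nseq_morph idfun idfun g].

(* Ext^n_M(N, L) is the set of classes of n-exact sequences in nseq n L N     *)
(* for this relation *)
Definition yoneda_eq L N : nseq n L N -> nseq n L N -> Prop :=
  clos_refl_sym_trans _ (@yoneda_step L N).

(* xi' is an n-pullback of xi along f: a morphism xi' -> xi over f whose      *)
(* mapping cone in degrees 1, ..., n+1 is an n-kernel. *)
Definition is_n_pullback L N N' (f : {linear N' -> N})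
    (xi : nseq n L N) (xi' : nseq n L N') : Prop :=
  is_n_exact n M xi' /\
  exists g : forall i, {linear xi' i -> xi i},
    is_nseq_morph idfun f g /\
    forall Z, M Z -> hom_left_exact n
      (cone n (C := cx_tail xi') (D := cx_tail xi) (fun i => g i.+1)) Z.

(* xi' is an n-pushout of xi along f: a morphism xi -> xi' under f whose      *)
(* mapping cone in degrees 0, ..., n is an n-cokernel. *)
Definition is_n_pushout L L' N (f : {linear L -> L'})
    (xi : nseq n L N) (xi' : nseq n L' N) : Prop :=
  is_n_exact n M xi' /\
  exists g : forall i, {linear xi i -> xi' i},
    is_nseq_morph f idfun g /\
    forall Z, M Z -> hom_right_exact n (cone n g) Z.

Definition nseq_sum L L' N N' (xi : nseq n L N) (xi' : nseq n L' N') :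
    nseq n (L * L')%type (N * N')%type :=
  @NSeq n (L * L')%type (N * N')%type (cx_sum xi xi')
    (prod_iso (ns_left xi) (ns_left xi'))
    (prod_iso (ns_right xi) (ns_right xi')).

Definition is_baer_sum L N (xi1 xi2 xi : nseq n L N) : Prop :=
  exists eta : nseq n (L * L)%type N,
    is_n_pullback (@diag_map N) (nseq_sum xi1 xi2) eta /\
    is_n_pushout (@codiag_map L) eta xi.

(* A sub-bifunctor F of Ext^n_M, given by the n-exact sequences whose class   *)
(* lies in F(N, L). Each F(N, L) is a subgroup: it is nonempty, closed under  *)
(* Baer sums, and contains opposites since these are pushouts along -1.       *)
Record additive_subfunctor := AdditiveSubfunctor {
  F_exact : forall N L, nseq n L N -> Prop;
  F_n_exact : forall N L (xi : nseq n L N), F_exact xi -> is_n_exact n M xi;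
  F_yoneda : forall N L (xi xi' : nseq n L N),
    F_exact xi -> yoneda_eq xi xi' -> F_exact xi';
  F_nonempty : forall N L, M N -> M L -> exists xi : nseq n L N, F_exact xi;
  F_baer_sum : forall N L (xi1 xi2 xi : nseq n L N),
    F_exact xi1 -> F_exact xi2 -> is_baer_sum xi1 xi2 xi -> F_exact xi;
  F_pullback : forall N N' L (f : {linear N' -> N})
      (xi : nseq n L N) (xi' : nseq n L N'),
    F_exact xi -> is_n_pullback f xi xi' -> F_exact xi';
  F_pushout : forall N L L' (f : {linear L -> L'})
      (xi : nseq n L N) (xi' : nseq n L' N),
    F_exact xi -> is_n_pushout f xi xi' -> F_exact xi' }.

Variable F : additive_subfunctor.

Definition F_projective P : Prop :=
  M P /\ forall N L (xi : nseq n L N), F_exact F xi -> hom_from_exact n xi P.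

Definition F_injective I : Prop :=
  M I /\ forall N L (xi : nseq n L N), F_exact F xi -> hom_to_exact n xi I.

Definition enough_projectives : Prop :=
  forall X, M X -> exists (L : lmodType S) (xi : nseq n L X),
    F_exact F xi /\ F_projective (xi n).

Definition enough_injectives : Prop :=
  forall X, M X -> exists (N : lmodType S) (xi : nseq n X N),
    F_exact F xi /\ F_injective (xi 1%N).

End Extensions.

Section ProjectivesInjectives.
Variables (n : nat) (M : add_subcat) (F : additive_subfunctor n M).

Lemma hom_from_exact_prod (C : complex) V W :
  hom_from_exact n C V -> hom_from_exact n C W ->
  hom_from_exact n C (V * W)%type.
Proof.
have lift i (f : {linear (V * W)%type -> C i.+1}) :
    (exists g : {linear V -> C i}, forall x, (f \o inj1 W) x = cx_d C i (g x)) ->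
    (exists g : {linear W -> C i}, forall x, (f \o inj2 V) x = cx_d C i (g x)) ->
    exists g : {linear (V * W)%type -> C i}, forall x, f x = cx_d C i (g x).
  move=> [g gP] [h hP]; exists (copair_map g h) => x.
  by rewrite {1}(prod_decomp x) /copair_map !linearD -gP -hP.
move=> [[V0 Vi] Ve] [[W0 Wi] We]; split; first split.
- move=> f df x; rewrite (prod_decomp x) linearD.
  have := V0 (f \o inj1 W) (fun x => df _) x.1.
  have := W0 (f \o inj2 V) (fun x => df _) x.2.
  by rewrite /= => -> ->; rewrite addr0.
- move=> i lt_in f; split=> [df|[g gP] x].
    apply: lift; first by apply/(Vi i lt_in) => x; apply: df.
    by apply/(Wi i lt_in) => x; apply: df.
  rewrite (prod_decomp x) !linearD.
  have -> : cx_d C i.+1 (f (inj1 W x.1)) = 0.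
    apply: (proj2 (Vi i lt_in (f \o inj1 W))).
    by exists (g \o inj1 W) => z; apply: gP.
  have -> : cx_d C i.+1 (f (inj2 V x.2)) = 0.
    apply: (proj2 (Wi i lt_in (f \o inj2 V))).
    by exists (g \o inj2 V) => z; apply: gP.
  by rewrite addr0.
- by move=> f; exact: (lift n f (Ve _) (We _)).
Qed.

Lemma hom_to_exact_prod (C : complex) V W :
  hom_to_exact n C V -> hom_to_exact n C W -> hom_to_exact n C (V * W)%type.
Proof.
have lift i (f : {linear C i -> (V * W)%type}) :
    (exists g : {linear C i.+1 -> V}, forall x, (fst \o f) x = g (cx_d C i x)) ->
    (exists g : {linear C i.+1 -> W}, forall x, (snd \o f) x = g (cx_d C i x)) ->
    exists g : {linear C i.+1 -> (V * W)%type}, forall x, f x = g (cx_d C i x).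
  move=> [g gP] [h hP]; exists (pair_map g h) => x.
  by rewrite /= /pair_map -gP -hP /= -surjective_pairing.
move=> [[V0 Vi] Ve] [[W0 Wi] We]; split; first split.
- move=> f df x; rewrite [f x]surjective_pairing.
  have fd0 y : f (cx_d C n y) = 0 by apply: df.
  have -> : (f x).1 = 0.
    by apply: (V0 (fst \o f)) => y /=; rewrite fd0.
  have -> : (f x).2 = 0.
    by apply: (W0 (snd \o f)) => y /=; rewrite fd0.
  by [].
- move=> i lt_in f; split=> [df|[g gP] x].
    apply: lift; first by apply/(Vi i lt_in) => x /=; rewrite df.
    by apply/(Wi i lt_in) => x /=; rewrite df.
  rewrite [f _]surjective_pairing.
  have -> : (f (cx_d C i x)).1 = 0.
    apply: (proj2 (Vi i lt_in (fst \o f))).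
    by exists (fst \o g) => z /=; rewrite gP.
  have -> : (f (cx_d C i x)).2 = 0.
    apply: (proj2 (Wi i lt_in (snd \o f))).
    by exists (snd \o g) => z /=; rewrite gP.
  by [].
- by move=> f; exact: (lift 0%N f (Ve _) (We _)).
Qed.

Lemma hom_from_exact_retract (C : complex) V W
    (s : {linear V -> W}) (r : {linear W -> V}) : cancel s r ->
  hom_from_exact n C W -> hom_from_exact n C V.
Proof.
move=> sK [[W0 Wi] We]; split; first split.
- move=> f df x; rewrite -(sK x).
  by apply: (W0 (f \o r)) => y; apply: df.
- move=> i lt_in f; split=> [df|[g gP] x].
    have [|g gP] := proj1 (Wi i lt_in (f \o r)).
      by move=> x; apply: df.
    by exists (g \o s) => x; rewrite /= -gP /= sK.
  rewrite -(sK x); apply: (proj2 (Wi i lt_in (f \o r))).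
  by exists (g \o r) => y; apply: gP.
- move=> f; have [g gP] := We (f \o r).
  by exists (g \o s) => x; rewrite /= -gP /= sK.
Qed.

Lemma hom_to_exact_retract (C : complex) V W
    (s : {linear V -> W}) (r : {linear W -> V}) : cancel s r ->
  hom_to_exact n C W -> hom_to_exact n C V.
Proof.
move=> sK [[W0 Wi] We]; split; first split.
- move=> f df x; rewrite -(sK (f x)).
  have -> : s (f x) = 0; last by rewrite linear0.
  by apply: (W0 (s \o f)) => y /=; rewrite df linear0.
- move=> i lt_in f; split=> [df|[g gP] x].
    have [|g gP] := proj1 (Wi i lt_in (s \o f)).
      by move=> x /=; rewrite df linear0.
    by exists (r \o g) => x; rewrite /= -gP /= sK.
  rewrite -(sK (f _)).
  have -> : s (f (cx_d C i x)) = 0; last by rewrite linear0.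
  apply: (proj2 (Wi i lt_in (s \o f))).
  by exists (s \o g) => y; rewrite /= gP.
- move=> f; have [g gP] := We (s \o f).
  by exists (r \o g) => x; rewrite /= -gP /= sK.
Qed.

Fact F_projective_zero V : (forall x : V, x = 0) -> F_projective F V.
Proof.
move=> V0; have f0 W (f : {linear V -> W}) x : f x = 0.
  by rewrite (V0 x) linear0.
split=> [|N L xi _]; first exact: subcat_zero.
split=> [|f]; last by exists \0 => x; rewrite !f0 linear0.
split=> [f _ x|i _ f]; first exact: f0.
split=> [_|_ x]; first by exists \0 => x; rewrite !f0 linear0.
by rewrite f0 linear0.
Qed.

Fact F_injective_zero V : (forall x : V, x = 0) -> F_injective F V.
Proof.
move=> V0; split=> [|N L xi _]; first exact: subcat_zero.
split=> [|f]; last by exists \0 => x; rewrite [LHS]V0 [RHS]V0.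
split=> [f _ x|i _ f]; first exact: V0.
split=> [_|_ x]; first by exists \0 => x; rewrite [LHS]V0 [RHS]V0.
exact: V0.
Qed.

Fact F_projective_prod V W :
  F_projective F V -> F_projective F W -> F_projective F (V * W)%type.
Proof.
move=> [MV HV] [MW HW]; split=> [|N L xi Fxi]; first exact: subcat_prod.
by apply: hom_from_exact_prod; [apply: HV Fxi | apply: HW Fxi].
Qed.

Fact F_injective_prod V W :
  F_injective F V -> F_injective F W -> F_injective F (V * W)%type.
Proof.
move=> [MV HV] [MW HW]; split=> [|N L xi Fxi]; first exact: subcat_prod.
by apply: hom_to_exact_prod; [apply: HV Fxi | apply: HW Fxi].
Qed.

Fact F_projective_iso V W :
  lin_iso V W -> F_projective F V -> F_projective F W.
Proof.
move=> h [MV HV]; split=> [|N L xi Fxi]; first exact: subcat_iso h MV.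
exact: hom_from_exact_retract (iso_invK h) (HV _ _ _ Fxi).
Qed.

Fact F_injective_iso V W :
  lin_iso V W -> F_injective F V -> F_injective F W.
Proof.
move=> h [MV HV]; split=> [|N L xi Fxi]; first exact: subcat_iso h MV.
exact: hom_to_exact_retract (iso_invK h) (HV _ _ _ Fxi).
Qed.

Definition F_proj : add_subcat :=
  AddSubcat F_projective_zero F_projective_prod F_projective_iso.

Definition F_inj : add_subcat :=
  AddSubcat F_injective_zero F_injective_prod F_injective_iso.

End ProjectivesInjectives.
End Modules.

(* Equality of morphisms is a relation hom_eq, so that a quotient category has *)
(* the morphisms of the original category and a coarser hom_eq.               *)
Record category := Category {
  obj :> Type;
  hom : obj -> obj -> Type;
  hom_eq : forall X Y, hom X Y -> hom X Y -> Prop;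
  id_hom : forall X, hom X X;
  cat_comp : forall X Y Z, hom Y Z -> hom X Y -> hom X Z;
  hom_eq_refl : forall X Y (f : hom X Y), hom_eq f f;
  hom_eq_sym : forall X Y (f g : hom X Y), hom_eq f g -> hom_eq g f;
  hom_eq_trans : forall X Y (f g h : hom X Y),
    hom_eq f g -> hom_eq g h -> hom_eq f h;
  comp_eq : forall X Y Z (f f' : hom Y Z) (g g' : hom X Y),
    hom_eq f f' -> hom_eq g g' -> hom_eq (cat_comp f g) (cat_comp f' g');
  comp_assoc : forall W X Y Z (f : hom Y Z) (g : hom X Y) (h : hom W X),
    hom_eq (cat_comp f (cat_comp g h)) (cat_comp (cat_comp f g) h);
  comp_id_left : forall X Y (f : hom X Y), hom_eq (cat_comp (id_hom Y) f) f;
  comp_id_right : forall X Y (f : hom X Y), hom_eq (cat_comp f (id_hom X)) f }.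

Record functor (C D : category) := Functor {
  fob :> C -> D;
  fmap : forall X Y, hom X Y -> hom (fob X) (fob Y);
  fmap_eq : forall X Y (f g : hom X Y),
    hom_eq f g -> hom_eq (fmap f) (fmap g);
  fmap_id : forall X, hom_eq (fmap (id_hom X)) (id_hom (fob X));
  fmap_comp : forall X Y Z (f : hom Y Z) (g : hom X Y),
    hom_eq (fmap (cat_comp f g)) (cat_comp (fmap f) (fmap g)) }.

Definition id_functor (C : category) : functor C C :=
  @Functor C C id (fun X Y f => f) (fun X Y f g e => e)
    (fun X => hom_eq_refl _) (fun X Y Z f g => hom_eq_refl _).

Section FunctorComposition.
Variables (C D E : category) (G : functor D E) (F : functor C D).

Fact comp_fmap_id X : hom_eq (fmap G (fmap F (id_hom X))) (id_hom (G (F X))).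
Proof. exact: hom_eq_trans (fmap_eq G (fmap_id F X)) (fmap_id G (F X)). Qed.

Fact comp_fmap_comp X Y Z (f : hom Y Z) (g : hom X Y) :
  hom_eq (fmap G (fmap F (cat_comp f g)))
         (cat_comp (fmap G (fmap F f)) (fmap G (fmap F g))).
Proof. exact: hom_eq_trans (fmap_eq G (fmap_comp F f g)) (fmap_comp G _ _). Qed.

Definition comp_functor : functor C E :=
  Functor (fun X Y (f g : hom X Y) e => fmap_eq G (fmap_eq F e))
    comp_fmap_id comp_fmap_comp.
End FunctorComposition.

Definition nat_iso (C D : category) (F G : functor C D) : Prop :=
  exists (a : forall X, hom (F X) (G X)) (b : forall X, hom (G X) (F X)),
    [/\ forall X Y (f : hom X Y),
          hom_eq (cat_comp (a Y) (fmap F f)) (cat_comp (fmap G f) (a X)),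
        forall X, hom_eq (cat_comp (b X) (a X)) (id_hom (F X)) &
        forall X, hom_eq (cat_comp (a X) (b X)) (id_hom (G X))].

Definition is_quasi_inverse (C D : category) (F : functor C D)
    (G : functor D C) : Prop :=
  nat_iso (comp_functor G F) (id_functor C) /\
  nat_iso (comp_functor F G) (id_functor D).

Section Quotients.
Variables (S : nzRingType) (M I : add_subcat S).

Definition sub_ob := {X : lmodType S | M X}.
Implicit Types X Y Z : sub_ob.

Definition sub_cat : category.
Proof.
refine (@Category sub_ob (fun X Y => {linear sval X -> sval Y})
  (fun X Y f g => f =1 g) (fun X => idfun) (fun X Y Z f g => f \o g)
  _ _ _ _ _ _ _) => //.
- by move=> X Y f g fg x; rewrite fg.
- by move=> X Y f g h fg gh x; rewrite fg gh.
- by move=> X Y Z f f' g g' ff' gg' x; rewrite /= gg' ff'.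
Defined.

Definition quot_eq X Y (f g : {linear sval X -> sval Y}) : Prop :=
  exists (P : lmodType S) (a : {linear sval X -> P}) (b : {linear P -> sval Y}),
    I P /\ forall x, f x - g x = b (a x).

Fact eq_quot_eq X Y (f g : {linear sval X -> sval Y}) : f =1 g -> quot_eq f g.
Proof.
move=> fg; exists (zero_mod S), \0, \0; split=> [|x].
  by apply: subcat_zero => x; apply: thinmx0.
by rewrite fg subrr.
Qed.

Fact quot_eq_sym X Y (f g : {linear sval X -> sval Y}) :
  quot_eq f g -> quot_eq g f.
Proof.
move=> [P [a [b [IP fg]]]]; exists P, a, (\- b); split=> // x.
by rewrite /= -fg opprB.
Qed.

Fact quot_eq_trans X Y (f g h : {linear sval X -> sval Y}) :
  quot_eq f g -> quot_eq g h -> quot_eq f h.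
Proof.
move=> [P [a [b [IP fg]]]] [Q [c [d [IQ gh]]]].
exists (P * Q)%type, (pair_map a c), (copair_map b d).
split=> [|x]; first exact: subcat_prod.
by rewrite /= /copair_map /= -fg -gh addrA subrK.
Qed.

Fact quot_comp_eq X Y Z (f f' : {linear sval Y -> sval Z})
    (g g' : {linear sval X -> sval Y}) :
  quot_eq f f' -> quot_eq g g' ->
  @quot_eq X Z (f \o g : {linear _ -> _}) (f' \o g' : {linear _ -> _}).
Proof.
move=> [P [a [b [IP ff']]]] [Q [c [d [IQ gg']]]].
exists (P * Q)%type, (pair_map (a \o g) c), (copair_map b (f' \o d)).
split=> [|x]; first exact: subcat_prod.
by rewrite /= /copair_map /= -ff' -gg' linearB addrA subrK.
Qed.

Definition quot_cat : category.
Proof.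
refine (@Category sub_ob (fun X Y => {linear sval X -> sval Y}) quot_eq
  (fun X => idfun) (fun X Y Z f g => f \o g)
  _ quot_eq_sym quot_eq_trans quot_comp_eq _ _ _).
- by move=> X Y f; apply: eq_quot_eq.
- by move=> W X Y Z f g h; apply: eq_quot_eq.
- by move=> X Y f; apply: eq_quot_eq.
- by move=> X Y f; apply: eq_quot_eq.
Defined.

Definition quot_functor : functor sub_cat quot_cat :=
  @Functor sub_cat quot_cat id (fun X Y f => f) eq_quot_eq
    (fun X => hom_eq_refl _) (fun X Y Z f g => hom_eq_refl _).
End Quotients.

Section Duality.
Variables (R : comNzRingType) (Lam : algType R) (E : lmodType R).

Definition r_scale (V : lmodType Lam^c) (r : R) (v : V) : V :=
  ((r%:A : Lam) : Lam^c) *: v.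

Fact r_scale_linear V r : linear (@r_scale V r).
Proof.
move=> a x y; rewrite /r_scale scalerDr !scalerA; congr (_ *: _ + _).
by rewrite /GRing.mul /= mulr_algl mulr_algr.
Qed.

HB.instance Definition _ V r :=
  GRing.isLinear.Build Lam^c V V _ (@r_scale V r) (@r_scale_linear V r).

Variables (n : nat) (M : add_subcat Lam^c).

(* R-linear maps from the Hom-group of X and Y in M / I to E *)
Record dual_hom (I : add_subcat Lam^c) (X Y : quot_cat M I) := DualHom {
  dual_fun :> hom X Y -> E;
  dual_eq : forall f g : hom X Y, hom_eq f g -> dual_fun f = dual_fun g;
  dual_add : forall f g : {linear sval X -> sval Y},
    dual_fun (f \+ g) = dual_fun f + dual_fun g;
  dual_scale : forall (r : R) (f : {linear sval X -> sval Y}),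
    dual_fun (@r_scale (sval Y) r \o f) = r *: dual_fun f }.

Variable F : additive_subfunctor n M.

(* An isomorphism of R-modules F(X, Y) -> D (M / I)(A Y, B X), natural in X   *)
(* and Y. It is given on n-exact sequences xi in nseq n Y X; its values       *)
(* outside F(X, Y) are irrelevant.                                            *)
Record is_dual_iso (I : add_subcat Lam^c) (A B : functor (sub_cat M) (quot_cat M I))
    (Phi : forall X Y : sub_cat M,
       nseq n (sval Y) (sval X) -> dual_hom (A Y) (B X)) : Prop := {
  di_inj : forall (X Y : sub_cat M) (xi xi' : nseq n (sval Y) (sval X)),
    F_exact F xi -> F_exact F xi' ->
    (Phi X Y xi =1 Phi X Y xi' <-> yoneda_eq M xi xi');
  di_surj : forall (X Y : sub_cat M) (phi : dual_hom (A Y) (B X)),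
    exists2 xi, F_exact F xi & Phi X Y xi =1 phi;
  di_add : forall (X Y : sub_cat M) (xi1 xi2 xi : nseq n (sval Y) (sval X)),
    F_exact F xi1 -> F_exact F xi2 -> is_baer_sum M xi1 xi2 xi ->
    forall h, Phi X Y xi h = Phi X Y xi1 h + Phi X Y xi2 h;
  di_scale : forall (X Y : sub_cat M) (r : R) (xi xi' : nseq n (sval Y) (sval X)),
    F_exact F xi -> is_n_pushout M (@r_scale (sval Y) r) xi xi' ->
    forall h, Phi X Y xi' h = r *: Phi X Y xi h;
  di_nat_left : forall (X X' Y : sub_cat M) (f : hom X' X)
      (xi : nseq n (sval Y) (sval X)) (xi' : nseq n (sval Y) (sval X')),
    F_exact F xi -> is_n_pullback M f xi xi' ->
    forall h, Phi X' Y xi' h = Phi X Y xi (cat_comp (fmap B f) h);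
  di_nat_right : forall (X Y Y' : sub_cat M) (g : hom Y Y')
      (xi : nseq n (sval Y) (sval X)) (xi' : nseq n (sval Y') (sval X)),
    F_exact F xi -> is_n_pushout M g xi xi' ->
    forall h, Phi X Y' xi' h = Phi X Y xi (cat_comp h (fmap A g)) }.

(* F(X, Y) ~ D (M / I)(A Y, B X), naturally in X and Y *)
Definition dual_iso (I : add_subcat Lam^c)
    (A B : functor (sub_cat M) (quot_cat M I)) : Prop :=
  exists Phi, @is_dual_iso I A B Phi.

Definition under_cat : category := quot_cat M (F_proj F).
Definition over_cat : category := quot_cat M (F_inj F).

Definition is_F_translate (tau : functor under_cat over_cat) : Prop :=
  exists tau' : functor over_cat under_cat,
    [/\ is_quasi_inverse tau tau',
        dual_iso (comp_functor tau' (quot_functor M (F_inj F)))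
                 (quot_functor M (F_proj F)) &
        dual_iso (quot_functor M (F_inj F))
                 (comp_functor tau (quot_functor M (F_proj F)))].

End Duality.

(* Main.v *)
(* A class in Ext^n(X, Y) is a cocycle P_n -> Y on a projective resolution of *)
(* X, and the n-Auslander-Reiten translate T of X carries a form on           *)
(* Hom(P_n, T) which identifies the dual of Ext^n(X, Y) with Hom(Y, T) modulo *)
(* injectives. The classes of F-exact sequences are exactly those killed by   *)
(* an F-exact embedding of Y into an F-injective, so the maps of Hom(Y, T)    *)
(* orthogonal to F(X, Y) are those factoring through F-injectives. Hence the  *)
(* map T -> T' dual to f : X -> X' is well defined modulo F-injectives.       *)
(* Testing on F-exact sequences with an F-projective term next to X' shows    *)
(* that this assignment is full, and faithful modulo F-projectives; it is     *)
(* dense because every object of M is such a T. For uniqueness, a second      *)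
(* translate U of X yields a functional on F(X, U), which is represented by a *)
(* map U -> T.                                                                *)

From HB Require Import structures.
From Stdlib Require Import Relation_Operators.
From mathcomp Require Import all_boot all_order all_algebra.
From mathcomp Require Import boolp classical_sets ring.
Require Import Defs.

Set Implicit Arguments.
Unset Strict Implicit.
Unset Printing Implicit Defensive.

Import GRing.Theory.
Local Open Scope ring_scope.

(** * Linear maps and submodules *)

(** Write n+1 for the cluster tilting index. For X in M with free resolution P, put T = ker(nu
    P_{n+1} -> nu P_n), where nu P = D Hom(P, Lam) is modelled by [J m] = D(Lam^m). The trace
    pairing [jpair] identifies Hom(V, nu P) with D Hom(P, V). Composing with the inclusion T -> nu
    P_{n+1} gives a form on Hom(P_{n+1}, T) under which Hom(Y, T), modulo maps through injectives,
    is dual to Ext^{n+1}(X, Y); this is bundled as [ar_data]. Vanishing of the intermediate Ext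
    groups puts T in M, and the same construction run backwards from an injective coresolution shows
    that every object of M is such a T ([ar_forward], [ar_backward]).

    To reach F, n-exact sequences are compared with cocycles on P_{n+1} ([class]). A cocycle that
    dies in the first middle term of an n-exact sequence comes from a pullback of it. As F has
    enough injectives, the classes of F-exact sequences in Ext(X, Y) are therefore those killed by
    an F-exact embedding of Y into an F-injective. Dually, functionals on Hom(Y, T) vanishing on
    maps through F-injectives are given by F-exact sequences ([F_represents]), and a map orthogonal
    to all F-classes factors through an F-injective ([F_classes_separate]). The pullbacks are built
    from approximations of iterated fibers ([pullback_complex], [n_pullback_ex]).

    The action of f : X -> X' on classes has a dual map T -> T' ([is_tau]), unique modulo
    injectives. It passes to the quotient categories because the translate of an F-projective is
    F-injective ([F_injective_translate]); F-exact sequences with an F-projective term next to X'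
    make it full and faithful ([tau_full], [tau_faithful]). The isomorphism involving the
    quasi-inverse is transported along the equivalence ([dual_iso_transport]). Uniqueness is a
    Yoneda argument: the functional on F(X, U) attached to the identity of a second translate U is
    represented by a map U -> T ([pairing_represents], [dual_iso_uniq]).

    The input from commutative algebra is that R and E have finite length and that End(E) consists
    of the scalars ([artinian_finite_chain], [injective_noetherian], [endo_scalar]), whence the
    biduality principle [pairing_represent]. *)

Lemma linear_ext (S : nzRingType) (V W : lmodType S) (f g : {linear V -> W}) :
  f =1 g -> f = g.
Proof.
case: f g => [f [[fa] [fb]]] [g [[ga] [gb]]] /= fg.
have {}fg : f = g by apply: funext.
by subst g; rewrite (Prop_irrelevance fa ga) (Prop_irrelevance fb gb).
Qed.

Section HomGroup.
Variables (S : nzRingType) (V W : lmodType S).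
Implicit Types f g : {linear V -> W}.

HB.instance Definition _ := gen_eqMixin {linear V -> W}.
HB.instance Definition _ := gen_choiceMixin {linear V -> W}.

Definition hom_add f g : {linear V -> W} := f \+ g.

Fact hom_addA : associative hom_add.
Proof. by move=> f g h; apply: linear_ext => x; apply: addrA. Qed.

Fact hom_addC : commutative hom_add.
Proof. by move=> f g; apply: linear_ext => x; apply: addrC. Qed.

Fact hom_add0 : left_id (\0 : {linear V -> W}) hom_add.
Proof. by move=> f; apply: linear_ext => x; apply: add0r. Qed.

Fact hom_addN :
  left_inverse (\0 : {linear V -> W}) (fun f => \- f : {linear V -> W}) hom_add.
Proof. by move=> f; apply: linear_ext => x; apply: addNr. Qed.

HB.instance Definition _ :=
  GRing.isZmodule.Build {linear V -> W} hom_addA hom_addC hom_add0 hom_addN.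

Lemma hom_addE f g x : (f + g) x = f x + g x. Proof. by []. Qed.
Lemma hom_oppE f x : (- f) x = - f x. Proof. by []. Qed.
Lemma hom_subE f g x : (f - g) x = f x - g x. Proof. by []. Qed.
Lemma hom_0E x : (0 : {linear V -> W}) x = 0. Proof. by []. Qed.
End HomGroup.

Section MkLinear.
Variables (S : nzRingType) (V W : lmodType S) (f : V -> W) (lin_f : linear f).
Definition mk_linear_fun of linear f := f.
HB.instance Definition _ :=
  GRing.isLinear.Build S V W _ (mk_linear_fun lin_f) lin_f.
Definition mk_linear : {linear V -> W} := mk_linear_fun lin_f.
Lemma mk_linearE x : mk_linear x = f x. Proof. by []. Qed.
End MkLinear.
Arguments mk_linear_fun {S V W f} lin_f _ /.

Section Submodules.
Variable S : nzRingType.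
Implicit Types L N V W : lmodType S.

Record submodule V := Submodule {
  sub_pred :> V -> Prop;
  sub0 : sub_pred 0;
  subD : forall x y, sub_pred x -> sub_pred y -> sub_pred (x + y);
  subZ : forall a x, sub_pred x -> sub_pred (a *: x) }.

Lemma subN V (U : submodule V) x : U x -> U (- x).
Proof. by move=> Ux; rewrite -scaleN1r; apply: subZ. Qed.

Lemma subB V (U : submodule V) x y : U x -> U y -> U (x - y).
Proof. by move=> Ux Uy; apply: subD => //; apply: subN. Qed.

Lemma sub_sum V (U : submodule V) m (f : 'I_m -> V) :
  (forall i, U (f i)) -> U (\sum_i f i).
Proof.
by move=> Uf; elim/big_ind: _ => //; [apply: sub0 | move=> x y; apply: subD].
Qed.

Lemma submodule_eq V (U U' : submodule V) : (forall x, U x <-> U' x) -> U = U'.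
Proof.
case: U U' => [U a b c] [U' a' b' c'] /= eqU.
have {}eqU : U = U' by apply: funext => x; rewrite propeqE.
by subst U'; congr Submodule; apply: Prop_irrelevance.
Qed.

Definition whole V : submodule V :=
  @Submodule V (fun=> True) I (fun _ _ _ _ => I) (fun _ _ _ => I).

Section KernelImage.
Variables (V W : lmodType S) (f : {linear V -> W}).

Definition lker_sub : submodule V.
Proof.
apply: (@Submodule V (fun x => f x = 0)); first exact: linear0.
- by move=> x y fx fy; rewrite linearD fx fy addr0.
- by move=> a x fx; rewrite linearZ /= fx scaler0.
Defined.

Definition limage : submodule W.
Proof.
apply: (@Submodule W (fun y => exists x, f x = y)).
- by exists 0; exact: linear0.
- by move=> _ _ [x <-] [y <-]; exists (x + y); rewrite linearD.
- by move=> a _ [x <-]; exists (a *: x); rewrite linearZ.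
Defined.

Definition preim_sub (U : submodule W) : submodule V.
Proof.
apply: (@Submodule V (fun x => U (f x))).
- by rewrite linear0; apply: sub0.
- by move=> x y Ux Uy; rewrite linearD; apply: subD.
- by move=> a x Ux; rewrite linearZ; apply: subZ.
Defined.
End KernelImage.

Record sub_of V (U : submodule V) := SubOf { sub_val : V; sub_valP : U sub_val }.

Section SubModule.
Variables (V : lmodType S) (U : submodule V).
Implicit Types x y : sub_of U.

Lemma sub_val_inj : injective (@sub_val V U).
Proof.
by move=> [x Ux] [y Uy] /= xy; subst y; rewrite (Prop_irrelevance Ux Uy).
Qed.

HB.instance Definition _ := gen_eqMixin (sub_of U).
HB.instance Definition _ := gen_choiceMixin (sub_of U).

Definition sub_zero : sub_of U := SubOf (sub0 U).
Definition sub_opp x : sub_of U := SubOf (subN (sub_valP x)).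
Definition sub_add x y : sub_of U := SubOf (subD (sub_valP x) (sub_valP y)).
Definition sub_scale a x : sub_of U := SubOf (subZ a (sub_valP x)).

Fact sub_addA : associative sub_add.
Proof. by move=> x y z; apply: sub_val_inj; apply: addrA. Qed.
Fact sub_addC : commutative sub_add.
Proof. by move=> x y; apply: sub_val_inj; apply: addrC. Qed.
Fact sub_add0 : left_id sub_zero sub_add.
Proof. by move=> x; apply: sub_val_inj; apply: add0r. Qed.
Fact sub_addN : left_inverse sub_zero sub_opp sub_add.
Proof. by move=> x; apply: sub_val_inj; apply: addNr. Qed.
HB.instance Definition _ :=
  GRing.isZmodule.Build (sub_of U) sub_addA sub_addC sub_add0 sub_addN.

Fact sub_scaleA a b x : sub_scale a (sub_scale b x) = sub_scale (a * b) x.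
Proof. by apply: sub_val_inj; apply: scalerA. Qed.
Fact sub_scale1 : left_id 1 sub_scale.
Proof. by move=> x; apply: sub_val_inj; apply: scale1r. Qed.
Fact sub_scaleDr : right_distributive sub_scale +%R.
Proof. by move=> a x y; apply: sub_val_inj; apply: scalerDr. Qed.
Fact sub_scaleDl x : {morph sub_scale^~ x : a b / a + b}.
Proof. by move=> a b; apply: sub_val_inj; apply: scalerDl. Qed.
HB.instance Definition _ := GRing.Zmodule_isLmodule.Build S (sub_of U)
  sub_scaleA sub_scale1 sub_scaleDr sub_scaleDl.

Fact sub_val_linear : linear (@sub_val V U). Proof. by []. Qed.
HB.instance Definition _ :=
  GRing.isLinear.Build S (sub_of U) V _ (@sub_val V U) sub_val_linear.
Definition sub_incl : {linear sub_of U -> V} := @sub_val V U.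

Lemma sub_incl_inj : injective sub_incl. Proof. exact: sub_val_inj. Qed.

Lemma sub_inclP x : U (sub_incl x). Proof. exact: sub_valP. Qed.

Lemma sub_inclE v : U v -> exists x, sub_incl x = v.
Proof. by move=> Uv; exists (SubOf Uv). Qed.

Lemma factor_sub W (f : {linear W -> V}) : (forall w, U (f w)) ->
  exists g : {linear W -> sub_of U}, forall w, f w = sub_incl (g w).
Proof.
move=> Uf; have lin_g : linear (fun w => SubOf (Uf w)).
  by move=> a x y; apply: sub_val_inj; rewrite /= linearP.
by exists (mk_linear lin_g).
Qed.
End SubModule.
Arguments sub_incl {V U}.

(** The value at y is that of [g] at a chosen preimage of y; the hypothesis is exactly independence
    of the choice. No quotient modules are formed in this development: images of maps with a
    prescribed kernel replace them. *)
Lemma factor_image V W W' (f : {linear V -> W}) (g : {linear V -> W'}) :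
  (forall x, f x = 0 -> g x = 0) ->
  exists h : {linear sub_of (limage f) -> W'},
    forall x (y : sub_of (limage f)), sub_incl y = f x -> h y = g x.
Proof.
move=> fg; have [s sP] := choice (fun y : sub_of (limage f) => sub_valP y).
have sg x y : sub_incl y = f x -> g (s y) = g x.
  move=> yx; apply/eqP; rewrite -subr_eq0 -linearB; apply/eqP; apply: fg.
  by rewrite linearB /= sP -yx subrr.
have lin_h : linear (fun y => g (s y)).
  by move=> a x y; rewrite -linearP; apply: sg; rewrite [RHS]linearP /= !sP.
by exists (mk_linear lin_h) => x y; apply: sg.
Qed.

Lemma factor_surj V W W' (f : {linear V -> W}) (g : {linear V -> W'}) :
  (forall y, exists x, f x = y) -> (forall x, f x = 0 -> g x = 0) ->
  exists h : {linear W -> W'}, forall x, h (f x) = g x.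
Proof.
move=> f_onto /factor_image[h hP].
have [k kP] := factor_sub (U := limage f) (f := idfun) f_onto.
by exists (h \o k) => x /=; apply: hP; rewrite -kP.
Qed.

Lemma factor_inj V W W' (f : {linear V -> W}) (g : {linear W' -> W}) :
  injective f -> (forall x, exists y, f y = g x) ->
  exists h : {linear W' -> V}, forall x, f (h x) = g x.
Proof.
move=> f_inj /choice[h hP].
have lin_h : linear h.
  by move=> a x y; apply: f_inj; rewrite hP !linearP /= !hP.
by exists (mk_linear lin_h) => x; apply: hP.
Qed.

Lemma bij_lin_iso V W (f : {linear V -> W}) :
  injective f -> (forall y, exists x, f x = y) ->
  exists h : lin_iso V W, forall x, h x = f x.
Proof.
move=> f_inj f_onto; have [g gP] := factor_inj (g := idfun) f_inj f_onto.
have fK : cancel f g by move=> x; apply: f_inj; rewrite gP.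
by exists (LinIso fK gP).
Qed.

(** Spans are defined by recursion on the list of generators, so that finiteness arguments become
    inductions on that list. *)
Fixpoint lspan V (s : seq V) (v : V) : Prop :=
  if s is x :: s' then exists a w, lspan s' w /\ v = a *: x + w else v = 0.

Lemma lspan0 V (s : seq V) : lspan s 0.
Proof.
by elim: s => //= x s IHs; exists 0, 0; rewrite scale0r addr0.
Qed.

Lemma lspanD V (s : seq V) v w : lspan s v -> lspan s w -> lspan s (v + w).
Proof.
elim: s v w => [|x s IHs] v w /=; first by move=> -> ->; rewrite addr0.
move=> [a [v' [sv ->]]] [b [w' [sw ->]]]; exists (a + b), (v' + w').
by split; [apply: IHs | rewrite scalerDl addrACA].
Qed.

Lemma lspanZ V (s : seq V) a v : lspan s v -> lspan s (a *: v).
Proof.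
elim: s v => [|x s IHs] v /=; first by move=> ->; rewrite scaler0.
move=> [b [v' [sv ->]]]; exists (a * b), (a *: v').
by split; [apply: IHs | rewrite scalerDr scalerA].
Qed.

Definition lspan_sub V (s : seq V) : submodule V :=
  Submodule (lspan0 s) (@lspanD V s) (@lspanZ V s).

Lemma lspan_mem V (s : seq V) x : x \in s -> lspan s x.
Proof.
elim: s => //= y s IHs; rewrite inE => /predU1P[->|/IHs sx].
  by exists 1, 0; rewrite scale1r addr0; split=> //; apply: lspan0.
by exists 0, x; rewrite scale0r add0r.
Qed.

Lemma lspan_least V (U : submodule V) (s : seq V) v :
  (forall x, x \in s -> U x) -> lspan s v -> U v.
Proof.
elim: s v => [|x s IHs] v Us /=; first by move=> ->; apply: sub0.
move=> [a [w [sw ->]]]; apply: subD; first by apply: subZ; apply: Us; rewrite inE eqxx.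
by apply: IHs sw => y ys; apply: Us; rewrite inE ys orbT.
Qed.

Lemma fin_genP V : fin_gen V <-> exists s : seq V, forall v, lspan s v.
Proof.
split=> [[m [e eP]]|[s sP]].
  exists (codom e) => v; have [c ->] := eP v.
  apply: (sub_sum (U := lspan_sub _)) => i; apply: lspanZ; apply: lspan_mem.
  exact: codom_f.
exists (size s), (fun i => s`_i) => v; move: (sP v); elim: s v {sP} => [|x s IHs] v /=.
  by move=> ->; exists (fun=> 0); rewrite big_ord0.
move=> [a [w [/IHs[c ->] ->]]].
exists (fun i => oapp c a (unlift ord0 i)).
rewrite big_ord_recl unlift_none /=; congr (_ + _).
by apply: eq_bigr => i _; rewrite liftK.
Qed.

Definition fin_gen_sub V (U : submodule V) : Prop :=
  exists s : seq V, (forall x, x \in s -> U x) /\ forall v, U v -> lspan s v.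

Definition noetherian V : Prop := forall U : submodule V, fin_gen_sub U.

Lemma lspan_image V W (f : {linear V -> W}) (s : seq V) v :
  lspan s v -> lspan (map f s) (f v).
Proof.
elim: s v => [|x s IHs] v /=; first by move=> ->; rewrite linear0.
by move=> [a [w [/IHs sw ->]]]; exists a, (f w); rewrite linearD linearZ.
Qed.

Lemma fin_gen_submodule V (U : submodule V) :
  fin_gen_sub U -> fin_gen (sub_of U).
Proof.
move=> [s [sU Us]]; apply/fin_genP.
have [t tP] : exists t : seq (sub_of U), map (@sub_incl V U) t = s.
  elim: s sU {Us} => [|x s IHs] sU; first by exists [::].
  have [|t <-] := IHs; first by move=> y ys; apply: sU; rewrite inE ys orbT.
  have [|y <-] := @sub_inclE _ U x; first by apply: sU; rewrite inE eqxx.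
  by exists (y :: t).
exists t => v; have := Us _ (sub_inclP v); rewrite -tP.
elim: t v {tP} => [|x t IHt] v /=.
  by move=> v0; apply: sub_incl_inj; rewrite /= v0.
move=> [a [w [tw vE]]]; exists a, (v - a *: x).
split; last by rewrite addrC subrK.
by apply: IHt; rewrite linearB linearZ /= vE ?scalerN addrAC subrr add0r.
Qed.

Lemma fin_gen_image V W (f : {linear V -> W}) :
  (forall y, exists x, f x = y) -> fin_gen V -> fin_gen W.
Proof.
move=> f_onto /fin_genP[s sP]; apply/fin_genP; exists (map f s) => y.
by have [x <-] := f_onto y; apply: lspan_image.
Qed.

Lemma noetherian_fin_gen V : noetherian V -> fin_gen V.
Proof. by move=> /(_ (whole V))[s [_ sP]]; apply/fin_genP; exists s => v; apply: sP. Qed.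

Lemma noetherian_inj V W (f : {linear V -> W}) :
  injective f -> noetherian W -> noetherian V.
Proof.
move=> f_inj noethW U.
pose fU := limage (f \o @sub_incl V U : {linear _ -> _}).
have [s [sU Us]] := noethW fU.
have [t [tU ts]] : exists t : seq V, (forall x, x \in t -> U x) /\ map f t = s.
  elim: s sU {Us} => [|y s IHs] sU; first by exists [::].
  have [|t [tU <-]] := IHs; first by move=> z zs; apply: sU; rewrite inE zs orbT.
  have [|x <-] := sU y; first by rewrite inE eqxx.
  exists (sub_incl x :: t); split=> // z; rewrite inE => /predU1P[->|/tU//].
  exact: sub_inclP.
exists t; split=> // v Uv.
have {}Us : lspan s (f v) by apply: Us; exists (SubOf Uv).
rewrite -{}ts in Us; elim: t v {tU Uv} Us => [|x t IHt] v /=.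
  by move=> fv; apply: f_inj; rewrite fv linear0.
move=> [a [w [tw vE]]]; exists a, (v - a *: x).
split; last by rewrite addrC subrK.
by apply: IHt; rewrite linearB linearZ /= vE addrAC subrr add0r.
Qed.

Lemma noetherian_image V W (f : {linear V -> W}) :
  (forall y, exists x, f x = y) -> noetherian V -> noetherian W.
Proof.
move=> f_onto noethV U; have [s [sU Us]] := noethV (preim_sub f U).
exists (map f s); split=> [y /mapP[x /sU Ux ->] //|y Uy].
by have [x xy] := f_onto y; rewrite -xy; apply: lspan_image; apply: Us; rewrite /= xy.
Qed.

(** Let [K] collect the N-components of elements of [U]. Lifts to [U] of generators of [K], together
    with generators of the part of [U] coming from N', generate [U]. *)
Lemma noetherian_add (N N' V : lmodType S) (f : {linear N -> V}) (g : {linear N' -> V}) :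
  noetherian N -> noetherian N' -> (forall v, exists x y, v = f x + g y) ->
  noetherian V.
Proof.
move=> noethN noethN' gen U.
have [K KE] : exists K : submodule N,
    forall x, K x <-> exists y, U (f x + g y).
  suff [] : exists K : submodule N,
    sub_pred K = (fun x => exists y, U (f x + g y)) by move=> K KE; exists K; rewrite KE.
  unshelve eexists (@Submodule N _ _ _ _); last reflexivity.
  - by exists 0; rewrite !linear0 addr0; apply: sub0.
  - move=> x x' [y Uy] [y' Uy']; exists (y + y').
    by rewrite !linearD addrACA; apply: subD.
  - by move=> a x [y Uy]; exists (a *: y); rewrite !linearZ -scalerDr; apply: subZ.
have [s [sK Ks]] := noethN K; have [t [tU Ut]] := noethN' (preim_sub g U).
have [r [rU rs]] : exists r : seq V, (forall x, x \in r -> U x) /\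
    forall x, lspan s x -> exists y, lspan r (f x + g y).
  elim: s sK {Ks} => [|x s IHs] sK.
    by exists [::]; split=> // x ->; exists 0; rewrite !linear0 addr0.
  have [|r [rU rs]] := IHs; first by move=> z zs; apply: sK; rewrite inE zs orbT.
  have /KE[y Uy] : K x by apply: sK; rewrite inE eqxx.
  exists ((f x + g y) :: r); split=> [z|_ /= [a [w [/rs[y' rw] ->]]]].
    by rewrite inE => /predU1P[->|/rU].
  exists (a *: y + y'), a, (f w + g y'); split=> //.
  by rewrite !linearP scalerDr addrACA.
exists (r ++ map g t); split=> [x|v Uv].
  by rewrite mem_cat => /orP[/rU//|/mapP[y /tU Uy ->]].
have [x [y vE]] := gen v; have /Ks/rs[y' rw] : K x by apply/KE; exists y; rewrite -vE.
have rsub z : lspan r z -> U z by apply: lspan_least.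
have Uy : U (g (y - y')).
  have -> : g (y - y') = v - (f x + g y') by rewrite vE linearB opprD addrACA subrr add0r.
  exact: subB (rsub _ rw).
have -> : v = (f x + g y') + g (y - y') by rewrite vE linearB addrACA subrr addr0.
apply: lspanD.
  by apply: (lspan_least (U := lspan_sub (r ++ map g t))) rw => z rz;
    apply: lspan_mem; rewrite mem_cat rz.
apply: (lspan_least (U := lspan_sub (r ++ map g t))) (lspan_image g (Ut _ Uy)) => z tz.
by apply: lspan_mem; rewrite mem_cat tz orbT.
Qed.

End Submodules.
Arguments sub_incl {S V U}.

(** * Commutative artinian rings *)

Section ArtinianRing.
Variable R : comNzRingType.
Hypothesis artR : artinian R.
Implicit Types (I J m : R -> Prop) (V : lmodType R).

Lemma ideal0 I : is_ideal I -> I 0. Proof. by case. Qed.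

Lemma idealD I x y : is_ideal I -> I x -> I y -> I (x + y).
Proof. by case=> _ + _; apply. Qed.

Lemma idealM I a x : is_ideal I -> I x -> I (a * x).
Proof. by case=> _ _; apply. Qed.

Lemma idealN I x : is_ideal I -> I x -> I (- x).
Proof. by move=> idI Ix; rewrite -mulN1r; apply: idealM. Qed.

Lemma idealB I x y : is_ideal I -> I x -> I y -> I (x - y).
Proof. by move=> idI Ix Iy; apply: idealD => //; apply: idealN. Qed.

(** Without a minimal member, choice would iterate to a strictly descending sequence of ideals. *)
Lemma minimal_ideal (F : (R -> Prop) -> Prop) :
  (forall I, F I -> is_ideal I) -> (exists I, F I) ->
  exists I, F I /\ forall J, F J -> (forall x, J x -> I x) -> forall x, I x -> J x.
Proof.
move=> idF [I0 FI0]; apply: contrapT => noMin.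
have next (I : {I | F I}) : exists J : {I | F I},
    (forall x, sval J x -> sval I x) /\ exists x, sval I x /\ ~ sval J x.
  case: I => I FI /=; apply: contrapT => noJ; apply: noMin; exists I; split=> // J FJ JI x Ix.
  apply: contrapT => nJx; apply: noJ; exists (exist _ J FJ); split=> //.
  by exists x.
have [g gP] := choice next.
pose s k := sval (iter k g (exist _ I0 FI0)).
have [||k sk] := @artR s.
- by move=> k; apply: idF; apply: svalP.
- by move=> k x; apply: (gP _).1.
have [x [sx nsx]] := (gP (iter k g (exist _ I0 FI0))).2.
by apply: nsx; apply: (sk k.+1).
Qed.

Lemma maximal_inverse m x : is_maximal_ideal m -> ~ m x -> exists s, m (1 - s * x).
Proof.
move=> [idm m1 maxm] nmx; pose J y := exists s, m (y - s * x).
have idJ : is_ideal J.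
  split; first by exists 0; rewrite mul0r subr0; apply: ideal0.
  - move=> y z [s sy] [t tz]; exists (s + t).
    by rewrite mulrDl opprD addrACA; apply: idealD.
  - by move=> a y [s sy]; exists (a * s); rewrite -mulrA -mulrBr; apply: idealM.
apply: contrapT => nJ1; apply: nmx; apply: (maxm J) => //.
  by move=> y my; exists 0; rewrite mul0r subr0.
by exists 1; rewrite mul1r subrr; apply: ideal0.
Qed.

Lemma maximal_prime m x y : is_maximal_ideal m -> m (x * y) -> m x \/ m y.
Proof.
move=> maxm mxy; have idm : is_ideal m by case: maxm.
apply: contrapT => /not_orP[/(maximal_inverse maxm)[s ms] nmy]; apply: nmy.
have -> : y = y * (1 - s * x) + s * (x * y) by ring.
by apply: idealD => //; apply: idealM.
Qed.

(* An ideal minimal among those strictly containing [I] is simple modulo [I]; *)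
(* the maximal ideal is the annihilator of this simple module.                *)
Lemma exists_maximal I : is_ideal I -> ~ I 1 ->
  exists m, is_maximal_ideal m /\ forall x, I x -> m x.
Proof.
move=> idI nI1.
have [||B [[idB IB [b [Bb nIb]]] minB]] := @minimal_ideal
    (fun B => [/\ is_ideal B, forall x, I x -> B x & exists b, B b /\ ~ I b]).
- by move=> B [].
- by exists (fun=> True); split=> //; exists 1.
have idm : is_ideal (fun r => I (r * b)).
  split; first by rewrite mul0r; apply: ideal0.
  - by move=> x y Ix Iy; rewrite mulrDl; apply: idealD.
  - by move=> a x Ix; rewrite -mulrA; apply: idealM.
exists (fun r => I (r * b)); split; last by move=> x Ix; rewrite mulrC; apply: idealM.
split=> //; first by rewrite mul1r.
move=> J idJ mJ nJ1 x Jx; apply: contrapT => nIxb; apply: nJ1.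
have [||t It] := minB (fun y => exists t, I (y - t * (x * b))) _ _ b Bb.
- split.
  + split; first by exists 0; rewrite mul0r subr0; apply: ideal0.
    * move=> y z [s sy] [t tz]; exists (s + t).
      by rewrite mulrDl opprD addrACA; apply: idealD.
    * by move=> a y [s sy]; exists (a * s); rewrite -mulrA -mulrBr; apply: idealM.
  + by move=> y Iy; exists 0; rewrite mul0r subr0.
  + by exists (x * b); split=> //; exists 1; rewrite mul1r subrr; apply: ideal0.
- move=> y [t It]; rewrite -[y](subrK (t * (x * b))).
  by apply: idealD => //; [apply: IB | apply: idealM => //; apply: idealM].
have m1 : J (1 - t * x).
  by apply: mJ; rewrite (_ : (1 - t * x) * b = b - t * (x * b)) //; ring.
by rewrite -(subrK (t * x) 1); apply: idealD => //; apply: idealM.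
Qed.

Definition ideal_mul I J x : Prop :=
  forall K, is_ideal K -> (forall a b, I a -> J b -> K (a * b)) -> K x.

Lemma ideal_mul_ideal I J : is_ideal (ideal_mul I J).
Proof.
split; first by move=> K idK _; apply: ideal0.
- by move=> x y Hx Hy K idK IJK; apply: idealD => //; [apply: Hx | apply: Hy].
- by move=> a x Hx K idK IJK; apply: idealM => //; apply: Hx.
Qed.

Lemma ideal_mul_mem I J a b : I a -> J b -> ideal_mul I J (a * b).
Proof. by move=> Ia Jb K _; apply. Qed.

Lemma ideal_mulr I J x : is_ideal J -> ideal_mul I J x -> J x.
Proof. by move=> idJ; apply=> // a b _ Jb; apply: idealM. Qed.

Lemma ideal_mull I J x : is_ideal I -> ideal_mul I J x -> I x.
Proof. by move=> idI; apply=> // a b Ia _; rewrite mulrC; apply: idealM. Qed.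

Lemma zero_ideal : is_ideal (fun x : R => x = 0).
Proof.
split=> // [x y -> ->|a x ->]; first exact: addr0.
exact: mulr0.
Qed.

(** Finite products of maximal ideals, as an inductive predicate so that facts about them follow by
    induction on the number of factors. *)
Inductive max_product : (R -> Prop) -> Prop :=
| max_product0 : max_product (fun=> True)
| max_productS m I : is_maximal_ideal m -> max_product I ->
    max_product (ideal_mul m I).

Lemma max_product_ideal I : max_product I -> is_ideal I.
Proof. by case=> [|m J _ _]; [split | apply: ideal_mul_ideal]. Qed.

(* If [I = m I] for every maximal ideal [m], for a minimal product [I] of     *)
(* maximal ideals, then [I = I I] lies in every maximal ideal; an ideal [A]   *)
(* minimal with [A I <> 0] is then of the form [a I], so [a = a j] with       *)
(* [1 - j] invertible.                                                        *)
Lemma max_product_zero : exists I, max_product I /\ forall x, I x -> x = 0.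
Proof.
have [|I [maxI minI]] := minimal_ideal max_product_ideal.
  by exists (fun=> True); apply: max_product0.
have idI := max_product_ideal maxI.
have ImI m : is_maximal_ideal m -> forall x, I x -> ideal_mul m I x.
  move=> maxm; apply: minI; first exact: max_productS.
  by move=> x; apply: ideal_mulr.
have IJI J : max_product J -> forall x, I x -> ideal_mul J I x.
  elim=> [x Ix|m J' maxm _ IHJ x Ix]; first by rewrite -[x]mul1r; apply: ideal_mul_mem.
  apply: (ImI m maxm x Ix); first exact: ideal_mul_ideal.
  move=> a b ma Ib; apply: (IHJ b Ib (fun b => ideal_mul (ideal_mul m J') I (a * b))).
    have [K0 KD KM] := ideal_mul_ideal (ideal_mul m J') I.
    split; first by rewrite mulr0.
    - by move=> y z Ky Kz; rewrite mulrDr; apply: KD.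
    - by move=> c y Ky; rewrite mulrCA; apply: KM.
  move=> c d Jc Id; rewrite mulrA; apply: ideal_mul_mem => //.
  exact: ideal_mul_mem.
exists I; split=> // x Ix; apply: contrapT => nx0.
have [||A [[idA [a [i [Aa Ii ai]]]] minA]] := @minimal_ideal
    (fun A => is_ideal A /\ exists a i, [/\ A a, I i & a * i <> 0]).
- by move=> A [].
- exists I; split=> //; apply: contrapT => nI; apply: nx0.
  apply: (IJI I maxI x Ix _ zero_ideal) => a b Ia Ib.
  by apply: contrapT => nab; apply: nI; exists a, b.
have [j [Ij aj]] : exists j, I j /\ a = a * j.
  apply: (minA (fun y => exists j, I j /\ y = a * j) _ _ _ (Aa)); last first.
    by move=> _ [j [Ij ->]]; rewrite mulrC; apply: idealM.
  split.
    split; first by exists 0; rewrite mulr0; split=> //; apply: ideal0.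
    - move=> _ _ [j [Ij ->]] [k [Ik ->]]; exists (j + k); rewrite mulrDr.
      by split=> //; apply: idealD.
    - by move=> c _ [j [Ij ->]]; exists (c * j); rewrite mulrCA; split=> //; apply: idealM.
  apply: contrapT => nj; apply: ai.
  apply: (IJI I maxI i Ii (fun y => a * y = 0)).
    split; first exact: mulr0.
    - by move=> y z ay az; rewrite mulrDr ay az addr0.
    - by move=> c y ay; rewrite mulrCA ay mulr0.
  move=> j k Ij Ik; apply: contrapT => najk; apply: nj.
  by exists (a * j), k; split=> //; [exists j | rewrite -mulrA].
have [s sj] : exists s, s * (1 - j) = 1.
  apply: contrapT => nunit.
  have [||m [maxm jm]] := @exists_maximal (fun y => exists s, s * (1 - j) = y).
  - split; first by exists 0; rewrite mul0r.
    + by move=> _ _ [s <-] [t <-]; exists (s + t); rewrite mulrDl.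
    + by move=> c _ [s <-]; exists (c * s); rewrite mulrA.
  - by [].
  - have [idm m1 _] := maxm; apply: m1; rewrite -(subrK j 1).
    apply: idealD => //; first by apply: jm; exists 1; rewrite mul1r.
    exact: ideal_mull (ImI m maxm j Ij).
apply: ai; rewrite (_ : a = 0) ?mul0r //.
by rewrite -[a]mul1r -sj -mulrA mulrBl mul1r [j * a]mulrC -aj subrr mulr0.
Qed.

(* a composition series with factors [R / m] *)
Inductive finite_chain V : submodule V -> Prop :=
| finite_chain0 (U : submodule V) : (forall x, U x -> x = 0) -> finite_chain U
| finite_chainS (U U' : submodule V) (u : V) m : is_maximal_ideal m ->
    (forall x, U' x -> U x) -> U u -> (forall x, m x -> U' (x *: u)) ->
    (forall v, U v -> exists r w, U' w /\ v = r *: u + w) ->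
    finite_chain U' -> finite_chain U.

(** Induction along the chain: if some element of [A] has a coefficient along [u] outside m, that
    coefficient is invertible modulo m, so this element and generators of the part of [A] inside U'
    suffice; otherwise [A] already lies in U'. *)
Lemma finite_chain_noetherian V : finite_chain (whole V) -> noetherian V.
Proof.
move=> chainV A.
suff: exists s : seq V, (forall x, x \in s -> A x) /\
    forall v, A v -> whole V v -> lspan s v.
  by move=> [s [sA As]]; exists s; split=> // v Av; apply: As.
elim: chainV => {}V' => [U0|U' u m maxm _ Uu mu gen _ [s [sA As]]].
  by exists [::]; split=> // v _ /U0.
have idm : is_ideal m by case: maxm.
have [[a [r [w [Aa Ua U'w aE nmr]]]]|noa] := pselect (exists a r w,
    [/\ A a, V' a, U' w, a = r *: u + w & ~ m r]); last first.
  exists s; split=> // v Av Vv; apply: As => //; have [r [w [U'w vE]]] := gen v Vv.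
  rewrite vE; apply: subD => //; apply: mu; apply: contrapT => nmr; apply: noa.
  by exists v, r, w.
exists (a :: s); split=> [x|v Av Vv]; first by rewrite inE => /predU1P[->|/sA].
have [t [w' [U'w' vE]]] := gen v Vv; have [c mc] := maximal_inverse maxm nmr.
exists (t * c), (v - (t * c) *: a); split; last by rewrite addrC subrK.
apply: As; first by apply: subB => //; apply: subZ.
have -> : v - (t * c) *: a = (t * (1 - c * r)) *: u + (w' - (t * c) *: w).
  rewrite vE aE scalerDr opprD addrACA; congr (_ + _).
  by rewrite scalerA -scalerBl mulrBr mulr1 mulrA.
apply: subD; first by apply: mu; apply: idealM.
by apply: subB => //; apply: subZ.
Qed.

Definition sub_ideal I (idI : is_ideal I) : submodule R^o :=
  @Submodule R R^o I (ideal0 idI) (fun x y Ix Iy => idealD idI Ix Iy)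
    (fun a x Ix => idealM a idI Ix).

Lemma whole_eq V (U : submodule V) : (forall x, U x) -> U = whole V.
Proof. by move=> UT; apply: submodule_eq => x; split. Qed.

(* Between [m I] and [I] there is, by Zorn's lemma, a submodule maximal among *)
(* those avoiding a given [u]; it is a hyperplane.                            *)
Lemma hyperplane I m u : is_ideal I -> is_maximal_ideal m -> I u ->
    ~ ideal_mul m I u ->
  exists N, [/\ is_ideal N, ~ N u, forall x, N x -> I x,
    forall x, m x -> N (x * u) & forall v, I v -> exists r w, N w /\ v = r * u + w].
Proof.
move=> idI maxm Iu nmIu; have idmI := ideal_mul_ideal m I.
pose good N := [/\ is_ideal N, ~ N u & forall x, N x -> I x].
have [F Ftot|A [[idN nNu NI] maxA]] := @Zorn_bigcup R (fun A =>
    good (fun x => A x \/ ideal_mul m I x)).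
  move=> tot.
  have cases x : (\bigcup_(X in F) X)%classic x \/ ideal_mul m I x ->
      ideal_mul m I x \/ exists2 X, F X & X x.
    by move=> [[X FX Xx]|]; [right; exists X | left].
  have back X x : F X -> X x \/ ideal_mul m I x ->
      (\bigcup_(X in F) X)%classic x \/ ideal_mul m I x.
    by move=> FX [Xx|]; [left; exists X | right].
  split; first split.
  - by right; apply: ideal0.
  - move=> x y /cases[mx|[X FX Xx]] /cases[my|[Y FY Yy]].
    + by right; apply: (idealD idmI).
    + by refine (back Y _ FY _); have [idY _ _] := Ftot Y FY; apply: (idealD idY); [right|left].
    + by refine (back X _ FX _); have [idX _ _] := Ftot X FX; apply: (idealD idX); [left|right].
    + have [XY|YX] := tot X Y FX FY.
        have [idY _ _] := Ftot Y FY; refine (back Y _ FY _).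
        by apply: (idealD idY); left => //; apply: XY.
      have [idX _ _] := Ftot X FX; refine (back X _ FX _).
      by apply: (idealD idX); left => //; apply: YX.
  - move=> a x /cases[mx|[X FX Xx]]; first by right; apply: (idealM _ idmI).
    by refine (back X _ FX _); have [idX _ _] := Ftot X FX; apply: (idealM _ idX); left.
  - by move=> /cases[//|[X FX Xu]]; have [_ nXu _] := Ftot X FX; apply: nXu; left.
  - move=> x /cases[mx|[X FX Xx]]; first exact: ideal_mulr mx.
    by have [_ _ XI] := Ftot X FX; apply: XI; left.
set N := (fun x => A x \/ _) in idN nNu NI.
have mIN x : ideal_mul m I x -> N x by right.
exists N; split=> // [x mx|v Iv]; first by apply: mIN; apply: ideal_mul_mem.
have [Nv|nNv] := pselect (N v); first by exists 0, v; rewrite mul0r add0r.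
have [r [w [Nw uE]]] : exists r w, N w /\ u = w + r * v.
  apply: contrapT => no; pose B := fun x => exists r w, N w /\ x = w + r * v.
  have NB x : N x -> B x by exists 0, x; rewrite mul0r addr0.
  have mIB x : B x \/ ideal_mul m I x <-> B x by split=> [[//|/mIN/NB]|]; [|left].
  apply: (maxA B).
    split=> [|AB]; first by move=> x Ax; apply: NB; left.
    apply: nNv; left; apply: AB; exists 1, 0; rewrite mul1r add0r.
    by split=> //; apply: ideal0.
  rewrite (_ : (fun x => B x \/ ideal_mul m I x) = B); last first.
    by apply: funext => x; rewrite propeqE; apply: mIB.
  split; first split.
  - by apply: NB; apply: ideal0.
  - move=> _ _ [r [w [Nw ->]]] [s [t [Nt ->]]]; exists (r + s), (w + t).
    by rewrite mulrDl addrACA; split=> //; apply: idealD.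
  - move=> a _ [r [w [Nw ->]]]; exists (a * r), (a * w).
    by rewrite mulrDr mulrA; split=> //; apply: idealM.
  - by move=> [r [w H]]; apply: no; exists r, w.
  - by move=> _ [r [w [Nw ->]]]; apply: idealD => //; [apply: NI | apply: idealM].
have nmr : ~ m r.
  move=> mr; apply: nNu; rewrite uE; apply: (idealD idN) => //.
  by apply: mIN; apply: ideal_mul_mem.
have [s ms] := maximal_inverse maxm nmr.
exists s, ((1 - s * r) * v - s * w); split.
  by apply: (idealB idN); [apply: mIN; apply: ideal_mul_mem | apply: (idealM _ idN)].
by rewrite uE; ring.
Qed.

(** The series is built from the top: take I minimal among the ideals from which a chain down to
    zero would complete to a chain of R. If I is nonzero, some maximal m has m I distinct from I,
    since a product of maximal ideals vanishes; a hyperplane of I then contradicts minimality. *)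
Lemma artinian_finite_chain : finite_chain (whole R^o).
Proof.
have idT : is_ideal (fun _ : R => True) by split.
have [||I [[idI IR] minI]] := @minimal_ideal
    (fun I => exists idI : is_ideal I, finite_chain (sub_ideal idI) -> finite_chain (whole R^o)).
- by move=> I [].
- by exists (fun=> True), idT; rewrite (whole_eq (U := sub_ideal idT)).
apply: (IR); apply: finite_chain0 => x Ix; apply: contrapT => nx0.
have [m [maxm [u [Iu nmIu]]]] : exists m, is_maximal_ideal m /\ exists u, I u /\ ~ ideal_mul m I u.
  apply: contrapT => nom; apply: nx0; have [J [maxJ]] := max_product_zero; apply.
  suff: ideal_mul J I x by apply: ideal_mull; apply: max_product_ideal.
  elim: {J} maxJ x Ix => [x Ix|m J maxm _ IHJ x Ix].
    by rewrite -[x]mul1r; apply: ideal_mul_mem.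
  have: ideal_mul m I x.
    by apply: contrapT => nmx; apply: nom; exists m; split=> //; exists x.
  apply; first exact: ideal_mul_ideal.
  move=> a b ma Ib; apply: (IHJ b Ib (fun b => ideal_mul (ideal_mul m J) I (a * b))).
    have [K0 KD KM] := ideal_mul_ideal (ideal_mul m J) I.
    split; first by rewrite mulr0.
    - by move=> y z Ky Kz; rewrite mulrDr; apply: KD.
    - by move=> c y Ky; rewrite mulrCA; apply: KM.
  move=> c d Jc Id; rewrite mulrA; apply: ideal_mul_mem => //.
  exact: ideal_mul_mem.
have [N [idN nNu NI mN gen]] := hyperplane idI maxm Iu nmIu.
apply: nNu; refine (minI N _ NI u Iu); exists idN => chainN; apply: IR.
exact: (finite_chainS (U' := sub_ideal idN) (u := u : R^o) maxm).
Qed.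

Lemma artinian_noetherian : noetherian R^o.
Proof. exact: finite_chain_noetherian artinian_finite_chain. Qed.

End ArtinianRing.

(** * Injective envelopes over R *)

Section InjectiveCogenerator.
Variables (R : comNzRingType) (E : lmodType R).
Hypotheses (artR : artinian R) (dualE : is_dualizing E).
Implicit Types (V W : lmodType R) (I m : R -> Prop).

Lemma inj_E : injective_module E. Proof. by have [Q _ []] := dualE. Qed.

(** Take t in an ideal I minimal among those not contained in m. For any other maximal m', the
    intersection of I and m' is again not contained in m, because m is prime; by minimality t lies
    in m', so m t lies in every maximal ideal. *)
Lemma maximal_cover m : is_maximal_ideal m ->
  exists t, ~ m t /\ forall x, m x -> radical (x * t).
Proof.
move=> maxm; have idm : is_ideal m by case: maxm.
pose F I := is_ideal I /\ (exists t, I t /\ ~ m t).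
have [||I [[idI [t [It nmt]]] minI]] := minimal_ideal artR (F := F).
- by move=> I [].
- exists (fun=> True); split; first by split.
  by exists 1; split=> //; case: maxm.
exists t; split=> // x mx m' maxm'; have idm' : is_ideal m' by case: maxm'.
have [mm'|nmm'] := pselect (forall y, m y -> m' y).
  by rewrite mulrC; apply: idealM => //; apply: mm'.
have [y [m'y nmy]] : exists y, m' y /\ ~ m y.
  apply: contrapT => no; apply: nmm' => y my; case: maxm' => _ _ /(_ m); apply=> //.
    by move=> z m'z; apply: contrapT => nmz; apply: no; exists z.
  by case: maxm.
apply: idealM => //; apply: (minI (fun z => I z /\ m' z) _ _ t It).2 => [|z []//].
split; last first.
  exists (y * t); split; first by split; [apply: idealM | rewrite mulrC; apply: idealM].
  by move=> /(maximal_prime maxm)[].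
split; first by split; apply: ideal0.
- by move=> u v [Iu mu] [Iv mv]; split; apply: idealD.
- by move=> a u [Iu mu]; split; apply: idealM.
Qed.

(* The elements of [E] killed by [m] form a line: by essentiality they lie in *)
(* [R / rad R], where [m] has a one-dimensional annihilator.                  *)
Lemma socle_line m : is_maximal_ideal m ->
  exists e0 : E, [/\ e0 <> 0, forall x, m x -> x *: e0 = 0 &
    forall e : E, (forall x, m x -> x *: e = 0) -> exists r, e = r *: e0].
Proof.
move=> maxm; have idm : is_ideal m by case: maxm.
have [Q [q [q_onto q0]] [_ [j [j_inj ess]]]] := dualE.
have [t [nmt mt]] := maximal_cover maxm.
exists (j (q t)); split.
- move=> jqt; apply: nmt; apply: (iffLR (q0 t)) => //.
  by apply: j_inj; rewrite jqt linear0.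
- move=> x mx; rewrite -linearZ -linearZ.
  by rewrite (iffRL (q0 (x *: (t : R^o)))) ?linear0 //; apply: mt.
move=> e me; have [->|/eqP e0] := eqVneq e 0; first by exists 0; rewrite scale0r.
have [a [v [ae jv]]] := ess _ e0.
have nma : ~ m a by move=> /me ae0; apply: jv.
have [s ms] := maximal_inverse maxm nma.
have [w vE] := q_onto (s *: v); pose c := w : R.
have eE : e = j (q w).
  rewrite vE linearZ /= -ae scalerA -[LHS]scale1r -(subrK (s * a) 1) scalerDl.
  by rewrite me ?add0r.
have mw x : m x -> radical (x * c).
  move=> mx; apply: (iffLR (q0 (x *: w))); rewrite linearZ; apply: j_inj.
  by rewrite linearZ /= linear0 -eE me.
have [r mr] := maximal_inverse maxm nmt.
exists (r * c); rewrite eE -2!linearZ; congr (j _); apply/eqP.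
rewrite -subr_eq0 -linearB; apply/eqP; apply: (iffRL (q0 _)).
have -> : w - (r * c) *: (t : R^o) = (1 - r * t) * c.
  by rewrite mulrBl mul1r mulrAC.
exact: mw.
Qed.

Definition annih (U : submodule R^o) : submodule E.
Proof.
apply: (@Submodule R E (fun e => forall x, U x -> (x : R) *: e = 0)).
- by move=> x _; apply: scaler0.
- by move=> e f Ue Uf x Ux; rewrite scalerDr Ue // Uf // addr0.
- by move=> a e Ue x Ux; rewrite scalerA mulrC -scalerA Ue // scaler0.
Defined.

(** Multiplication by [u] sends [annih U'] into the elements of E killed by m, which form a line by
    [socle_line], and its kernel lies in [annih U]. So the annihilator grows either not at all or by
    one factor R/m. *)
Lemma annih_step (U U' : submodule R^o) (u : R) m : is_maximal_ideal m -> U u ->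
    (forall x, m x -> U' (x * u)) ->
    (forall v, U v -> exists r w, U' w /\ v = r * u + w) ->
  (forall e, annih U' e -> annih U e) \/
  exists e1, [/\ annih U' e1, forall x, m x -> annih U (x *: e1),
    forall e, annih U' e -> exists r w, annih U w /\ e = r *: e1 + w &
    forall e : E, (forall x, m x -> x *: e = 0) -> exists r, e = r *: (u *: e1)].
Proof.
move=> maxm Uu mu gen; have [e0 [e0n0 me0 e0gen]] := socle_line maxm.
have ann_gen e : annih U' e -> u *: e = 0 -> annih U e.
  move=> ann_e ue v /gen[r [w [U'w ->]]].
  by rewrite scalerDl -scalerA ue scaler0 add0r ann_e.
have [[e1 [ann1 ue1]]|no] := pselect (exists e1, annih U' e1 /\ u *: e1 <> 0); last first.
  by left=> e ann_e; apply: ann_gen => //; apply: contrapT => ue; apply: no; exists e.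
have kill e : annih U' e -> forall x, m x -> x *: (u *: e) = 0.
  by move=> ann_e x mx; rewrite scalerA; apply: ann_e; apply: mu.
right; have [r1 r1E] := e0gen _ (kill _ ann1).
have [s ms] : exists s, m (1 - s * r1).
  by apply: maximal_inverse => // mr1; apply: ue1; rewrite r1E me0.
have e0E : e0 = s *: (u *: e1).
  rewrite r1E scalerA -[LHS]scale1r -(subrK (s * r1) 1) scalerDl.
  by rewrite me0 ?add0r.
have line e : (forall x, m x -> x *: e = 0) -> exists r, e = r *: (u *: e1).
  by move=> /e0gen[r ->]; exists (r * s); rewrite e0E !scalerA.
have annm x : m x -> annih U (x *: e1).
  move=> mx; apply: ann_gen; first exact: subZ.
  by rewrite scalerA mulrC -scalerA kill.
exists e1; split=> // e ann_e; have [r rE] := line _ (kill _ ann_e).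
exists r, (e - r *: e1); split; last by rewrite addrC subrK.
apply: ann_gen; first by apply: subB => //; apply: subZ.
by rewrite scalerBr rE !scalerA [u * r]mulrC subrr.
Qed.

Lemma annih_whole e : annih (whole R^o) e -> e = 0.
Proof. by move=> ann_e; rewrite -[e]scale1r; apply: ann_e. Qed.

Lemma annih0 (U : submodule R^o) : (forall x, U x -> x = 0) -> annih U = whole E.
Proof. by move=> U0; apply: whole_eq => e x /U0 ->; apply: scale0r. Qed.

(** Taking annihilators turns a composition series of R into one of E, read in the opposite
    order. *)
Lemma injective_noetherian : noetherian E.
Proof.
apply: finite_chain_noetherian.
have: finite_chain (annih (whole R^o)) by apply: finite_chain0; apply: annih_whole.
elim: (artinian_finite_chain artR) => [U U0|U U' u m maxm U'U Uu mu gen _ IH chainU].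
  by rewrite annih0.
apply: IH; have [ann_eq|[e1 [ann1 annm ann_gen _]]] := annih_step maxm Uu mu gen; last first.
  apply: finite_chainS maxm _ ann1 annm ann_gen chainU => e ann_e x U'x.
  by apply: ann_e; apply: U'U.
suff <- : annih U = annih U' by [].
apply: submodule_eq => e; split=> [ann_e x U'x|]; last exact: ann_eq.
by apply: ann_e; apply: U'U.
Qed.

(** This is Matlis's computation of End(E). A scalar r that agrees with [f] on [annih U] is
    corrected on the next annihilator by a multiple of [u]; since [u] lies in U, the correction does
    not disturb [annih U]. *)
Lemma endo_scalar (f : {linear E -> E}) : exists r, forall e, f e = r *: e.
Proof.
suff [r rP] : exists r, forall e, whole E e -> f e = r *: e.
  by exists r => e; apply: rP.
have: exists r, forall e, annih (whole R^o) e -> f e = r *: e.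
  by exists 0 => e /annih_whole ->; rewrite linear0 scaler0.
elim: (artinian_finite_chain artR) => [U U0|U U' u m maxm U'U Uu mu gen _ IH [r rP]].
  by rewrite annih0.
apply: IH; have [ann_eq|[e1 [ann1 annm ann_gen line]]] := annih_step maxm Uu mu gen.
  by exists r => e /ann_eq; apply: rP.
have [c cE] : exists c, f e1 - r *: e1 = c *: (u *: e1).
  apply: line => x mx; rewrite scalerBr -linearZ rP; last exact: annm.
  by rewrite !scalerA [x * r]mulrC subrr.
exists (r + c * u) => e /ann_gen[a [w [ann_w ->]]].
rewrite linearD linearZ /= (rP w) // -[f e1](subrK (r *: e1)) cE scalerDr [RHS]scalerDr.
congr (_ + _); first by rewrite -scalerDr scalerA -scalerDl !scalerA [c * u + r]addrC mulrC.
by rewrite scalerDl -scalerA (ann_w u) // scaler0 addr0.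
Qed.

(** Exactness of D: [b] descends to the image of [f] and extends from there by injectivity of E. *)
Lemma extend_functional V W (f : {linear V -> W}) (b : {linear V -> E}) :
  (forall x, f x = 0 -> b x = 0) -> exists g : {linear W -> E}, forall x, b x = g (f x).
Proof.
move=> /factor_image[h hP].
have [g gP] := inj_E h (@sub_incl_inj _ _ (limage f)).
exists g => x; have [|y yE] := @sub_inclE _ _ (limage f) (f x); first by exists x.
by rewrite -(hP x y yE) gP yE.
Qed.

(** The proper ideal of scalars r with r v in U lies in a maximal ideal m. Sending v to a nonzero
    element of E killed by m, and U to zero, is then consistent, and extends to V. *)
Lemma separation V (U : submodule V) v : ~ U v ->
  exists g : {linear V -> E}, (forall x, U x -> g x = 0) /\ g v <> 0.
Proof.
move=> nUv; have [||m [maxm Um]] := exists_maximal artR (I := fun r => U (r *: v)).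
- split; first by rewrite scale0r; apply: sub0.
  + by move=> a b Ua Ub; rewrite scalerDl; apply: subD.
  + by move=> a b Ub; rewrite -scalerA; apply: subZ.
- by rewrite scale1r.
have [e0 [e0n0 me0 _]] := socle_line maxm.
have lin_r : linear (fun r : R^o => (r : R) *: v).
  by move=> a x y; rewrite scalerDl scalerA.
have lin_e : linear (fun r : R^o => (r : R) *: e0).
  by move=> a x y; rewrite scalerDl scalerA.
pose f : {linear (sub_of U * R^o)%type -> V} := copair_map sub_incl (mk_linear lin_r).
pose b : {linear (sub_of U * R^o)%type -> E} := copair_map \0 (mk_linear lin_e).
have [[u r]|g gP] := extend_functional (f := f) (b := b).
  rewrite /f /b /= /copair_map /= add0r => /(canRL (addKr _)); rewrite addr0 => rv.
  by apply: me0; apply: Um; rewrite rv; apply: subN; apply: sub_valP.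
exists g; split=> [x Ux|].
  have := gP (SubOf Ux, 0); rewrite /f /b /= /copair_map /= !scale0r !addr0.
  by move=> <-.
have := gP (0, 1); rewrite /f /b /= /copair_map /= !scale1r !add0r => <-.
exact: e0n0.
Qed.

Lemma cogenerator V v : v <> 0 -> exists g : {linear V -> E}, g v <> 0.
Proof.
move=> v0; have [|g [_ gv]] := @separation V (lker_sub idfun) v; first exact: v0.
by exists g.
Qed.

Lemma commutative_noetherian V : fin_gen V -> noetherian V.
Proof.
move=> /fin_genP[s sP].
have: forall v, sub_pred (whole V) v -> lspan s v by [].
have noeth (t : seq V) : noetherian (sub_of (lspan_sub t)).
  elim: t => [|x t IHt].
    move=> U; exists [::]; split=> // v _; apply: sub_val_inj; exact: sub_valP v.
  have lin_r : linear (fun r : R^o => (r : R) *: x).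
    by move=> a y z; rewrite scalerDl scalerA.
  have [f fP] : exists f : {linear R^o -> sub_of (lspan_sub (x :: t))},
      forall r, r *: x = sub_val (f r).
    have [|f fP] := @factor_sub _ _ (lspan_sub (x :: t)) _ (mk_linear lin_r).
      by move=> r; exists r, 0; rewrite addr0; split=> //; apply: lspan0.
    by exists f => r; apply: fP.
  have [g gP] : exists g : {linear sub_of (lspan_sub t) -> sub_of (lspan_sub (x :: t))},
      forall y, sub_val y = sub_val (g y).
    have [|g gP] := @factor_sub _ _ (lspan_sub (x :: t)) _ (@sub_incl _ _ (lspan_sub t)).
      by move=> y; exists 0, (sub_val y); rewrite scale0r add0r; split=> //; apply: sub_valP.
    by exists g => r; apply: gP.
  apply: (noetherian_add (f := f) (g := g)) (artinian_noetherian artR) IHt _ => v.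
  have [r [w [tw vE]]] := sub_valP v.
  by exists r, (SubOf (U := lspan_sub t) tw); apply: sub_val_inj; rewrite vE linearD /= -fP -gP.
move=> _; apply: (noetherian_image (f := @sub_incl _ _ (lspan_sub s))) (noeth s) => y.
by have [x <-] := @sub_inclE _ _ (lspan_sub s) y (sP y); exists x.
Qed.

(* As [E]-endomorphisms are scalars, a functional on [H] which depends only   *)
(* on the pairing with finitely many elements is itself given by the pairing. *)
Lemma pairing_represent (H V : lmodType R) (b : V -> {linear H -> E})
    (lin_b : forall h, linear (fun v => b v h)) (phi : {linear H -> E}) :
  fin_gen V -> (forall h, (forall v, b v h = 0) -> phi h = 0) ->
  exists v, forall h, phi h = b v h.
Proof.
move=> /fin_genP[s sP] phiP.
have {sP} phiS h : (forall v, v \in s -> b v h = 0) -> phi h = 0.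
  move=> bh; apply: phiP => v.
  exact: (@lspan_least _ _ (lker_sub (mk_linear (lin_b h)))) (sP v).
elim: s H b lin_b phi {phiP} phiS => [|x s IHs] H b lin_b phi phiS.
  exists 0 => h; rewrite phiS //; exact: esym (linear0 (mk_linear (lin_b h))).
pose i := @sub_incl _ _ (lker_sub (b x)).
have [|h h0|v vP] := IHs _ (fun v => b v \o i : {linear _ -> _}) _ (phi \o i).
- by move=> h; apply: lin_b.
- apply: phiS => v; rewrite inE => /predU1P[->|]; last exact: h0.
  exact: sub_valP h.
have [h bxh|g gP] := extend_functional (f := b x) (b := phi - b v).
  by have := vP (SubOf (U := lker_sub (b x)) bxh); rewrite /= => eqh; apply/eqP; rewrite subr_eq0; apply/eqP.
have [r rP] := endo_scalar g; exists (r *: x + v) => h.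
by rewrite (lin_b h) -rP -gP [in RHS]/= subrK.
Qed.

Lemma eval_functionals V (s : seq V) : exists (W : lmodType R)
    (ev : {linear V -> E} -> W), noetherian W /\
  [/\ forall f g : {linear V -> E}, ev (f + g) = ev f + ev g,
      forall r (f : {linear V -> E}), ev (r \*: f) = r *: ev f &
      forall f : {linear V -> E}, ev f = 0 -> forall v, v \in s -> f v = 0].
Proof.
elim: s => [|x s [W [ev [noethW [evD evZ ev0]]]]].
  exists (zero_mod R), (fun=> 0); split; last first.
    by split=> // [f g|r f]; rewrite ?addr0 ?scaler0.
  by move=> U; exists [::]; split=> // v _; exact: thinmx0.
exists (E * W)%type, (fun f : {linear V -> E} => (f x, ev f)); split.
  apply: (@noetherian_add R E W (E * W)%type (@inj1 R E W) (@inj2 R E W)) injective_noetherian noethW _.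
  by move=> [e w]; exists e, w; rewrite [LHS]prod_decomp.
split=> [f g|r f|f [fx /ev0 fs] v]; first by rewrite evD.
  by rewrite evZ.
by rewrite inE => /predU1P[->|/fs].
Qed.

(** Evaluation at generators of V embeds the dual of V into a power of E, which is noetherian. So
    the functionals vanishing on U have finitely many generators, and any vector killed by these is
    killed by all of them, hence lies in U. *)
Lemma separating_functionals V (U : submodule V) : fin_gen V ->
  exists s : seq {linear V -> E}, (forall f : {linear V -> E}, f \in s -> forall v, U v -> f v = 0) /\
    forall v, (forall f : {linear V -> E}, f \in s -> f v = 0) -> U v.
Proof.
move=> /fin_genP[g gP]; have [W [ev [noethW [evD evZ ev0]]]] := eval_functionals g.
have ev_inj (f h : {linear V -> E}) : ev f = ev h -> f = h.
  move=> fh; apply: linear_ext => v; apply/eqP; rewrite -subr_eq0; apply/eqP.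
  have {}fh : ev (f + (-1) \*: h) = 0 by rewrite evD evZ fh scaleN1r subrr.
  apply: (@lspan_least _ _ (lker_sub (f - h))) (gP v) => x xg /=.
  by rewrite -[RHS](ev0 _ fh x xg) hom_addE /= scaleN1r.
pose N w := exists f : {linear V -> E}, w = ev f /\ forall v, U v -> f v = 0.
have [N0 ND NZ] : [/\ N 0, forall x y, N x -> N y -> N (x + y) &
    forall a x, N x -> N (a *: x)].
  split.
  - exists (0 \*: \0); rewrite evZ scale0r; split=> // v _; exact: scale0r.
  - move=> _ _ [f [-> fU]] [h [-> hU]]; exists (f + h); rewrite evD; split=> // v Uv.
    by rewrite hom_addE fU // hU // addr0.
  - move=> a _ [f [-> fU]]; exists (a \*: f); rewrite evZ; split=> // v Uv.
    by rewrite /= fU // scaler0.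
have [t [tN Nt]] := noethW (Submodule N0 ND NZ).
have [s [sU sE]] : exists s : seq {linear V -> E},
    (forall f : {linear V -> E}, f \in s -> forall v, U v -> f v = 0) /\ t = map ev s.
  elim: t tN {Nt} => [|w t IHt] tN; first by exists [::].
  have [|s [sU ->]] := IHt; first by move=> z zt; apply: tN; rewrite inE zt orbT.
  have [|f [-> fU]] := tN w; first by rewrite inE eqxx.
  by exists (f :: s); split=> // h; rewrite inE => /predU1P[->|/sU].
exists s; split=> // v sv; apply: contrapT => nUv.
have [f [fU]] := separation nUv; apply.
have: lspan (map ev s) (ev f) by rewrite -sE; apply: Nt; exists f.
elim: s f sv {sU sE fU} => [|h s IHs] f sv /=.
  move=> evf; have -> : f = 0 \*: f by apply: ev_inj; rewrite evZ scale0r evf.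
  exact: scale0r.
move=> [a [w [sw evE]]].
have wE : w = ev (f + (- a) \*: h) by rewrite evD evZ evE scaleNr addrAC subrr add0r.
have hv : h v = 0 by apply: sv; rewrite inE eqxx.
have := IHs (f + (- a) \*: h); rewrite -wE => /(_ _ sw) <-.
  by rewrite hom_addE /= hv scaler0 addr0.
by move=> k ks; apply: sv; rewrite inE ks orbT.
Qed.
End InjectiveCogenerator.

(** * The modules D(Lam^m) *)

Section ScalarRestriction.
Variables (R : comNzRingType) (Lam : algType R).

(** A module over [Lam^c] with scalars restricted to R; the alias keeps the two module structures
    apart. *)
Definition res (V : lmodType Lam^c) : Type := V.
HB.instance Definition _ V := GRing.Zmodule.on (res V).

Section Res.
Variable V : lmodType Lam^c.
Implicit Types v w : res V.

Definition res_scale (r : R) (v : res V) : res V := @r_scale R Lam V r v.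

Fact res_scaleA r t v : res_scale r (res_scale t v) = res_scale (r * t) v.
Proof.
rewrite /res_scale /r_scale scalerA; congr (_ *: _).
by rewrite {1}/GRing.mul /= -scalerAl mul1r scalerA mulrC.
Qed.

Fact res_scale1 : left_id 1 res_scale.
Proof. by move=> v; rewrite /res_scale /r_scale scale1r; apply: scale1r. Qed.

Fact res_scaleDr : right_distributive res_scale +%R.
Proof. by move=> r v w; apply: scalerDr. Qed.

Fact res_scaleDl v : {morph res_scale^~ v : r t / r + t}.
Proof. by move=> r t; rewrite /res_scale /r_scale scalerDl; apply: scalerDl. Qed.

HB.instance Definition _ := GRing.Zmodule_isLmodule.Build R (res V)
  res_scaleA res_scale1 res_scaleDr res_scaleDl.

Lemma res_scaleE r (v : res V) : r *: v = ((r%:A : Lam) : Lam^c) *: (v : V).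
Proof. by []. Qed.
End Res.

Variables V W : lmodType Lam^c.

Definition hom_scale (r : R) (f : {linear V -> W}) : {linear V -> W} :=
  @r_scale R Lam W r \o f.

Fact hom_scaleA r t f : hom_scale r (hom_scale t f) = hom_scale (r * t) f.
Proof. by apply: linear_ext => x; exact: (scalerA r t (f x : res W)). Qed.

Fact hom_scale1 : left_id 1 hom_scale.
Proof. by move=> f; apply: linear_ext => x; exact: (scale1r (f x : res W)). Qed.

Fact hom_scaleDr : right_distributive hom_scale +%R.
Proof. by move=> r f g; apply: linear_ext => x; apply: scalerDr. Qed.

Fact hom_scaleDl f : {morph hom_scale^~ f : r t / r + t}.
Proof. by move=> r t; apply: linear_ext => x; exact: (scalerDl (f x : res W)). Qed.

HB.instance Definition _ := GRing.Zmodule_isLmodule.Build R {linear V -> W}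
  hom_scaleA hom_scale1 hom_scaleDr hom_scaleDl.

Lemma hom_scaleE r (f : {linear V -> W}) x : (r *: f) x = r *: (f x : res W).
Proof. by []. Qed.
End ScalarRestriction.

Section ResHom.
Variables (R : comNzRingType) (Lam : algType R) (U V W : lmodType Lam^c).

Fact precomp_linear (g : {linear U -> V}) :
  linear (fun f : {linear V -> W} => f \o g : {linear U -> W}).
Proof. by move=> r f h; apply: linear_ext. Qed.
Definition precomp (g : {linear U -> V}) : {linear {linear V -> W} -> {linear U -> W}} :=
  mk_linear (precomp_linear g).

Fact postcomp_linear (g : {linear V -> W}) :
  linear (fun f : {linear U -> V} => g \o f : {linear U -> W}).
Proof.
move=> r f h; apply: linear_ext => x /=.
by rewrite linearD; congr (_ + _); apply: linearZ.
Qed.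
Definition postcomp (g : {linear V -> W}) : {linear {linear U -> V} -> {linear U -> W}} :=
  mk_linear (postcomp_linear g).
End ResHom.

Section DualOfFree.
Variables (R : comNzRingType) (Lam : algType R) (E : lmodType R).
Hypotheses (artR : artinian R) (fgLam : fin_gen (S := R) Lam) (dualE : is_dualizing E).
Local Notation S := (Lam^c).
Implicit Types V W : lmodType S.

Definition central (r : R) : S := (r%:A : Lam).

Lemma centralC r (s : S) : central r * s = s * central r.
Proof. by rewrite /GRing.mul /= /central mulr_algl mulr_algr. Qed.

(* J m = D(S^m), the [m]-th power of the injective cogenerator D(Lam). *)
Definition J (m : nat) : Type := {linear res 'cV[S]_m -> E}.
HB.instance Definition _ m := GRing.Zmodule.on (J m).

Section Jmodule.
Variable m : nat.
Implicit Types phi : J m.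

Fact right_mul_linear (s : S) : linear (fun x : res 'cV[S]_m => x *m s%:M : res 'cV[S]_m).
Proof.
move=> r x y; rewrite mulmxDl !res_scaleE; congr (_ + _).
exact: esym (scalemxAl _ _ _).
Qed.

Definition J_scale (s : S) (phi : J m) : J m :=
  (phi : {linear _ -> _}) \o mk_linear (right_mul_linear s).

Fact J_scaleA s t phi : J_scale s (J_scale t phi) = J_scale (s * t) phi.
Proof.
by apply: linear_ext => x; rewrite /= -mulmxA -scalar_mxM.
Qed.

Fact J_scale1 : left_id 1 J_scale.
Proof. by move=> phi; apply: linear_ext => x; rewrite /= mulmx1. Qed.

Fact J_scaleDr : right_distributive J_scale +%R.
Proof. by move=> s f g; apply: linear_ext. Qed.

Fact J_scaleDl phi : {morph J_scale^~ phi : s t / s + t}.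
Proof.
move=> s t; apply: linear_ext => x; rewrite /= raddfD mulmxDr.
exact: (linearD (phi : {linear _ -> _})).
Qed.

HB.instance Definition _ := GRing.Zmodule_isLmodule.Build S (J m)
  J_scaleA J_scale1 J_scaleDr J_scaleDl.

Definition J_ev (phi : J m) (x : 'cV[S]_m) : E := (phi : {linear _ -> _}) (x : res _).

Lemma J_ext phi psi : J_ev phi =1 J_ev psi -> phi = psi.
Proof. by move=> eq_ev; apply: (@linear_ext R (res 'cV[S]_m) E phi psi) => x; apply: eq_ev. Qed.

Lemma J_ev0 x : J_ev 0 x = 0.
Proof. by []. Qed.

Lemma J_evD phi psi x : J_ev (phi + psi) x = J_ev phi x + J_ev psi x.
Proof. by []. Qed.

Lemma J_evS (s : S) phi x : J_ev (s *: phi) x = J_ev phi (x *m s%:M).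
Proof. by []. Qed.

Lemma J_evx phi x y : J_ev phi (x + y) = J_ev phi x + J_ev phi y.
Proof. exact: (linearD (phi : {linear res 'cV[S]_m -> E})). Qed.

Lemma J_evZ phi r x : J_ev phi (central r *: x) = r *: J_ev phi x.
Proof. exact: (linearZ_LR (phi : {linear res 'cV[S]_m -> E}) r (x : res 'cV[S]_m)). Qed.

Lemma J_ev_sum phi I (s : seq I) (F : I -> 'cV[S]_m) :
  J_ev phi (\sum_(i <- s) F i) = \sum_(i <- s) J_ev phi (F i).
Proof. exact: (linear_sum (phi : {linear res 'cV[S]_m -> E})). Qed.
End Jmodule.

Definition unit_row m (i : 'I_m) : 'rV[S]_m := delta_mx 0 i.
Definition unit_col m (i : 'I_m) : 'cV[S]_m := delta_mx i 0.

(** The trace form pairing Hom(V, D(S^m)) with Hom(S^m, V). It realises the natural isomorphism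
    between Hom(V, nu P) and D Hom(P, V) for P free of rank m. *)
Definition jpair m V (f : {linear V -> J m}) (u : {linear 'rV[S]_m -> V}) : E :=
  \sum_i J_ev (f (u (unit_row i))) (unit_col i).

Lemma mulmx_central m p (A : 'M[S]_(m, p)) r : A *m (central r)%:M = central r *: A.
Proof.
apply/matrixP => i j; rewrite !mxE (bigD1 j) //= big1 => [|k /negPf jk].
  by rewrite mxE eqxx addr0 centralC.
by rewrite mxE jk mulr0n mulr0. Qed.

Lemma mulmx_centralr m p q (A : 'M[S]_(m, p)) (B : 'M[S]_(p, q)) r :
  A *m (central r *: B) = central r *: (A *m B).
Proof. by rewrite -!mulmx_central mulmxA. Qed.

Lemma mul_mx_scalar00 (A : 'M[S]_1) s : (A *m s%:M) 0 0 = A 0 0 * s.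
Proof. by rewrite mxE big_ord1 mxE eqxx. Qed.

Fact pair_linear m V (f : {linear V -> J m}) : linear (jpair f).
Proof.
move=> r u v; rewrite /jpair scaler_sumr -big_split; apply: eq_bigr => i _.
by rewrite hom_addE hom_scaleE linearD J_evD res_scaleE linearZ J_evS mulmx_central J_evZ.
Qed.

Definition jpairing m V (f : {linear V -> J m}) : {linear {linear 'rV[S]_m -> V} -> E} :=
  mk_linear (pair_linear f).

Lemma pair_comp m V W (f : {linear V -> J m}) (g : {linear W -> V}) u :
  jpair (f \o g) u = jpair f (g \o u).
Proof. by []. Qed.

Fact row_scale_linear m V (x : 'cV[S]_m) (v : V) :
  linear (fun y : 'rV[S]_m => (y *m x) 0 0 *: v).
Proof. by move=> a y z; rewrite mulmxDl -scalemxAl !mxE scalerDl scalerA. Qed.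
Definition row_scale m V (x : 'cV[S]_m) (v : V) : {linear 'rV[S]_m -> V} :=
  mk_linear (row_scale_linear x v).

Lemma unit_row_mul m (x : 'cV[S]_m) i : (unit_row i *m x) 0 0 = x i 0.
Proof. by rewrite /unit_row -rowE mxE. Qed.

Lemma mul_unit_col m (y : 'rV[S]_m) i : (y *m unit_col i) 0 0 = y 0 i.
Proof. by rewrite /unit_col -colE mxE. Qed.

Lemma col_sum m (x : 'cV[S]_m) : x = \sum_i unit_col i *m (x i 0)%:M.
Proof.
apply/colP => j; rewrite summxE (bigD1 j) //= big1 => [|i /negPf ij].
  by rewrite mxE big_ord1 !mxE !eqxx mul1r addr0.
by rewrite mxE big_ord1 !mxE eq_sym ij mul0r.
Qed.

Lemma linear_row_sum m V (u : {linear 'rV[S]_m -> V}) y :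
  u y = \sum_i y 0 i *: u (unit_row i).
Proof.
by rewrite {1}[y]row_sum_delta linear_sum; apply: eq_bigr => i _; rewrite linearZ.
Qed.

Lemma hom_sumE (T : nzRingType) (V W : lmodType T) I (r : seq I) (F : I -> {linear V -> W}) v :
  (\sum_(i <- r) F i) v = \sum_(i <- r) F i v.
Proof.
by elim: r => [|i r IHr]; rewrite ?big_nil // !big_cons hom_addE IHr.
Qed.

Lemma linear_row_ext m V (u v : {linear 'rV[S]_m -> V}) :
  (forall i, u (unit_row i) = v (unit_row i)) -> u =1 v.
Proof.
by move=> uv y; rewrite !linear_row_sum; apply: eq_bigr => i _; rewrite uv.
Qed.

Lemma pair_row_scale m V (f : {linear V -> J m}) x v :
  jpair f (row_scale x v) = J_ev (f v) x.
Proof.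
rewrite [in RHS](col_sum x) J_ev_sum; apply: eq_bigr => i _.
by rewrite /= unit_row_mul linearZ J_evS.
Qed.

Lemma pair_inj m V (f g : {linear V -> J m}) : jpair f =1 jpair g -> f =1 g.
Proof. by move=> fg v; apply: J_ext => x; rewrite -!pair_row_scale fg. Qed.

(** The map is forced: by [pair_row_scale] the value of f v at x must be [b] of the homomorphism
    [row_scale x v]. *)
Lemma pair_onto m V (b : {linear {linear 'rV[S]_m -> V} -> E}) :
  exists f : {linear V -> J m}, jpair f =1 b.
Proof.
have lin_phi v : linear (fun x : res 'cV[S]_m => b (row_scale x v)).
  move=> r x y; rewrite -linearP; congr (b _); apply: linear_ext => z /=.
  have -> : r *: x = central r *: (x : 'cV[S]_m) by [].
  by rewrite mulmxDr mulmx_centralr !mxE scalerDl -scalerA.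
pose f0 v : J m := mk_linear (lin_phi v).
have lin_f : linear f0.
  move=> s v w; apply: J_ext => x; rewrite J_evD J_evS /J_ev /=.
  rewrite -linearD; congr (b _); apply: linear_ext => z.
  by rewrite hom_addE /= mulmxA mul_mx_scalar00 scalerDr scalerA.
exists (mk_linear lin_f) => u; rewrite /jpair /J_ev /=.
rewrite -linear_sum; congr (b _); apply: linear_ext; apply: linear_row_ext => i.
rewrite hom_sumE (bigD1 i) //= big1 => [|j /negPf ji].
  by rewrite mul_unit_col mxE !eqxx scale1r addr0.
by rewrite mul_unit_col mxE ji andbF scale0r.
Qed.

(* The map J m -> J p dual to left multiplication of columns by [A]. *)
Section Jmap.
Variables (m p : nat) (A : 'M[S]_(m, p)).

Fact left_mul_linear : linear (fun x : res 'cV[S]_p => A *m x : res 'cV[S]_m).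
Proof.
by move=> r x y; rewrite mulmxDr; congr (_ + _); apply: mulmx_centralr.
Qed.

Definition Jmap_fun (phi : J m) : J p :=
  (phi : {linear _ -> _}) \o mk_linear left_mul_linear.

Fact Jmap_linear : linear Jmap_fun.
Proof. by move=> s f g; apply: J_ext => x; rewrite /J_ev /= mulmxA. Qed.
HB.instance Definition _ := GRing.isLinear.Build S (J m) (J p) _ Jmap_fun Jmap_linear.
Definition Jmap : {linear J m -> J p} := Jmap_fun.

Lemma Jmap_ev phi x : J_ev (Jmap phi) x = J_ev phi (A *m x).
Proof. by []. Qed.
End Jmap.

Definition rmul m p (A : 'M[S]_(m, p)) : {linear 'rV[S]_m -> 'rV[S]_p} := mulmxr A.

(** [Jmap A] is adjoint to right multiplication by [A], so the pairing translates between complexes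
    of free modules and complexes of modules [J m]. *)
Lemma pair_Jmap m p (A : 'M[S]_(m, p)) V (f : {linear V -> J m})
    (u : {linear 'rV[S]_p -> V}) : jpair (Jmap A \o f) u = jpair f (u \o rmul A).
Proof.
rewrite /jpair /= .
have E1 i : J_ev (f (u (rmul A (unit_row i)))) (unit_col i) =
    \sum_j J_ev (f (u (unit_row j))) (unit_col i *m (A i j)%:M).
  rewrite linear_row_sum /= linear_sum.
  rewrite /J_ev hom_sumE; apply: eq_bigr => j _.
  by rewrite /= -rowE mxE linearZ.
rewrite (eq_bigr _ (fun i _ => E1 i)) exchange_big; apply: eq_bigr => j _ /=.
rewrite [LHS]Jmap_ev /unit_col -colE -J_ev_sum; congr (J_ev _ _).
by rewrite [LHS]col_sum; apply: eq_bigr => i _; rewrite mxE.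
Qed.
End DualOfFree.

Lemma fin_gen_free (S : nzRingType) m : fin_gen ('rV[S]_m : lmodType S).
Proof.
exists m, (fun i => delta_mx 0 i) => y; exists (fun i => y 0 i).
exact: row_sum_delta.
Qed.

(** * Exact duality between free modules and their injective duals *)

Section FreeDuality.
Variables (R : comNzRingType) (Lam : algType R) (E : lmodType R).
Hypotheses (artR : artinian R) (fgLam : fin_gen (S := R) Lam) (dualE : is_dualizing E).
Local Notation S := (Lam^c).
Local Notation J := (J Lam E).
Local Notation Jmap := (@Jmap R Lam E _ _).
Local Notation unit_row := (@unit_row R Lam _).
Local Notation unit_col := (@unit_col R Lam _).
Implicit Types V W : lmodType S.

Lemma fin_gen_res V : fin_gen V -> fin_gen (res V).
Proof.
move=> /fin_genP[s sP]; have /fin_genP[t tP] := fgLam; apply/fin_genP.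
suff [q qP] : exists q : seq (res V), forall v, lspan s v -> lspan q (v : res V).
  by exists q => v; apply: qP.
elim: s {sP} => [|x s [q qP]]; first by exists [::].
have lin_x : linear (fun a : Lam => (a : S) *: x : res V).
  move=> r b c; have -> : (r *: b + c : Lam) = ((r%:A : Lam) : S) * (b : S) + c :> S.
    by congr (_ + c); rewrite /GRing.mul /= mulr_algr.
  by rewrite scalerDl -scalerA.
exists (map (mk_linear lin_x) t ++ q) => _ [a [w [sw ->]]]; apply: lspanD.
  apply: (lspan_least (U := lspan_sub (_ ++ _))) (lspan_image (mk_linear lin_x) (tP a)).
  by move=> z tz; apply: lspan_mem; rewrite mem_cat tz.
apply: (lspan_least (U := lspan_sub (_ ++ _))) (qP _ sw) => z qz.
by apply: lspan_mem; rewrite mem_cat qz orbT.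
Qed.

Definition res_sub V (U : submodule V) : submodule (res V) :=
  @Submodule R (res V) U (sub0 U) (fun x y Ux Uy => @subD _ _ U x y Ux Uy)
    (fun r x Ux => @subZ _ _ U _ x Ux).

Lemma lspan_res V (s : seq V) v : lspan (s : seq (res V)) (v : res V) -> lspan s v.
Proof.
elim: s v => //= x s IHs v [r [w [sw ->]]].
by exists ((r%:A : Lam) : S), w; split; [apply: IHs|].
Qed.

Lemma fin_gen_noetherian V : fin_gen V -> noetherian V.
Proof.
move=> /fin_gen_res/(commutative_noetherian artR) noethV U.
have [s [sU Us]] := noethV (res_sub U).
by exists s; split=> [x /sU|v /Us/lspan_res].
Qed.

Lemma fin_gen_submod V (U : submodule V) : fin_gen V -> fin_gen (sub_of U).
Proof. by move=> fgV; apply: fin_gen_submodule; apply: fin_gen_noetherian. Qed.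

Lemma fin_gen_cV m : fin_gen ('cV[S]_m : lmodType S).
Proof.
apply: (fin_gen_image (f := @trmx S 1 m : {linear 'rV[S]_m -> 'cV[S]_m})) (fin_gen_free _ m).
by move=> y; exists y^T; apply: trmxK.
Qed.

(* Hom(P, V) and Hom(V, J) are dual to each other, for P the complex of free  *)
(* modules given by [A] and [B]. *)
Lemma dual_exact m p q (A : 'M[S]_(m, p)) (B : 'M[S]_(p, q)) V :
    (forall u : {linear 'rV[S]_p -> V}, (forall x, u (x *m A) = 0) ->
       exists w : {linear 'rV[S]_q -> V}, forall x, u x = w (x *m B)) ->
  forall f : {linear V -> J p}, (forall v, Jmap B (f v) = 0) ->
  exists g : {linear V -> J m}, forall v, f v = Jmap A (g v).
Proof.
move=> exP f Bf.
have [u uA|b bP] := extend_functional dualE (f := precomp V (rmul A)) (b := jpairing f).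
  have [|w wP] := exP u; first by move=> x; have /= := congr1 (fun h : {linear _ -> _} => h x) uA.
  have -> : u = w \o rmul B by apply: linear_ext => x; apply: wP.
  rewrite mk_linearE -pair_Jmap; apply: big1 => i _.
  by rewrite -[RHS](J_ev0 E (unit_col i)); congr (J_ev _ _); apply: Bf.
have [g gP] := pair_onto b; exists g; apply: (@pair_inj _ _ _ _ _ f (Jmap A \o g)) => u.
by rewrite pair_Jmap gP -[RHS]bP.
Qed.

(** A cocycle [u] outside the image would be separated from it by a functional. That functional is
    the pairing with some f killed by [Jmap B]; writing f as [Jmap A] after g and moving [A] across
    the pairing shows that it vanishes on [u]. *)
Lemma dual_exact_inv m p q (A : 'M[S]_(m, p)) (B : 'M[S]_(p, q)) V :
    (forall f : {linear V -> J p}, (forall v, Jmap B (f v) = 0) ->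
      exists g : {linear V -> J m}, forall v, f v = Jmap A (g v)) ->
  forall u : {linear 'rV[S]_p -> V}, (forall x, u (x *m A) = 0) ->
  exists w : {linear 'rV[S]_q -> V}, forall x, u x = w (x *m B).
Proof.
move=> exJ u uA; apply: contrapT => nw.
have [|b [bU bu]] := @separation _ _ artR dualE _ (limage (precomp V (rmul B))) u.
  by move=> [w wu]; apply: nw; exists w => x; rewrite -wu.
have [f fP] := pair_onto b; apply: bu; rewrite -fP.
have [v|g gP] := exJ f.
  move: v; apply: (@pair_inj _ _ _ _ _ (Jmap B \o f) \0) => w.
  rewrite pair_Jmap fP bU; last by exists w.
  by rewrite /jpair big1 // => i _; apply: hom_0E.
have -> : f = Jmap A \o g by apply: linear_ext.
rewrite pair_Jmap -[RHS](linear0 (jpairing g)); congr (jpair g _).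
by apply: linear_ext.
Qed.

(** Hom(S^m, -) preserves injections and E is injective; the pairing converts an extended functional
    back into a map to [J m]. *)
Lemma J_injective m V W (i : {linear V -> W}) (f : {linear V -> J m}) :
  injective i -> exists g : {linear W -> J m}, forall v, f v = g (i v).
Proof.
move=> i_inj.
have [u iu|b bP] := extend_functional dualE (f := postcomp 'rV[S]_m i) (b := jpairing f).
  suff -> : u = 0 by rewrite linear0.
  apply: linear_ext => x; apply: i_inj; rewrite linear0.
  by have /= := congr1 (fun h : {linear _ -> _} => h x) iu.
have [g gP] := pair_onto b; exists g; apply: (@pair_inj _ _ _ _ _ f (g \o i)) => u.
by rewrite pair_comp gP -[RHS]bP.
Qed.

Lemma fin_gen_J m : fin_gen (J m : lmodType S).
Proof.
have [g gP] := iffLR (fin_genP _) (fin_gen_res (fin_gen_cV m)).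
have [W [ev [noethW [evD evZ ev0]]]] := eval_functionals artR dualE g.
have lin_ev : linear (fun phi : res (J m) => ev phi).
  move=> r phi psi; rewrite -evZ -evD; congr (ev _); apply: linear_ext => x.
  by rewrite -[LHS]/(J_ev (_ + _) x) J_evD J_evS mulmx_central J_evZ.
have ev_inj : injective (mk_linear lin_ev).
  move=> phi psi /= eq_ev; apply/eqP; rewrite -subr_eq0; apply/eqP.
  have {}eq_ev : ev ((phi : {linear _ -> _}) - psi) = 0.
    have := linearB (mk_linear lin_ev) phi psi; rewrite /= => ->.
    by rewrite eq_ev subrr.
  apply: linear_ext => x.
  by apply: (@lspan_least _ _ (lker_sub (_ - _))) (gP x) => y yg; apply: ev0 eq_ev _ yg.
have [s sP] := iffLR (fin_genP _) (noetherian_fin_gen (noetherian_inj ev_inj noethW)).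
by apply/fin_genP; exists s => phi; apply: lspan_res; apply: sP.
Qed.

(* Finitely many functionals cut out a submodule, so every finitely generated *)
(* quotient embeds in some J m. *)
Lemma cogenerated V (U : submodule V) : fin_gen V ->
  exists m (f : {linear V -> J m}), forall v, f v = 0 <-> U v.
Proof.
move=> /fin_gen_res fgV.
have [s [sU Us]] := separating_functionals artR dualE (res_sub U) fgV.
have lin_b : linear (fun u : {linear 'rV[S]_(size s) -> V} =>
    \sum_(i < size s) s`_i (u (unit_row i) : res V)).
  move=> r u w; rewrite scaler_sumr -big_split; apply: eq_bigr => i _.
  by rewrite hom_addE hom_scaleE linearP.
have [f fP] := pair_onto (mk_linear lin_b); exists (size s), f => v.
have fE x : J_ev (f v) x = \sum_(i < size s) s`_i (x i 0 *: v : res V).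
  by rewrite -pair_row_scale fP /=; apply: eq_bigr => i _; rewrite unit_row_mul.
split=> [fv|Uv]; last first.
  apply: J_ext => x; rewrite fE big1 => [|i _]; first by rewrite /J_ev hom_0E.
  by apply: sU; [apply: mem_nth | apply: subZ].
apply: Us => g /(nthP 0)[i lt_is <-].
have := fE (unit_col (Ordinal lt_is)); rewrite fv [LHS]hom_0E.
rewrite (bigD1 (Ordinal lt_is)) //= big1 => [|j /negPf ji].
  by rewrite mxE !eqxx scale1r addr0 => ->.
by rewrite mxE ji scale0r linear0.
Qed.

(** Biduality: evaluating [g] at a unit column is a functional on [J m], which by
    [pairing_represent] is evaluation at some column. These columns form the matrix. *)
Lemma Jmap_onto m p (g : {linear J m -> J p}) :
  exists B : 'M[S]_(m, p), forall phi, g phi = Jmap B phi.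
Proof.
have ev_lin x : linear (fun phi : res (J m) => J_ev phi x).
  by move=> r phi psi; rewrite J_evD J_evS mulmx_central J_evZ.
have col i : exists b : 'cV[S]_m, forall phi, J_ev (g phi) (unit_col i) = J_ev phi b.
  have lin_g : linear (fun phi : res (J m) => J_ev (g phi) (unit_col i)).
    by move=> r phi psi; rewrite linearD res_scaleE linearZ J_evD J_evS mulmx_central J_evZ.
  have [|||b bP] := @pairing_represent _ _ artR dualE (res (J m)) (res 'cV[S]_m)
    (fun x => mk_linear (ev_lin x)) _ (mk_linear lin_g).
  - by move=> phi r x y /=; rewrite J_evx J_evZ.
  - exact/fin_gen_res/fin_gen_cV.
  - move=> phi phi0; suff -> : phi = 0 by rewrite linear0.
    by apply: J_ext => x; exact: phi0.
  - by exists b => phi; apply: bP.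
have [c cP] := choice col; exists (\matrix_(i, j) c j i 0) => phi.
apply: J_ext => x; rewrite Jmap_ev [in LHS](col_sum x) J_ev_sum.
rewrite (eq_bigr (fun i => J_ev phi (c i *m (x i 0)%:M))); last first.
  by move=> i _; rewrite -!J_evS -linearZ cP.
rewrite -J_ev_sum; congr (J_ev _ _); apply/colP => i.
rewrite summxE mxE; apply: eq_bigr => j _; rewrite !mxE.
by rewrite big_ord1 mxE eqxx.
Qed.

Lemma J_cokernel m V (g : {linear V -> J m}) : exists p (B : 'M[S]_(m, p)),
  forall phi, Jmap B phi = 0 <-> exists v, g v = phi.
Proof.
have [p [f fP]] := cogenerated (limage g) (fin_gen_J m).
by have [B BP] := Jmap_onto f; exists p, B => phi; rewrite -BP.
Qed.
End FreeDuality.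

(** * Resolutions and extensions *)

Section Resolutions.
Variable S : nzRingType.
Hypothesis noeth : forall V : lmodType S, fin_gen V -> noetherian V.
Implicit Types Q V W X Y Z : lmodType S.

Definition short_exact V W X (i : {linear V -> W}) (p : {linear W -> X}) : Prop :=
  [/\ injective i, forall x, exists w, p w = x &
      forall w, p w = 0 <-> exists v, i v = w].

Lemma fin_gen_row V : fin_gen V ->
  exists m (f : {linear 'rV[S]_m -> V}), forall v, exists x, f x = v.
Proof.
move=> [m [g gP]]; have lin_f : linear (fun x : 'rV[S]_m => \sum_i x 0 i *: g i).
  move=> a x y; rewrite scaler_sumr -big_split; apply: eq_bigr => i _.
  by rewrite !mxE scalerDl scalerA.
exists m, (mk_linear lin_f) => v; have [c ->] := gP v.
by exists (\row_i c i); apply: eq_bigr => i _; rewrite mxE.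
Qed.

Lemma projective_free m : projective_module ('rV[S]_m : lmodType S).
Proof.
move=> W U p f p_onto.
have [w wP] := choice (fun i : 'I_m => p_onto (f (delta_mx 0 i))).
have lin_g : linear (fun y : 'rV[S]_m => \sum_i y 0 i *: w i).
  move=> a y z; rewrite scaler_sumr -big_split; apply: eq_bigr => i _.
  by rewrite !mxE scalerDl scalerA.
exists (mk_linear lin_g) => y; rewrite {1}[y]row_sum_delta /= !linear_sum.
by apply: eq_bigr => i _; rewrite !linearZ wP.
Qed.

Lemma syzygy m V (f : {linear 'rV[S]_m -> V}) : exists p (A : 'M[S]_(p, m)),
  forall x, f x = 0 <-> exists y, x = y *m A.
Proof.
have [p [g g_onto]] := fin_gen_row (fin_gen_submodule (noeth (fin_gen_free _ m) (lker_sub f))).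
exists p, (\matrix_i sub_val (g (delta_mx 0 i))) => x.
have gE y : sub_val (g y) = y *m \matrix_i sub_val (g (delta_mx 0 i)).
  rewrite {1}[y]row_sum_delta !linear_sum mulmx_sum_row; apply: eq_bigr => i _.
  by rewrite !linearZ rowK.
split=> [fx|[y ->]]; last by rewrite -gE; exact: sub_valP (g y).
have [y yx] := g_onto (SubOf (U := lker_sub f) fx).
by exists y; rewrite -gE yx.
Qed.

(** The sizes are packed with the matrix so that successive syzygies can be produced by [iter]. *)
Record stage := Stage { rows : nat; cols : nat; stage_mx : 'M[S]_(rows, cols) }.

Lemma free_syzygies m V (f : {linear 'rV[S]_m -> V}) :
  exists (r : nat -> nat) (A0 : 'M[S]_(r 0, m)) (A : forall i, 'M[S]_(r i.+1, r i)),
  [/\ forall x, f x = 0 <-> exists y, x = y *m A0,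
      forall x : 'rV_(r 0), x *m A0 = 0 <-> exists y, x = y *m A 0 &
      forall i (x : 'rV_(r i.+1)), x *m A i = 0 <-> exists y, x = y *m A i.+1].
Proof.
have [p [A0 A0P]] := syzygy f.
have next (t : stage) : exists u : {p : nat & 'M[S]_(p, rows t)},
    forall x : 'rV_(rows t), x *m stage_mx t = 0 <-> exists y, x = y *m projT2 u.
  have [q [B BP]] := syzygy (mulmxr (stage_mx t) : {linear 'rV[S]_(rows t) -> 'rV[S]_(cols t)}).
  by exists (existT (fun p => 'M[S]_(p, rows t)) q B) => x; apply: BP.
pose g t := projT1 (cid (next t)); have gP t := projT2 (cid (next t)).
pose step t := Stage (projT2 (g t)); pose st i := iter i step (Stage A0).
exists (fun i => rows (st i)), A0, (fun i => stage_mx (st i.+1)); split=> // [|i].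
  exact: (gP (st 0)).
exact: (gP (st i.+1)).
Qed.

Definition cons_size m (r : nat -> nat) i := if i is j.+1 then r j else m.
Definition cons_mx m (r : nat -> nat) (A0 : 'M[S]_(r 0, m))
    (A : forall i, 'M[S]_(r i.+1, r i)) i : 'M[S]_(cons_size m r i.+1, cons_size m r i) :=
  match i with 0 => A0 | j.+1 => A j end.

Definition free_res (r : nat -> nat) i : lmodType S := 'rV[S]_(r i).
Definition free_d r (A : forall i, 'M[S]_(r i.+1, r i)) i :
  {linear free_res r i.+1 -> free_res r i} := mulmxr (A i).

Lemma free_resP r (A : forall i, 'M[S]_(r i.+1, r i)) X (e : {linear free_res r 0 -> X}) :
    (forall x, exists p, e p = x) -> (forall p, e p = 0 <-> exists q, p = q *m A 0) ->
    (forall i (p : 'rV_(r i.+1)), p *m A i = 0 <-> exists q, p = q *m A i.+1) ->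
  proj_resolution (free_d A) e.
Proof.
move=> e_onto ker_e ker_A; split=> //.
- by move=> i; split; [apply: fin_gen_free | apply: projective_free].
- by move=> p; rewrite ker_e; split=> -[q]; exists q.
- by move=> i p; rewrite -[free_d A i p]/(p *m A i) ker_A; split=> -[q]; exists q.
Qed.

Lemma free_resolution X : fin_gen X -> exists r (A : forall i, 'M[S]_(r i.+1, r i))
  (e : {linear free_res r 0 -> X}), proj_resolution (free_d A) e.
Proof.
move=> /fin_gen_row[m [e e_onto]]; have [r [A0 [A [eA AA0 AA]]]] := free_syzygies e.
exists (cons_size m r), (cons_mx A0 A), e; apply: free_resP => //.
by case.
Qed.

Lemma resolution_ex X : fin_gen X -> exists (P : nat -> lmodType S)
  (d : forall i, {linear P i.+1 -> P i}) (e : {linear P 0 -> X}), proj_resolution d e.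
Proof.
by move=> /free_resolution[r [A [e resX]]]; exists (free_res r), (free_d A), e.
Qed.

Section Cover.
Variables (X : lmodType S) (P : nat -> lmodType S)
  (d : forall i, {linear P i.+1 -> P i}) (e : {linear P 0 -> X}).
Hypothesis resX : proj_resolution d e.

Lemma res_dd i x : d i (d i.+1 x) = 0.
Proof. by have [_ _ _ dP] := resX; apply/dP; exists x. Qed.

Lemma res_ed x : e (d 0 x) = 0.
Proof. by have [_ _ eP _] := resX; apply/eP; exists x. Qed.

Lemma res_projective i : projective_module (P i).
Proof. by have [Pi _ _ _] := resX; case: (Pi i). Qed.

Lemma res_fin_gen i : fin_gen (P i).
Proof. by have [Pi _ _ _] := resX; case: (Pi i). Qed.

Lemma res_factor Y (f : {linear P 0 -> Y}) :
  (forall x, f (d 0 x) = 0) -> exists g : {linear X -> Y}, forall x, f x = g (e x).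
Proof.
move=> fd; have [_ e_onto eP _] := resX.
have [x|g gP] := factor_surj (f := e) (g := f) e_onto; first by move/eP=> [q <-].
by exists g => x; rewrite gP.
Qed.
End Cover.

Lemma projective_lift Q V W Z (f : {linear V -> W}) (g : {linear W -> Z})
    (h : {linear Q -> W}) : projective_module Q ->
    (forall w, g w = 0 -> exists v, f v = w) -> (forall x, g (h x) = 0) ->
  exists k : {linear Q -> V}, forall x, h x = f (k x).
Proof.
move=> projQ ex gh.
have [h' h'P] := factor_sub (U := limage f) (fun x => ex _ (gh x)).
have [f' f'P] := @factor_sub _ _ (limage f) V f (fun x => ex_intro _ x erefl).
have f'_onto y : exists v, f' v = y.
  by have [v vy] := sub_valP y; exists v; apply: sub_val_inj; rewrite -f'P.
have [k kP] := projQ _ _ f' h' f'_onto.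
by exists k => x; rewrite h'P kP f'P.
Qed.

Section Comparison.
Variables (X : lmodType S) (P : nat -> lmodType S)
  (d : forall i, {linear P i.+1 -> P i}) (e : {linear P 0 -> X}).
Variables (X' : lmodType S) (P' : nat -> lmodType S)
  (d' : forall i, {linear P' i.+1 -> P' i}) (e' : {linear P' 0 -> X'}).
Hypotheses (resX : proj_resolution d e) (resX' : proj_resolution d' e').
Implicit Types f : {linear X -> X'}.

(* [a] is the [i]-th component of a lift of [f] to the resolutions *)
Fixpoint res_lift f i : {linear P i -> P' i} -> Prop :=
  match i with
  | 0 => fun a => forall x, e' (a x) = f (e x)
  | j.+1 => fun a => exists b, res_lift f b /\ forall x, d' j (a x) = b (d j x)
  end.

Lemma res_lift_ex f i : exists a, @res_lift f i a.
Proof.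
have [_ e'_onto e'P d'P] := resX'.
elim: i => [|[|i] [b bP]].
- have [a aP] := @res_projective _ _ _ _ resX 0 _ _ e' (f \o e) e'_onto.
  by exists a => x; rewrite -aP.
- have [|w /e'P//||a aP] := @projective_lift (P 1) (P' 1) (P' 0) X' (d' 0) e' (b \o d 0).
  + exact: res_projective resX _.
  + by move=> x; rewrite /= bP (res_ed resX) linear0.
  + by exists a, b; split=> // x; rewrite -aP.
- have [|w /d'P//||a aP] := @projective_lift (P i.+2) (P' i.+2) (P' i.+1) (P' i) (d' i.+1) (d' i) (b \o d i.+1).
  + exact: res_projective resX _.
  + by have [c [_ bc]] := bP => x; rewrite /= bc (res_dd resX) linear0.
  + by exists a, b; split=> // x; rewrite -aP.
Qed.

Lemma res_liftD f f' i a a' :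
  @res_lift f i a -> @res_lift f' i a' -> @res_lift (f + f') i (a + a').
Proof.
elim: i a a' => [|i IHi] a a' /= => [aP a'P x|[b [bP ab]] [b' [b'P a'b']]].
  by rewrite linearD aP a'P.
by exists (b + b'); split; [apply: IHi | move=> x; rewrite linearD ab a'b'].
Qed.

Lemma res_liftN f i a : @res_lift f i a -> @res_lift (- f) i (- a).
Proof.
elim: i a => [|i IHi] a /= => [aP x|[b [bP ab]]].
  by rewrite linearN aP.
by exists (- b); split; [apply: IHi | move=> x; rewrite linearN ab].
Qed.

Lemma res_liftB f f' i a a' :
  @res_lift f i a -> @res_lift f' i a' -> @res_lift (f - f') i (a - a').
Proof. by move=> aP a'P; apply: res_liftD => //; apply: res_liftN. Qed.

Lemma res_lift_boundary f i a x : @res_lift f i a ->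
  exists y, a (d i x) = d' i y.
Proof.
have [_ _ e'P d'P] := resX'.
case: i a x => [|i] a x /= => [aP|[b [_ ab]]].
  by have /e'P[y <-] : e' (a (d 0 x)) = 0 by [rewrite aP (res_ed resX) linear0]; exists y.
have /d'P[y <-] : d' i (a (d i.+1 x)) = 0 by rewrite ab (res_dd resX) linear0.
by exists y.
Qed.

(** A null-homotopy a = d's + td, recorded only after composition with d: the second summand then
    disappears, and this is all that cocycles see. *)
Lemma res_lift_zero f i a : @res_lift f i a -> (forall x, f x = 0) ->
  exists s : {linear P i -> P' i.+1}, forall x, a (d i x) = d' i (s (d i x)).
Proof.
have [_ _ e'P d'P] := resX'; move=> + f0.
elim: i a => [|i IHi] a /= => [aP|[b [/IHi[s sP] ab]]].
  have [|w /e'P//||s sP] := @projective_lift (P 0) (P' 1) (P' 0) X' (d' 0) e' a.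
  - exact: res_projective resX _.
  - by move=> x; rewrite aP f0.
  - by exists s => x; rewrite -sP.
have [|w /d'P//||t tP] := @projective_lift (P i.+1) (P' i.+2) (P' i.+1) (P' i)
    (d' i.+1) (d' i) (a - (s \o d i : {linear _ -> _})).
- exact: res_projective resX _.
- by move=> x; rewrite hom_subE linearB ab sP subrr.
- by exists t => x; rewrite -tP hom_subE /= (res_dd resX) linear0 subr0.
Qed.

Lemma res_lift_zero_cocycle Y f i (a : {linear P i.+1 -> P' i.+1})
    (u : {linear P' i.+1 -> Y}) :
  res_lift f a -> (forall x, f x = 0) -> (forall x, u (d' i.+1 x) = 0) ->
  exists g : {linear P i -> Y}, forall x, u (a x) = g (d i x).
Proof.
move=> [b [bP ab]] f0 ud; have [s sP] := res_lift_zero bP f0.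
exists (u \o s) => x; have [_ _ _ d'P] := resX'.
have /d'P[y yE] : d' i (a x - s (d i x)) = 0 by rewrite linearB ab sP subrr.
by rewrite -[a x](subrK (s (d i x))) -yE linearD ud add0r.
Qed.
End Comparison.

Section Comparison2.
Variables (X : lmodType S) (P : nat -> lmodType S)
  (d : forall i, {linear P i.+1 -> P i}) (e : {linear P 0 -> X}).
Variables (X' : lmodType S) (P' : nat -> lmodType S)
  (d' : forall i, {linear P' i.+1 -> P' i}) (e' : {linear P' 0 -> X'}).
Variables (X2 : lmodType S) (P2 : nat -> lmodType S)
  (d2 : forall i, {linear P2 i.+1 -> P2 i}) (e2 : {linear P2 0 -> X2}).

Lemma res_lift_comp f f' i a a' : res_lift d e d' e' f (i := i) a ->
    res_lift d' e' d2 e2 f' (i := i) a' ->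
  res_lift d e d2 e2 (f' \o f) (i := i) (a' \o a).
Proof.
elim: i a a' => [|i IHi] a a' /= => [aP a'P x|[b [bP ab]] [b' [b'P a'b']]].
  by rewrite a'P aP.
by exists (b' \o b); split; [apply: IHi | move=> x /=; rewrite a'b' ab].
Qed.

Lemma res_lift_id i : res_lift d e d e idfun (i := i) idfun.
Proof. by elim: i => //= i IHi; exists idfun. Qed.
End Comparison2.

(** * Vanishing of Ext: independence of the resolution and long exact sequences *)

Section ExtVanishing.
Implicit Types A B C : lmodType S.

(** Lifts of the identity in both directions compare an arbitrary resolution with the given one, and
    their composite acts on cocycles as the identity up to coboundaries. *)
Lemma ext_vanishes_res X Y i (P : nat -> lmodType S) (d : forall i, {linear P i.+1 -> P i}) (e : {linear P 0 -> X}) :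
    proj_resolution d e ->
    (forall u : {linear P i.+1 -> Y}, (forall x, u (d i.+1 x) = 0) ->
       exists g : {linear P i -> Y}, forall x, u x = g (d i x)) ->
  ext_vanishes i.+1 X Y.
Proof.
move=> resX exP P' d' e' resX' u ud.
have [a aP] := res_lift_ex resX' resX idfun i.+1.
have [b bP] := res_lift_ex resX resX' idfun i.+1.
have [x|g gP] := exP (u \o b).
  by have [y /= ->] := res_lift_boundary resX resX' x bP; apply: ud.
have [c [cP ac]] := aP.
have [|h hP] := res_lift_zero_cocycle resX' resX'
    (res_liftB (res_lift_comp aP bP) (res_lift_id d' e' i.+1)) _ ud.
  by move=> x; rewrite hom_subE /= subrr.
exists ((g \o c : {linear _ -> _}) - h) => x.
have /eqP := hP x; rewrite hom_subE linearB /= subr_eq => /eqP uba.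
by rewrite -[RHS]/(g (c (d' i x)) - h (d' i x)) -ac -gP /= uba addrAC subrr add0r.
Qed.

Lemma ext_vanishes_retract i X Y Z (s : {linear Y -> Z}) (r : {linear Z -> Y}) :
  cancel s r -> ext_vanishes i.+1 X Z -> ext_vanishes i.+1 X Y.
Proof.
move=> sK vZ P d e resX u ud.
have [|g gP] := vZ P d e resX (s \o u); first by move=> x /=; rewrite ud linear0.
by exists (r \o g) => x; rewrite /= -gP /= sK.
Qed.

Section ShortExact.
Variables (A B C : lmodType S) (i : {linear A -> B}) (p : {linear B -> C}).
Hypothesis ex : short_exact i p.

Lemma ses_kernel W (f : {linear W -> B}) :
  (forall w, p (f w) = 0) -> exists g : {linear W -> A}, forall w, i (g w) = f w.
Proof.
have [i_inj _ pP] := ex; move=> pf.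
by have [w|g gP] := factor_inj i_inj (g := f); [apply/pP; apply: pf | exists g].
Qed.

Lemma ext1_lift X (f : {linear X -> C}) : fin_gen X -> ext_vanishes 1 X A ->
  exists g : {linear X -> B}, forall x, p (g x) = f x.
Proof.
move=> fgX vA; have [i_inj p_onto pP] := ex.
have [P [d [e resX]]] := resolution_ex fgX.
have [g gP] := @res_projective _ _ _ _ resX 0 _ _ p (f \o e) p_onto.
have [w|u uP] := ses_kernel (f := g \o d 0).
  by rewrite /= -gP /= (res_ed resX) linear0.
have [w|h hP] := vA _ _ _ resX u.
  by apply: i_inj; rewrite uP /= (res_dd resX) !linear0.
have [x|k kP] := res_factor resX (f := g - (i \o h : {linear _ -> _})).
  by rewrite hom_subE /= -hP uP subrr.
exists k => x; have [_ e_onto _ _] := resX; have [y <-] := e_onto x.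
rewrite -kP hom_subE linearB /= -gP (_ : p (i _) = 0) ?subr0 //.
by apply/pP; exists (h y).
Qed.

Lemma ext1_kernel Z : (forall f : {linear Z -> C}, exists g : {linear Z -> B}, forall x, p (g x) = f x) ->
  ext_vanishes 1 Z B -> ext_vanishes 1 Z A.
Proof.
move=> lifts vB P d e resZ u ud; have [i_inj _ pP] := ex.
have [x|g gP] := vB P d e resZ (i \o u); first by rewrite /= ud linear0.
have [x|f fP] := res_factor resZ (f := p \o g).
  by rewrite /= -gP; apply/pP; exists (u x).
have [k kP] := lifts f.
have [w|h hP] := ses_kernel (f := g - (k \o e : {linear _ -> _})).
  by rewrite hom_subE linearB /= kP -fP subrr.
exists h => x; apply: i_inj; rewrite hP hom_subE /= (res_ed resZ) linear0 subr0.
by rewrite -gP.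
Qed.

Lemma ext_kernel j Z : ext_vanishes j.+1 Z C -> ext_vanishes j.+2 Z B ->
  ext_vanishes j.+2 Z A.
Proof.
move=> vC vB P d e resZ u ud; have [i_inj p_onto pP] := ex.
have [x|g gP] := vB P d e resZ (i \o u); first by rewrite /= ud linear0.
have [x|h hP] := vC P d e resZ (p \o g).
  by rewrite /= -gP; apply/pP; exists (u x).
have [h' h'P] := @res_projective _ _ _ _ resZ j _ _ p h p_onto.
have [w|k kP] := ses_kernel (f := g - (h' \o d j : {linear _ -> _})).
  by rewrite hom_subE linearB /= -h'P -hP subrr.
exists k => x; apply: i_inj; rewrite kP hom_subE /= (res_dd resZ) linear0 subr0.
by rewrite -gP.
Qed.

Lemma ext_cokernel j Z : ext_vanishes j.+2 Z A -> ext_vanishes j.+1 Z B ->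
  ext_vanishes j.+1 Z C.
Proof.
move=> vA vB P d e resZ u ud; have [i_inj p_onto pP] := ex.
have [g gP] := @res_projective _ _ _ _ resZ j.+1 _ _ p u p_onto.
have [x|h hP] := ses_kernel (f := g \o d j.+1); first by rewrite /= -gP.
have [x|k kP] := vA P d e resZ h.
  by apply: i_inj; rewrite hP /= (res_dd resZ) !linear0.
have [x|l lP] := vB P d e resZ (g - (i \o k : {linear _ -> _})).
  by rewrite hom_subE /= -kP hP subrr.
exists (p \o l) => x /=; rewrite -lP hom_subE linearB -gP (_ : p (i _) = 0) ?subr0 //.
by apply/pP; exists (k x).
Qed.
End ShortExact.
End ExtVanishing.
End Resolutions.

(** * Cluster tilting subcategories *)

Section ClusterTilting.
Variable S : nzRingType.
Implicit Types C I Q V W X Y Z : lmodType S.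

Definition inj_mod Z : Prop := forall V W (i : {linear V -> W}) (f : {linear V -> Z}),
  injective i -> exists g : {linear W -> Z}, forall v, f v = g (i v).

Lemma inj_mod_extend Z V W (i : {linear V -> W}) (f : {linear V -> Z}) : inj_mod Z ->
    (forall v, i v = 0 -> f v = 0) ->
  exists g : {linear W -> Z}, forall v, f v = g (i v).
Proof.
move=> injZ /factor_image[h hP].
have [g gP] := injZ _ _ _ h (@sub_incl_inj _ _ (limage i)).
exists g => v; have [|y yE] := @sub_inclE _ _ (limage i) (i v); first by exists v.
by rewrite -(hP v y yE) gP yE.
Qed.

Lemma ext_inj_mod i X Z : inj_mod Z -> ext_vanishes i.+1 X Z.
Proof.
move=> injZ P d e [_ _ _ dP] u ud.
by apply: inj_mod_extend => // x /dP[y <-].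
Qed.

(** The artin algebra enters here and in the study of n-exact sequences through two facts: finitely
    generated modules are noetherian, and their quotients embed into finitely generated
    injectives. *)
Hypothesis noeth : forall V, fin_gen V -> noetherian V.
Hypothesis cogen : forall V (U : submodule V), fin_gen V ->
  exists I (f : {linear V -> I}), [/\ fin_gen I, inj_mod I & forall v, f v = 0 <-> U v].
Variables (n : nat) (M : add_subcat S).
Hypothesis n_gt0 : (0 < n)%N.
Hypothesis ctM : is_cluster_tilting n M.

Lemma fin_gen_M X : M X -> fin_gen X.
Proof. exact: (ct_fin_gen ctM). Qed.

Lemma ext_M i X Y : M X -> M Y -> (0 < i < n)%N -> ext_vanishes i X Y.
Proof. by move=> MX MY; apply: (iffLR (ct_ext_right ctM (fin_gen_M MY))). Qed.

Lemma M_right X : fin_gen X ->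
  (forall Z i, M Z -> (0 < i < n)%N -> ext_vanishes i Z X) -> M X.
Proof. by move=> fgX extX; apply/(ct_ext_right ctM fgX). Qed.

Lemma retract_M X Y (s : {linear X -> Y}) (r : {linear Y -> X}) :
  cancel s r -> M Y -> M X.
Proof.
move=> sK MY; have fgX : fin_gen X.
  by apply: (fin_gen_image (f := r)) (fin_gen_M MY) => x; exists (s x).
apply/(ct_ext_right ctM fgX) => C [//|i] MC lt_in.
by apply: ext_vanishes_retract sK _; apply: ext_M.
Qed.

Lemma projective_M X : fin_gen X -> projective_module X -> M X.
Proof.
move=> fgX projX; have [C [f [MC f_onto]]] := ct_generating ctM fgX.
have [s sP] := projX _ _ f idfun f_onto.
by apply: (retract_M (s := s) (r := f)) => // x; rewrite -sP.
Qed.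

Lemma free_M m : M ('rV[S]_m).
Proof. apply: projective_M; [apply: fin_gen_free | apply: projective_free]. Qed.

Lemma injective_M X : fin_gen X -> inj_mod X -> M X.
Proof.
move=> fgX injX; have [C [f [MC f_inj]]] := ct_cogenerating ctM fgX.
have [r rP] := injX _ _ f idfun f_inj.
by apply: (retract_M (s := f) (r := r)) => // x; rewrite -rP.
Qed.

Lemma approximation X : fin_gen X -> exists C (f : {linear C -> X}),
  [/\ M C, forall x, exists c, f c = x & forall C' (g : {linear C' -> X}), M C' ->
     exists h : {linear C' -> C}, forall x, f (h x) = g x].
Proof.
move=> fgX; have [C [f [MC fP]]] := ct_contravariantly_finite ctM fgX.
have lift C' (g : {linear C' -> X}) : M C' -> exists h : {linear C' -> C}, forall x, f (h x) = g x.
  by move=> MC'; have [h hP] := fP C' g MC'; exists h.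
exists C, f; split=> // x.
have [C' [g [MC' g_onto]]] := ct_generating ctM fgX.
by have [h hP] := lift C' g MC'; have [c <-] := g_onto x; exists (h c).
Qed.

Definition exact_complex (C : complex S) : Prop :=
  [/\ forall i x, (i < n)%N -> cx_d C i.+1 (cx_d C i x) = 0,
      forall i x, (i < n)%N -> cx_d C i.+1 x = 0 -> exists y, cx_d C i y = x &
      forall y, exists x, cx_d C n x = y].

(** Dimension shift on the target. The parameter k counts the Ext groups from M to [Z] known to
    vanish, and i the distance from the left end. Replacing [Z] by its cosyzygy lowers k and raises
    i, until i+1 = n, where [f] factors because the last map is onto. *)
Lemma exact_hom_right_aux (C : complex S) k : exact_complex C ->
    (forall i, (i <= n.+1)%N -> M (C i)) ->
  forall Z i, fin_gen Z -> (forall X j, M X -> (j < k)%N -> ext_vanishes j.+1 X Z) ->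
    (i + k).+1 = n ->
  forall f : {linear C i.+1 -> Z}, (forall x, f (cx_d C i x) = 0) ->
    exists g : {linear C i.+2 -> Z}, forall x, f x = g (cx_d C i.+1 x).
Proof.
move=> [dd0 ex onto] MC; elim: k => [|k IHk] Z i fgZ extZ ik f fd.
  rewrite addn0 in ik; have [||g gP] := factor_surj (f := cx_d C i.+1) (g := f).
  - by rewrite ik.
  - by move=> x /ex[|y <-]; [rewrite ik | apply: fd].
  - by exists g => x; rewrite gP.
have lt_in : (i < n)%N by rewrite -ik ltnS leq_addr.
have lt_in1 : (i.+1 < n)%N by rewrite -ik addnS !ltnS leq_addr.
have [I [j [fgI injI jP]]] := cogen (lker_sub (idfun : {linear Z -> Z})) fgZ.
have j_inj : injective j by move=> x y /eqP; rewrite -subr_eq0 -linearB => /eqP/jP/eqP; rewrite subr_eq0 => /eqP.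
(* [Z1] is I/Z, realised as the image of a map with kernel Z. *)
have [I' [p [fgI' _ pP]]] := cogen (limage j) fgI.
pose Z1 := sub_of (limage p).
have [q qP] := @factor_sub _ _ (limage p) I p (fun x => ex_intro _ x erefl).
have sesZ : short_exact j q.
  split=> // [x|x].
    by have [y yx] := sub_valP x; exists y; apply: sub_val_inj; rewrite -qP.
  split=> [qx|/pP px]; first by apply/pP; rewrite qP qx.
  by apply: sub_val_inj; rewrite -qP px.
have [x|g0 g0P] := inj_mod_extend (i := cx_d C i.+1) (f := j \o f) injI.
  by move=> /(ex i x lt_in)[y <-]; rewrite /= fd linear0.
have [||||h hP] := IHk Z1 i.+1 _ _ _ (q \o g0).
- exact: fin_gen_submodule (noeth fgI' _).
- move=> X l MX lt_lk; apply: (ext_cokernel sesZ); first by apply: extZ.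
  exact: ext_inj_mod.
- by rewrite addSn -addnS.
- move=> x /=; rewrite -g0P /=.
  by have [_ _ qj] := sesZ; apply/qj; exists (f x).
(* Since Ext^1(C_{i+3}, Z) = 0, the map into I/Z lifts to I; subtracting the lift from [g0] makes
   its values fall into Z. *)
have MC3 : M (C i.+3) by apply: MC; rewrite ltnS.
have [|h' h'P] := ext1_lift noeth sesZ h (fin_gen_M MC3); first exact: extZ.
have [x|g gP] := ses_kernel sesZ (f := g0 - (h' \o cx_d C i.+2 : {linear _ -> _})).
  by rewrite hom_subE linearB /= h'P -hP subrr.
exists g => x; apply: j_inj.
by rewrite gP hom_subE /= dd0 // linear0 subr0 -g0P.
Qed.

Lemma exact_hom_right (C : complex S) Z : exact_complex C ->
  (forall i, (i <= n.+1)%N -> M (C i)) -> M Z -> hom_right_exact n C Z.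
Proof.
move=> exC MC MZ; have [dd0 ex onto] := exC; split=> [f fd y|i lt_in f].
  by have [x <-] := onto y.
split=> [fd|[g gP] x]; last by rewrite gP dd0 // linear0.
apply: (@exact_hom_right_aux C (n - i.+1)) fd => //; first exact: fin_gen_M.
- move=> X j MX lt_j; apply: ext_M => //=.
  by rewrite -ltn_predRL; apply: leq_trans lt_j _; rewrite -subn1 leq_sub2l.
- by rewrite -addSn subnKC.
Qed.

Fact elem_linear V (v : V) : linear (fun y : 'rV[S]_1 => y 0 0 *: v).
Proof. by move=> a y z; rewrite !mxE scalerDl scalerA. Qed.
Definition elem V (v : V) : {linear 'rV[S]_1 -> V} := mk_linear (elem_linear v).

Lemma elem1 V (v : V) : elem v 1%:M = v.
Proof. by rewrite /= mxE eqxx scale1r. Qed.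

Lemma elem_comp V W (f : {linear V -> W}) v x : f (elem v x) = elem (f v) x.
Proof. by rewrite /= linearZ. Qed.

Lemma left_exact_inj (C : complex S) :
  hom_left_exact n C 'rV[S]_1 -> injective (cx_d C 0).
Proof.
move=> [inj0 _] x y /eqP; rewrite -subr_eq0 -linearB => /eqP dxy.
apply/eqP; rewrite -subr_eq0 -[x - y]elem1; apply/eqP; apply: inj0 => z.
by rewrite elem_comp dxy /= scaler0.
Qed.

Lemma left_exact_exact (C : complex S) : hom_left_exact n C 'rV[S]_1 ->
    (forall y, exists x, cx_d C n x = y) -> exact_complex C.
Proof.
move=> [_ ex] onto; split=> // i x lt_in => [|dx].
  rewrite -[x]elem1 elem_comp; apply: (iffRL (ex i lt_in _)).
  by exists (elem x) => y; rewrite elem_comp.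
have [|g gP] := iffLR (ex i lt_in (elem x)).
  by move=> z; rewrite elem_comp dx /= scaler0.
by exists (g 1%:M); rewrite -gP elem1.
Qed.

Lemma n_exact_inj (C : complex S) : is_n_exact n M C -> injective (cx_d C 0).
Proof. by case=> _ /(_ _ (free_M 1)) exL _; apply: left_exact_inj. Qed.

(** Hom from the free module of rank one detects exactness at the inner terms. At the last term, a
    map into an injective whose kernel is the image of the last differential must vanish. *)
Lemma n_exact_exact (C : complex S) : is_n_exact n M C -> exact_complex C.
Proof.
case=> MC /(_ _ (free_M 1)) exL exR; apply: left_exact_exact => // y.
have [I [f [fgI injI fP]]] := cogen (limage (cx_d C n)) (fin_gen_M (MC _ (leqnn _))).
apply: (iffLR (fP y)); have [H _] := exR _ (injective_M fgI injI).
by apply: H => x; apply/fP; exists x.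
Qed.
End ClusterTilting.

(** * n-pullbacks and n-pushouts *)

Section Pullback.
Variable S : nzRingType.
Implicit Types K L Q V W X Y Z : lmodType S.
Hypothesis noeth : forall V, fin_gen V -> noetherian V.
Hypothesis cogen : forall V (U : submodule V), fin_gen V ->
  exists (I : lmodType S) (f : {linear V -> I}),
    [/\ fin_gen I, inj_mod I & forall v, f v = 0 <-> U v].
Variables (n : nat) (M : add_subcat S).
Hypothesis n_gt0 : (0 < n)%N.
Hypothesis ctM : is_cluster_tilting n M.

(** An object already in M is approximated by itself, so that the approximation is then
    injective. *)
Lemma best_approximation X : fin_gen X -> exists K (p : {linear K -> X}),
  [/\ M K, forall x, exists c, p c = x, M X -> injective p &
     forall Z (g : {linear Z -> X}), M Z ->
     exists h : {linear Z -> K}, forall x, p (h x) = g x].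
Proof.
move=> fgX; have [MX|nMX] := pselect (M X).
  exists X, idfun; split=> // [x|_ x y //|Z g _]; first by exists x.
  by exists g.
by have [K [p [MK p_onto lift]]] := approximation ctM fgX; exists K, p; split.
Qed.

Section Fiber.
Variables (C D : complex S) (g : {linear C 0 -> D 1}).

(** Up to sign, the cocycles of the cone of [g] in lowest degree; the next term to the left has to
    cover them for maps from M. *)
Definition fiber : submodule (C 0 * D 0)%type.
Proof.
apply: (@Submodule S (C 0 * D 0)%type
  (fun z => cx_d C 0 z.1 = 0 /\ g z.1 = cx_d D 0 z.2)).
- by split; rewrite !linear0.
- by move=> x y [dx gx] [dy gy]; split; rewrite !linearD ?dx ?dy ?gx ?gy ?addr0.
- by move=> a x [dx gx]; split; rewrite !linearZ /= ?dx ?gx ?scaler0.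
Defined.
End Fiber.

Definition cons_ob K (C : nat -> lmodType S) i := if i is j.+1 then C j else K.
Definition cons_cx K (C : complex S) (d : {linear K -> C 0}) : complex S :=
  @Complex S (cons_ob K C) (fun i => match i return
    {linear cons_ob K C i -> cons_ob K C i.+1} with 0 => d | j.+1 => cx_d C j end).
Definition cons_map K (C : nat -> lmodType S) (D : nat -> lmodType S)
    (g0 : {linear K -> D 0}) (g : forall i, {linear C i -> D i.+1}) i :
    {linear cons_ob K C i -> D i} :=
  match i with 0 => g0 | j.+1 => g j end.

(* Built from right to left; the terms approximate the fibers of C -> D, and  *)
(* are equal to them once enough extension groups vanish.                     *)
Lemma pullback_complex m (D : complex S) X (f : {linear X -> D m.+1}) :
    M X -> (forall i, (i <= m.+1)%N -> M (D i)) ->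
    (forall i x, (i < m)%N -> cx_d D i.+1 (cx_d D i x) = 0) ->
  exists (C : complex S) (r : lin_iso (C m) X) (g : forall i, {linear C i -> D i.+1}),
  [/\ forall i, (i <= m)%N -> M (C i),
      forall i x, (i < m)%N -> g i.+1 (cx_d C i x) = cx_d D i.+1 (g i x),
      forall x, g m x = f (r x), forall x, cx_d C m x = 0 &
  [/\ forall i x, (i < m)%N -> cx_d C i.+1 (cx_d C i x) = 0,
      forall i, (i < m)%N -> forall Z (a : {linear Z -> C i.+1}) (b : {linear Z -> D i.+1}),
        M Z -> (forall z, cx_d C i.+1 (a z) = 0) ->
        (forall z, g i.+1 (a z) = cx_d D i.+1 (b z)) ->
        exists c : {linear Z -> C i}, forall z, cx_d C i (c z) = a z /\ g i (c z) = b z,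
      forall i x, (i < m)%N -> (i + n <= m)%N -> cx_d C i x = 0 -> g i x = 0 -> x = 0 &
      forall Z j, M Z -> (j < m)%N -> (j.+1 < n)%N ->
        ext_vanishes j.+1 Z (sub_of (fiber (g 0)))]].
Proof.
elim: m D f => [|m IHm] D f MX MD ddD.
  pose C := @Complex S (cons_ob X (fun=> zero_mod S)) (fun i => \0).
  exists C, (@LinIso S (C 0) X idfun idfun (fun=> erefl) (fun=> erefl)).
  exists (fun i => match i return {linear C i -> D i.+1} with 0 => f | j.+1 => \0 end).
  by split=> //; case.
have [||C [r [g [MC gC gr Cm [ddC lift inj extW]]]]] := IHm (cx_tail D) f MX.
- by move=> i le_im; apply: MD.
- by move=> i x lt_im; apply: ddD.
set W := sub_of (fiber (g 0)) in extW.
have fgW : fin_gen W.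
  by apply/fin_gen_submodule/noeth/(fin_gen_M ctM)/subcat_prod; [apply: MC|apply: MD].
have [K [p [MK p_onto p_inj p_lift]]] := best_approximation fgW.
pose d0 : {linear K -> C 0} := (fst : {linear _ -> _}) \o (sub_incl \o p : {linear _ -> _}).
pose g0 : {linear K -> D 1} := (snd : {linear _ -> _}) \o (sub_incl \o p : {linear _ -> _}).
pose C' := cons_cx d0; exists C', r, (@cons_map K C (fun i => D i.+1) g0 g).
have pP k : sub_val (p k) = (d0 k, g0 k) by rewrite [LHS]surjective_pairing.
have [dp gp] : (forall k, cx_d C 0 (d0 k) = 0) /\ (forall k, g 0 (d0 k) = cx_d D 1 (g0 k)).
  by split=> k; have [] := sub_valP (p k); rewrite pP.
split=> //; first by case.
  by case=> [x _|i x]; [apply: gp | apply: gC].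
split.
- by case=> [x _|i x]; [apply: dp | apply: ddC].
- case=> [_ Z a b MZ da gab|i]; last exact: lift.
  have [|c cP] := @factor_sub _ _ (fiber (g 0)) Z (pair_map a b).
    by move=> z; split; [apply: da | apply: gab].
  have [h hP] := p_lift Z c MZ; exists h => z.
  by have := pP (h z); rewrite hP -cP => -[-> ->].
- case=> [x _|i x]; last by rewrite addSn; apply: inj.
  (* At this stage the Ext groups from M to the fiber vanish in all degrees below n, so the fiber is
     in M and its approximation is injective. *)
  rewrite add0n => le_nm dx gx; apply: p_inj; last first.
    by apply: sub_val_inj; rewrite linear0 pP; congr (_, _).
  apply: (M_right ctM fgW) => Z [//|j] MZ lt_jn; apply: extW => //.
  by rewrite -ltnS; apply: leq_trans le_nm; case/andP: lt_jn.
(* The new fiber is the kernel of K + D_0 -> W. Its higher Ext groups shift down to those of W, and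
   Ext^1 vanishes because every map from M to W lifts to K. *)
pose q0 : {linear (K * D 0)%type -> (C 0 * D 1)%type} :=
  pair_map (d0 \o fst) (copair_map g0 (\- cx_d D 0)).
have [|q qP] := @factor_sub _ _ (fiber (g 0)) _ q0.
  move=> [k b]; split; first exact: dp.
  by rewrite /= /copair_map /= gp linearB ddD // subr0.
have sesW : short_exact (@sub_incl _ _ (@fiber C' D g0)) q.
  split; first exact: sub_incl_inj.
    move=> w; have [k kw] := p_onto w; exists (k, 0); apply: sub_val_inj.
    by rewrite -qP -kw pP /= /pair_map /copair_map /= linear0 subr0.
  move=> [k b]; split=> [qkb|[w <-]]; last first.
    apply: sub_val_inj; rewrite -qP linear0; have [/= dw gw] := sub_valP w.
    by rewrite /q0 /= /pair_map /copair_map /= dw gw subrr.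
  apply: sub_inclE; have := qP (k, b); rewrite qkb /= /pair_map /copair_map /= => -[dk gk].
  by split=> //=; apply/eqP; rewrite -subr_eq0 gk.
have MKD : M (K * D 0)%type by apply: subcat_prod => //; apply: MD.
move=> Z [|j] MZ lt_jm lt_jn; last first.
  apply: (ext_kernel sesW); first by apply: extW => //; apply: ltnW.
  exact: (ext_M ctM).
apply: (ext1_kernel sesW); last exact: (ext_M ctM).
move=> h; have [k kP] := p_lift Z h MZ.
exists (@inj1 S K (D 0) \o k) => z; apply: sub_val_inj.
by rewrite -qP /= /pair_map /copair_map /= linear0 subr0 -pP kP.
Qed.

(** The components are chosen from right to left, each supplied by the weak universal property of
    the fibers. *)
Lemma lift_complex m (B C D : complex S) (g : forall i, {linear C i -> D i})
    (h : forall i, {linear B i -> D i}) (sm : {linear B m -> C m}) :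
    (forall i, (i <= m)%N -> M (B i)) ->
    (forall i x, (i.+1 < m)%N -> cx_d B i.+1 (cx_d B i x) = 0) ->
    (forall i x, (i < m)%N -> h i.+1 (cx_d B i x) = cx_d D i (h i x)) ->
    (forall x, cx_d C m x = 0) ->
    (forall i, (i < m)%N -> forall Z (a : {linear Z -> C i.+1}) (b : {linear Z -> D i}),
        M Z -> (forall z, cx_d C i.+1 (a z) = 0) ->
        (forall z, g i.+1 (a z) = cx_d D i (b z)) ->
        exists c : {linear Z -> C i}, forall z, cx_d C i (c z) = a z /\ g i (c z) = b z) ->
    (forall x, g m (sm x) = h m x) ->
  exists s : forall i, {linear B i -> C i},
  [/\ forall i x, (i < m)%N -> s i.+1 (cx_d B i x) = cx_d C i (s i x),
      forall i x, (i <= m)%N -> g i (s i x) = h i x &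
      forall x, s m x = sm x].
Proof.
elim: m B C D g h sm => [|m IHm] B C D g h sm MB ddB hB Cm lift gsm.
  exists (fun i => match i return {linear B i -> C i} with 0 => sm | j.+1 => \0 end).
  by split=> // -[].
have [||||||s [sB gs sE]] := IHm (cx_tail B) (cx_tail C) (cx_tail D)
  (fun i => g i.+1) (fun i => h i.+1) sm.
- by move=> i; exact: (MB i.+1).
- by move=> i x; exact: (ddB i.+1).
- by move=> i x; exact: (hB i.+1).
- exact: Cm.
- by move=> i lt_im; exact: (lift i.+1).
- exact: gsm.
have [|z|z|c cP] := lift 0 isT (B 0) (s 0 \o cx_d B 0) (h 0); first exact: MB.
- case: m {IHm lift MB hB} sm s sB gs sE Cm gsm ddB => [|m] sm s sB gs sE Cm gsm ddB.
    exact: Cm.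
  by rewrite /= -[LHS]sB // ddB // linear0.
- by rewrite /= gs // hB.
exists (fun i => match i return {linear B i -> C i} with 0 => c | j.+1 => s j end).
split=> // [[|i] x lt_im|[|i] x le_im]; first by have [-> _] := cP x.
- exact: sB.
- by have [_ ->] := cP x.
- exact: gs.
Qed.

Lemma cutK (b : bool) V (x : V) : b -> uncut_map b V (cut_map b V x) = x.
Proof. by case: b. Qed.

Lemma uncutK (b : bool) V (x : cut b V) : cut_map b V (uncut_map b V x) = x.
Proof. by case: b x => // x; apply/rowP => -[]. Qed.

Definition iso_sym V W (h : lin_iso V W) : lin_iso W V :=
  LinIso (iso_invK h) (iso_funK h).

Definition iso_comp V W X (h : lin_iso W X) (k : lin_iso V W) : lin_iso V X.
Proof.
apply: (@LinIso S V X (h \o k) (iso_inv k \o iso_inv h)) => x /=.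
  by rewrite !iso_funK.
by rewrite !iso_invK.
Defined.

(** The complex of approximated fibers has Y as its left end because the fibers there are exact, and
    its cone is left exact by the lifting property. The second clause is the weak universal
    property: a morphism over [f] factors through the pullback with the identity on the right. *)
Lemma n_pullback_ex Y X X' (zeta : nseq n Y X') (f : {linear X -> X'}) :
    M X -> is_n_exact n M zeta ->
  exists eta : nseq n Y X, is_n_pullback M f zeta eta /\
    forall L (l : {linear L -> Y}) (xi : nseq n L X) (h : forall i, {linear xi i -> zeta i}),
      is_n_exact n M xi -> is_nseq_morph l f h ->
      exists s : forall i, {linear xi i -> eta i}, is_nseq_morph l idfun s.
Proof.
move=> MX exz; have [Mz exzL exzR] := exz.
have [dd0 exact_z onto_z] := n_exact_exact cogen ctM exz.
have inj_z := n_exact_inj ctM exz.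
(* A zero term is prepended so that the construction also produces the left end, in the position of
   [zeta 0]. *)
pose D := @cons_cx (zero_mod S) zeta \0.
have [||C [r [g [MC gC gr Cm [ddC lift inj _]]]]] :=
    @pullback_complex n.+1 D X (iso_inv (ns_right zeta) \o f) MX.
- by case=> [_|i le_in]; [apply: subcat_zero => x; apply: thinmx0 | apply: Mz].
- by case=> [x _|i x lt_in]; rewrite /= ?linear0 //; apply: dd0.
(* With m = n+1 the bound i + n <= m leaves exactly the degrees 0 and 1. *)
have inj1 x : cx_d C 1 x = 0 -> g 1 x = 0 -> x = 0 by apply: inj; rewrite ?ltnS.
have g0_inj x : g 0 x = 0 -> x = 0.
  move=> gx; apply: inj => //; apply: inj1; first exact: ddC.
  by rewrite gC // gx linear0.
(* Two lifts: first a preimage of the pair (0, d y) in degree 1, then one of this element and y in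
   degree 0. *)
have g0_onto y : exists x, g 0 x = y.
  have [z|z|a aP] := lift 1 n_gt0 'rV[S]_1 \0
      (cx_d zeta 0 \o elem y : {linear _ -> D 2}) (free_M ctM 1).
  - by rewrite linear0.
  - by rewrite linear0; apply: esym; apply: dd0.
  have [z|z|c cP] := lift 0 isT 'rV[S]_1 a (elem y : {linear _ -> D 1}) (free_M ctM 1).
  - by have [-> _] := aP z.
  - by have [_ ->] := aP z.
  by exists (c 1%:M); have [_ ->] := cP 1%:M; apply: elem1.
have [i0 i0P] : exists i0 : lin_iso (C 0) (zeta 0), forall x, i0 x = g 0 x.
  apply: bij_lin_iso g0_onto => x y gxy; apply/eqP; rewrite -subr_eq0.
  by apply/eqP/g0_inj; rewrite linearB gxy subrr.
pose eta := @NSeq S n Y X C (iso_comp (iso_sym i0) (ns_left zeta)) r.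
have g_left y : g 0 (ns_left eta y) = ns_left zeta y by rewrite -i0P /= iso_invK.
have g_chain i x : (i <= n)%N -> g i.+1 (cx_d C i x) = cx_d zeta i (g i x) by exact: gC.
have g_right x : ns_right zeta (g n.+1 x) = f (ns_right eta x).
  by rewrite gr /= iso_invK.
have exL Z : M Z -> hom_left_exact n C Z.
  move=> MZ; split=> [a da z|i lt_in a].
    by apply: g0_inj; apply: inj_z; rewrite -g_chain // da !linear0.
  split=> [da|[c cP] z]; last by rewrite cP ddC // ltnS ltnW.
  have [_ exzLi] := exzL _ MZ.
  have [z|b bP] := iffLR (exzLi i lt_in (g i.+1 \o a : {linear _ -> zeta i.+1})).
    by rewrite /= -g_chain // da linear0.
  have lt_in1 : (i < n.+1)%N by rewrite ltnS ltnW.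
  have [c cP] := lift i lt_in1 Z a (b : {linear _ -> D i.+1}) MZ da bP.
  by exists c => z; have [->] := cP z.
have exC : exact_complex n C.
  apply: left_exact_exact; first exact: exL (free_M ctM 1).
  move=> y; have [b by_] := onto_z (g n.+1 y).
  have [z|z|c cP] := lift n (ltnSn n) 'rV[S]_1 (elem y) (elem b : {linear _ -> D n.+1}) (free_M ctM 1).
  - exact: Cm.
  - have -> : g n.+1 (elem y z) = elem (g n.+1 y) z by rewrite elem_comp.
    by rewrite -by_; apply: esym; apply: (elem_comp (cx_d zeta n)).
  by exists (c 1%:M); have [-> _] := cP 1%:M; apply: elem1.
have exeta : is_n_exact n M eta.
  by split=> // Z MZ; apply: (exact_hom_right noeth cogen ctM).
exists eta; split; first split=> //.
  exists g; split; first by split=> // i le_in x; apply: g_chain.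
  move=> Z MZ; pose T := cone n (C := cx_tail eta) (D := cx_tail zeta) (fun i => g i.+1).
  have lt_S i : (i < n)%N -> (i < n.+1)%N by move=> lt_in; rewrite ltnS ltnW.
  have ca1 i (w : T i) : (i < n)%N -> cx_d T i w = 0 ->
      cx_d C i.+1 (uncut_map (i <= n)%N (C i.+1) w.1) = 0.
    move=> lt_in /(congr1 fst)/(congr1 (uncut_map (i.+1 <= n)%N (C i.+2))) /=.
    by rewrite cutK // linear0 => /eqP; rewrite oppr_eq0 => /eqP.
  have ca2 i (w : T i) : cx_d T i w = 0 ->
      g i.+1 (uncut_map (i <= n)%N (C i.+1) w.1) + pre_d (cx_tail zeta) i w.2 = 0.
    by move=> /(congr1 snd).
  split=> [a ca z|i lt_in a].
    have u0 : uncut_map (0 <= n)%N (C 1) (a z).1 = 0.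
      apply: inj1; first exact: ca1 n_gt0 (ca z).
      by have /= := ca2 0 _ (ca z); rewrite addr0.
    rewrite [LHS]surjective_pairing; congr (_, _); last exact: thinmx0.
    have := congr1 (cut_map (0 <= n)%N (C 1)) u0; rewrite uncutK => ->.
    exact: linear0.
  split=> [ca|[c cP] z].
    pose a1 : {linear Z -> C i.+2} := uncut_map (i.+1 <= n)%N (C i.+2) \o
      ((fst : {linear T i.+1 -> cut (i.+1 <= n)%N (C i.+2)}) \o a : {linear _ -> _}).
    pose b : {linear Z -> zeta i.+1} := (snd : {linear T i.+1 -> _}) \o a.
    (* The sign matches the cone differential, whose first component is -d. *)
    have [z|z|c cP] := lift i.+1 lt_in Z (- a1) (b : {linear _ -> D i.+2}) MZ.
    - have [lt_in1|ge_n] := ltnP i.+1 n.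
        by rewrite hom_oppE linearN (ca1 i.+1 (a z)) ?oppr0.
      have e : i.+1 = n by apply/eqP; rewrite eqn_leq lt_in.
      by move: (- a1) => {a1} a1; rewrite e in a1 *; apply: Cm.
    - rewrite hom_oppE linearN; apply/eqP; rewrite eq_sym -addr_eq0 addrC.
      by apply/eqP; apply: ca2.
    exists (pair_map (cut_map (i <= n)%N (C i.+1) \o c : {linear _ -> _})
                     (\0 : {linear Z -> pre_ob (cx_tail zeta) i})) => z.
    have [dc gc] := cP z; rewrite /= /pair_map /= /cone_d /= cutK; last exact: ltnW.
    by rewrite dc gc linear0 addr0 hom_oppE opprK uncutK -surjective_pairing.
  have pre_dd j (w : pre_ob (cx_tail zeta) j) : (j < n)%N ->
      cx_d zeta j.+1 (pre_d (cx_tail zeta) j w) = 0.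
    by case: j w => [|j] w lt_jn; rewrite /= ?linear0 // dd0 // ltnW.
  rewrite cP /= /cone_d /= cutK // [RHS]surjective_pairing; congr (_, _).
    have ddN u : cx_d C i.+2 (- cx_d C i.+1 u) = 0 by rewrite linearN ddC // oppr0.
    by rewrite ddN oppr0 linear0.
  by rewrite linearN linearD g_chain // pre_dd // addr0 addNr.
move=> L l xi h exxi [h_chain h_left h_right].
have [dd_xi _ _] := n_exact_exact cogen ctM exxi; have [Mxi _ _] := exxi.
have [||||x|s [s_chain gs sn]] := @lift_complex n.+1 xi C zeta g h
  (iso_inv r \o (ns_right xi : {linear _ -> _})) Mxi.
- by move=> i x lt_in; apply: dd_xi.
- by move=> i x lt_in; apply: h_chain.
- exact: Cm.
- by move=> i lt_in Z a b; apply: lift.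
- have /= : ns_right zeta (g n.+1 (iso_inv r (ns_right xi x))) = ns_right zeta (h n.+1 x).
    by rewrite gr iso_invK iso_invK h_right.
  by move/(congr1 (iso_inv (ns_right zeta))); rewrite !iso_funK.
exists s; split=> [i le_in x|x|x]; first exact: s_chain.
- apply/eqP; rewrite -subr_eq0 -[ns_left eta _]/(ns_left eta (l x)).
  apply/eqP/g0_inj; rewrite linearB gs // h_left g_left; exact: subrr.
- by rewrite sn /= iso_invK.
Qed.
End Pullback.

(** * Constructing morphisms of n-exact sequences *)

Section Morphisms.
Variable S : nzRingType.
Implicit Types K L N Q V W X Y Z : lmodType S.
Hypothesis noeth : forall V, fin_gen V -> noetherian V.
Hypothesis cogen : forall V (U : submodule V), fin_gen V ->
  exists (I : lmodType S) (f : {linear V -> I}),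
    [/\ fin_gen I, inj_mod I & forall v, f v = 0 <-> U v].
Variables (n : nat) (M : add_subcat S).
Hypothesis n_gt0 : (0 < n)%N.
Hypothesis ctM : is_cluster_tilting n M.

Lemma cut_eq (b : bool) V (x y : cut b V) : ~~ b -> x = y.
Proof. by case: b x y => // x y _; apply/rowP => -[]. Qed.

Lemma M_cut (b : bool) X : M X -> M (cut b X).
Proof. by case: b => // _; apply: subcat_zero => x; apply: thinmx0. Qed.

(* The cone is exact, hence an n-cokernel. *)
Lemma n_pushout_of_morph L L' N (l : {linear L -> L'}) (xi : nseq n L N)
    (eta : nseq n L' N) (s : forall i, {linear xi i -> eta i}) :
  is_n_exact n M xi -> is_n_exact n M eta -> is_nseq_morph l idfun s ->
  is_n_pushout M l xi eta.
Proof.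
move=> exxi exeta smor; split=> //; exists s; split=> // Z MZ.
have [s_chain _ s_right] := smor.
have [dd_xi ex_xi onto_xi] := n_exact_exact cogen ctM exxi.
have [dd_eta ex_eta onto_eta] := n_exact_exact cogen ctM exeta.
have inj_eta := n_exact_inj ctM exeta.
have [[Mxi _ _] [Meta _ _]] := (exxi, exeta).
have s_inj x : s n.+1 x = 0 -> x = 0.
  move=> sx; rewrite -[x](iso_funK (ns_right xi)) -[ns_right xi x]s_right sx.
  by rewrite !linear0.
have s_onto y : exists x, s n.+1 x = y.
  exists (iso_inv (ns_right xi) (ns_right eta y)).
  rewrite -[LHS](iso_funK (ns_right eta)) s_right /= iso_invK; exact: iso_funK.
pose T := cone n s.
have pre_dd j (w : pre_ob eta j) : (j <= n)%N -> cx_d eta j (pre_d eta j w) = 0.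
  by case: j w => [|j] w lt_jn; rewrite /= ?linear0 // dd_eta.
have pre_ex j (y : eta j) : (j <= n)%N -> cx_d eta j y = 0 -> exists w, pre_d eta j w = y.
  case: j y => [|j] y le_jn dy; last exact: ex_eta.
  by exists 0; rewrite linear0; apply: inj_eta; rewrite dy linear0.
apply: (exact_hom_right noeth cogen ctM) => //; last first.
  move=> i le_in; apply: subcat_prod; first by apply/M_cut/Mxi.
  by case: i le_in => [|i] le_in; [apply: subcat_zero => x; apply: thinmx0 | apply/Meta/ltnW].
split=> [i w lt_in|i w lt_in dw|y].
- rewrite /= /cone_d /= cutK // [RHS]surjective_pairing; congr (_, _).
    have ddN u : cx_d xi i.+1 (- cx_d xi i u) = 0 by rewrite linearN dd_xi // oppr0.
    by rewrite ddN oppr0 linear0.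
  by rewrite linearN linearD s_chain ?(ltnW lt_in) // pre_dd ?(ltnW lt_in) // addr0 addNr.
- set a := uncut_map (i.+1 <= n)%N (xi i.+1) w.1.
  have gd : s i.+1 a + cx_d eta i w.2 = 0 by have := congr1 snd dw.
  have da : cx_d xi i.+1 a = 0.
    have [lt_in1|ge_n] := ltnP i.+1 n.
      have := congr1 (fun z => uncut_map (i.+2 <= n)%N (xi i.+2) z.1) dw.
      by rewrite /= cutK // linear0 => /eqP; rewrite oppr_eq0 => /eqP.
    (* The cone omits the last term of [xi], so here d a = 0 is not part of the cocycle condition;
       it follows because [s] is injective on the right ends. *)
    have e : i.+1 = n by apply/eqP; rewrite eqn_leq lt_in.
    have : s i.+2 (cx_d xi i.+1 a) = 0.
      rewrite s_chain; last by rewrite e.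
      have -> : s i.+1 a = - cx_d eta i w.2 by apply/eqP; rewrite -addr_eq0 gd.
      by rewrite linearN dd_eta // oppr0.
    by move: (cx_d xi i.+1 a); rewrite e => b; apply: s_inj.
  have [a' a'P] := ex_xi i a lt_in da.
  have [|y' y'P] := pre_ex i (s i a' + w.2) (ltnW lt_in).
    by rewrite linearD -s_chain ?(ltnW lt_in) // a'P.
  exists (cut_map (i <= n)%N (xi i) (- a'), y').
  rewrite /= /cone_d /= cutK ?(ltnW lt_in) // !linearN opprK a'P y'P.
  by rewrite uncutK addKr -surjective_pairing.
- have [x xP] := s_onto (cx_d eta n y.2); have [a aP] := onto_xi x.
  have [|y' y'P] := pre_ex n (y.2 - s n a) (leqnn n).
    by rewrite linearB -s_chain // aP xP subrr.
  exists (cut_map (n <= n)%N (xi n) a, y').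
  rewrite /= /cone_d /= cutK // y'P [y.2 - _]addrC addrA subrr add0r.
  by rewrite [RHS]surjective_pairing; congr (_, _); apply: cut_eq; rewrite ltnn.
Qed.

Lemma extend_complex m (B C : complex S) (h0 : {linear B 0 -> C 0}) (h1 : {linear B 1 -> C 1}) :
    (forall x, h1 (cx_d B 0 x) = cx_d C 0 (h0 x)) ->
    (forall i x, (i < m)%N -> cx_d C i.+1 (cx_d C i x) = 0) ->
    (forall i, (i < m)%N -> forall f : {linear B i.+1 -> C i.+2}, (forall x, f (cx_d B i x) = 0) ->
       exists g : {linear B i.+2 -> C i.+2}, forall x, f x = g (cx_d B i.+1 x)) ->
  exists s : forall i, {linear B i -> C i},
  [/\ forall i x, (i <= m)%N -> s i.+1 (cx_d B i x) = cx_d C i (s i x),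
      s 0 =1 h0 & s 1 =1 h1].
Proof.
elim: m B C h0 h1 => [|m IHm] B C h0 h1 h01 ddC ext.
  exists (fun i => match i return {linear B i -> C i} with 0 => h0 | 1 => h1 | _ => \0 end).
  by split=> // -[|i].
have [x|h2 h2P] := ext 0 isT (cx_d C 1 \o h1); first by rewrite /= h01 ddC.
have [x|i x lt_im|i lt_im|s [s_chain s0 s1]] := IHm (cx_tail B) (cx_tail C) h1 h2.
- by rewrite -[LHS]h2P.
- exact: (ddC i.+1).
- exact: (ext i.+1).
exists (fun i => match i return {linear B i -> C i} with 0 => h0 | j.+1 => s j end).
split=> // [[|i] x le_im]; last exact: s_chain.
by rewrite s0 h01.
Qed.

(** Right exactness of [xi] against the terms of [zeta] extends a compatible pair of components to
    the right; the last component determines the map on the right ends. *)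
Lemma nseq_extend L N Y X' (xi : nseq n L N) (zeta : nseq n Y X')
    (l : {linear L -> Y}) (h1 : {linear xi 1 -> zeta 1}) :
    is_n_exact n M xi -> is_n_exact n M zeta ->
    (forall x, h1 (cx_d xi 0 (ns_left xi x)) = cx_d zeta 0 (ns_left zeta (l x))) ->
  exists (f : {linear N -> X'}) (h : forall i, {linear xi i -> zeta i}),
    is_nseq_morph l f h.
Proof.
move=> [_ _ exR] exz h1P; have [dd_z _ _] := n_exact_exact cogen ctM exz.
have [Mz _ _] := exz.
have [||i lt_in g|h [h_chain h0 _]] := @extend_complex n xi zeta
    (ns_left zeta \o (l \o iso_inv (ns_left xi) : {linear _ -> _})) h1.
- by move=> x; rewrite -{1}[x](iso_invK (ns_left xi)) h1P.
- exact: dd_z.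
- by have [_ ex] := exR _ (Mz i.+2 lt_in) => /(ex i lt_in g).
exists (ns_right zeta \o (h n.+1 \o iso_inv (ns_right xi) : {linear _ -> _})), h.
by split=> [i le_in x|x|x]; [exact: h_chain | rewrite h0 /= iso_funK | rewrite /= iso_funK].
Qed.

(** The morphism is altered by a homotopy concentrated in degree n. It changes only the components n
    and n+1, hence not the left end, as n is positive. *)
Lemma nseq_homotopy L N Y X' (xi : nseq n L N) (zeta : nseq n Y X')
    (l : {linear L -> Y}) (f f' : {linear N -> X'}) (h : forall i, {linear xi i -> zeta i})
    (k : {linear N -> zeta n}) :
    is_n_exact n M xi -> is_n_exact n M zeta -> is_nseq_morph l f h ->
    (forall x, f' x = f x + ns_right zeta (cx_d zeta n (k x))) ->
  exists h' : forall i, {linear xi i -> zeta i}, is_nseq_morph l f' h'.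
Proof.
move=> exxi exz [h_chain h_left h_right] f'E.
have [dd_xi _ _] := n_exact_exact cogen ctM exxi.
have [dd_z _ _] := n_exact_exact cogen ctM exz.
pose kn : {linear xi n.+1 -> zeta n} := k \o ns_right xi.
have [kappa [kappa_n kappa0]] : exists kappa : forall i, {linear xi i.+1 -> zeta i},
    kappa n =1 kn /\ forall i, i != n -> forall x, kappa i x = 0.
  exists (dfwith (fun i => \0 : {linear xi i.+1 -> zeta i}) kn).
  by rewrite dfwith_in; split=> // i ne_in x; rewrite dfwith_out // eq_sym.
exists (fun i => match i return {linear xi i -> zeta i} with
  | 0 => h 0 + (kappa 0 \o cx_d xi 0 : {linear _ -> _})
  | j.+1 => h j.+1 + (kappa j.+1 \o cx_d xi j.+1 : {linear _ -> _})
                  + (cx_d zeta j \o kappa j : {linear _ -> _}) end).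
have kdd i x : kappa i.+1 (cx_d xi i.+1 (cx_d xi i x)) = 0.
  have [lt_in|le_ni] := ltnP i n; first by rewrite dd_xi // linear0.
  by rewrite kappa0 // neq_ltn ltnS le_ni orbT.
split=> [i le_in x|x|x].
- have -> : forall j, forall y : xi j.+1, (h j.+1 + (kappa j.+1 \o cx_d xi j.+1 : {linear _ -> _})
      + (cx_d zeta j \o kappa j : {linear _ -> _})) y
      = h j.+1 y + kappa j.+1 (cx_d xi j.+1 y) + cx_d zeta j (kappa j y) by [].
  rewrite kdd // addr0 h_chain //; case: i x le_in => [|i] x le_in.
    by rewrite hom_addE linearD.
  by rewrite !hom_addE !linearD /= [X in _ = _ + X]dd_z // addr0.
- by rewrite hom_addE /= kappa0 ?addr0 // eq_sym -lt0n.
- rewrite !hom_addE !linearD /= h_right kappa_n f'E.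
  by rewrite kappa0 ?linear0 ?addr0 // eqn_leq ltnn.
Qed.

Lemma coextend_complex m (B C : complex S) (s0 : {linear B m -> C m}) (s1 : {linear B m.+1 -> C m.+1}) :
    (forall x, s1 (cx_d B m x) = cx_d C m (s0 x)) ->
    (forall i x, (i < m)%N -> cx_d B i.+1 (cx_d B i x) = 0) ->
    (forall i, (i < m)%N -> forall f : {linear B i -> C i.+1}, (forall x, cx_d C i.+1 (f x) = 0) ->
       exists g : {linear B i -> C i}, forall x, f x = cx_d C i (g x)) ->
  exists s : forall i, {linear B i -> C i},
    (forall i x, (i <= m)%N -> s i.+1 (cx_d B i x) = cx_d C i (s i x)) /\ s m.+1 =1 s1.
Proof.
elim: m B C s0 s1 => [|m IHm] B C s0 s1 s01 ddB lift.
  exists (fun i => match i return {linear B i -> C i} with 0 => s0 | 1 => s1 | _ => \0 end).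
  by split=> // -[|i].
have [|i x lt_im|i lt_im|s [s_chain s1P]] := IHm (cx_tail B) (cx_tail C) s0 s1.
- exact: s01.
- exact: (ddB i.+1).
- exact: (lift i.+1).
have [x|c cP] := lift 0 isT (s 0 \o cx_d B 0).
  by rewrite /= -[LHS]s_chain // [X in s 1 X]ddB // linear0.
exists (fun i => match i return {linear B i -> C i} with 0 => c | j.+1 => s j end).
by split=> // -[|i] x le_im; [rewrite -cP | apply: s_chain].
Qed.

Lemma nseq_coextend L L' N N' (xi : nseq n L N) (xi' : nseq n L' N') (r : {linear N -> N'})
    (p : {linear xi n -> xi' n}) :
    is_n_exact n M xi -> is_n_exact n M xi' ->
    (forall x, ns_right xi' (cx_d xi' n (p x)) = r (ns_right xi (cx_d xi n x))) ->
  exists (l : {linear L -> L'}) (s : forall i, {linear xi i -> xi' i}), is_nseq_morph l r s.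
Proof.
move=> exxi [_ exL _] pr; have [dd_xi _ _] := n_exact_exact cogen ctM exxi.
have [Mxi _ _] := exxi.
have [||i lt_in f df|s [s_chain sn]] := @coextend_complex n xi xi' p
    (iso_inv (ns_right xi') \o (r \o ns_right xi : {linear _ -> _})).
- by move=> x; rewrite /= -pr iso_funK.
- exact: dd_xi.
- have Mi : M (xi i) by apply: Mxi; rewrite ltnW // ltnS ltnW.
  by have [_ ex] := exL _ Mi; apply/(ex i lt_in).
exists (iso_inv (ns_left xi') \o (s 0 \o ns_left xi : {linear _ -> _})), s.
split=> [i le_in x|x|x]; first exact: s_chain.
- by rewrite /= iso_invK.
- by rewrite sn /= iso_invK.
Qed.

Lemma nseq_sum_exact L L' N N' (xi : nseq n L N) (xi' : nseq n L' N') :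
  is_n_exact n M xi -> is_n_exact n M xi' -> is_n_exact n M (nseq_sum xi xi').
Proof.
move=> exxi exxi'; have [dd_xi _ _] := n_exact_exact cogen ctM exxi.
have [dd_xi' _ _] := n_exact_exact cogen ctM exxi'.
have [[Mxi exL exR] [Mxi' exL' exR']] := (exxi, exxi'); split=> [i le_in|Z MZ|Z MZ].
- by apply: subcat_prod; [apply: Mxi | apply: Mxi'].
- have [[inj ex] [inj' ex']] := (exL Z MZ, exL' Z MZ); split=> [f df x|i lt_in f].
    rewrite [f x]surjective_pairing; congr (_, _).
      by apply: (inj (fst \o f)) => y; have := congr1 fst (df y).
    by apply: (inj' (snd \o f)) => y; have := congr1 snd (df y).
  split=> [df|[g gP] x].
    have [|g gP] := iffLR (ex i lt_in (fst \o f)); first by move=> x; by have := congr1 fst (df x).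
    have [|g' g'P] := iffLR (ex' i lt_in (snd \o f)); first by move=> x; by have := congr1 snd (df x).
    exists (pair_map g g') => x; rewrite [f x]surjective_pairing.
    by congr (_, _); [apply: gP | apply: g'P].
  rewrite gP [LHS]surjective_pairing; congr (_, _).
    by apply: (iffRL (ex i lt_in (cx_d xi i \o (fst \o g : {linear _ -> _})))); exists (fst \o g).
  by apply: (iffRL (ex' i lt_in (cx_d xi' i \o (snd \o g : {linear _ -> _})))); exists (snd \o g).
- have [[inj ex] [inj' ex']] := (exR Z MZ, exR' Z MZ); split=> [f fd x|i lt_in f].
    rewrite (prod_decomp x) linearD.
    have -> : f (inj1 _ x.1) = 0.
      apply: (inj (f \o @inj1 S _ _)) => y.
      by rewrite -(fd (y, 0)) /= /prod_map /= linear0.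
    have -> : f (inj2 _ x.2) = 0.
      apply: (inj' (f \o @inj2 S _ _)) => y.
      by rewrite -(fd (0, y)) /= /prod_map /= linear0.
    exact: addr0.
  split=> [fd|[g gP] x].
    have [|g gP] := iffLR (ex i lt_in (f \o @inj1 S _ _)).
      by move=> y; rewrite -(fd (y, 0)) /= /prod_map /= linear0.
    have [|g' g'P] := iffLR (ex' i lt_in (f \o @inj2 S _ _)).
      by move=> y; rewrite -(fd (0, y)) /= /prod_map /= linear0.
    exists (copair_map g g') => x; rewrite {1}(prod_decomp x) linearD.
    by rewrite /= /copair_map /= -gP -g'P.
  rewrite gP [X in g X]surjective_pairing /= dd_xi // dd_xi' //.
  exact: (linear0 g).
Qed.
End Morphisms.

(** * Lifting resolutions to n-exact sequences *)

Section Classes.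
Variable S : nzRingType.
Implicit Types K L N Q V W X Y Z : lmodType S.
Hypothesis noeth : forall V, fin_gen V -> noetherian V.
Hypothesis cogen : forall V (U : submodule V), fin_gen V ->
  exists (I : lmodType S) (f : {linear V -> I}),
    [/\ fin_gen I, inj_mod I & forall v, f v = 0 <-> U v].
Variables (n : nat) (M : add_subcat S).
Hypothesis ctM : is_cluster_tilting n.+1 M.

Section Lifts.
Variables (X : lmodType S) (P : nat -> lmodType S)
  (d : forall i, {linear P i.+1 -> P i}) (e : {linear P 0 -> X}).
Hypotheses (resX : proj_resolution d e) (MX : M X).

(* [u] is the component P_i -> xi_k, with i + k = n + 1, of a morphism from   *)
(* the resolution of X to xi over f : X -> N.                                 *)
Fixpoint lifts L N (xi : nseq n.+1 L N) (f : {linear X -> N}) i k :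
    {linear P i -> xi k} -> Prop :=
  match i with
  | 0 => fun u => forall (E : k = n.+1) x,
      ns_right xi (ecast j (xi j.+1) E (cx_d xi k (u x))) = f (e x)
  | j.+1 => fun u => exists v : {linear P j -> xi k.+1},
      lifts f v /\ forall x, cx_d xi k (u x) = v (d j x)
  end.

Section OneSequence.
Variables (L N : lmodType S) (xi : nseq n.+1 L N).
Implicit Types f : {linear X -> N}.

Lemma lifts0 f (u : {linear P 0 -> xi n.+1}) :
  lifts f u <-> forall x, ns_right xi (cx_d xi n.+1 (u x)) = f (e x).
Proof.
split=> [uP x|uP E x]; first exact: (uP erefl x).
by rewrite (eq_irrelevance E erefl) -uP.
Qed.

Lemma liftsB f f' i k (u u' : {linear P i -> xi k}) :
  lifts f u -> lifts f' u' -> lifts (f - f') (u - u').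
Proof.
elim: i k u u' => [|i IHi] k u u' /= => [uP u'P E x|[v [vP uv]] [v' [v'P u'v']]].
  by subst k; rewrite /= !linearB /= (uP erefl) (u'P erefl).
by exists (v - v'); split; [apply: IHi | move=> x; rewrite !linearB uv u'v'].
Qed.

Lemma liftsD f f' i k (u u' : {linear P i -> xi k}) :
  lifts f u -> lifts f' u' -> lifts (f + f') (u + u').
Proof.
elim: i k u u' => [|i IHi] k u u' /= => [uP u'P E x|[v [vP uv]] [v' [v'P u'v']]].
  by subst k; rewrite /= !linearD /= (uP erefl) (u'P erefl).
by exists (v + v'); split; [apply: IHi | move=> x; rewrite !linearD uv u'v'].
Qed.

Lemma lifts_zero i k : lifts 0 (0 : {linear P i -> xi k}).
Proof.
elim: i k => [|i IHi] k /=; last first.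
  by exists 0; split=> // x; rewrite !hom_0E linear0.
by move=> E x; subst k; rewrite /= !linear0.
Qed.

Hypothesis exxi : is_n_exact n.+1 M xi.

Let dd0 i x : (i < n.+1)%N -> cx_d xi i.+1 (cx_d xi i x) = 0.
Proof. by have [H _ _] := n_exact_exact cogen ctM exxi; apply: H. Qed.

Let ex_xi i x : (i < n.+1)%N -> cx_d xi i.+1 x = 0 -> exists y, cx_d xi i y = x.
Proof. by have [_ H _] := n_exact_exact cogen ctM exxi; apply: H. Qed.

Let M_xi i : (i <= n.+2)%N -> M (xi i).
Proof. by have [H _ _] := exxi; apply: H. Qed.

Lemma lifts_ex f i k : (i + k)%N = n.+1 -> exists u : {linear P i -> xi k}, lifts f u.
Proof.
have [_ _ onto_xi] := n_exact_exact cogen ctM exxi.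
elim: i k => [|i IHi] k ik.
  rewrite add0n in ik; subst k.
  have [|u uP] := @res_projective _ _ _ _ _ resX 0 _ _
    (ns_right xi \o (cx_d xi n.+1 : {linear _ -> _})) (f \o e).
    move=> y; have [x xP] := onto_xi (iso_inv (ns_right xi) y).
    by exists x; rewrite /= xP iso_invK.
  by exists u; apply/lifts0 => x; rewrite -[LHS]uP.
have [|v vP] := IHi k.+1; first by rewrite addnS -addSn.
have lt_kn : (k < n.+1)%N by rewrite -ik ltnS leq_addl.
have [||u uP] := @projective_lift _ (P i.+1) _ _ _ (cx_d xi k) (cx_d xi k.+1) (v \o d i)
  (@res_projective _ _ _ _ _ resX _).
- by move=> w; apply: ex_xi.
- move=> x /=; case: i ik v vP {IHi} x => [|i] ik v vP x.
    move: ik; rewrite add1n => -[ik]; subst k; have /lifts0 vE := vP.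
    have := vE (d 0 x); rewrite (res_ed resX) linear0 => vd0.
    by rewrite -[LHS](iso_funK (ns_right xi)) vd0 linear0.
  by have [w [_ vw]] := vP; rewrite vw (res_dd resX) linear0.
by exists u, v; split=> // x; rewrite -uP.
Qed.

Lemma lifts_d i k (g : {linear P i -> xi k}) : (i + k)%N = n -> lifts 0 (cx_d xi k \o g).
Proof.
case: i g => [|i] g ik.
  by rewrite add0n in ik; subst k; apply/lifts0 => x; rewrite /= dd0 // linear0.
exists 0; split=> [|x]; first exact: lifts_zero.
by rewrite /= dd0 // -ik ltnS leq_addl.
Qed.

Lemma lifts_boundary (g : {linear P n -> xi 0}) : lifts 0 (g \o d n).
Proof. by exists (cx_d xi 0 \o g); split=> //; apply: lifts_d; rewrite addn0. Qed.

Lemma lifts_cocycle f (u : {linear P n.+1 -> xi 0}) x : lifts f u -> u (d n.+1 x) = 0.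
Proof.
move=> [v [_ uv]]; apply: (n_exact_inj ctM exxi).
by rewrite uv (res_dd resX) !linear0.
Qed.

(** A lift of [f] through the last middle term contracts the degree-zero component, and projectivity
    carries the contraction up the resolution. *)
Lemma lifts_factor_aux f (p : {linear X -> xi n.+1}) i k (u : {linear P i -> xi k.+1}) :
    (forall x, f x = ns_right xi (cx_d xi n.+1 (p x))) -> (i + k)%N = n -> lifts f u ->
  exists t : {linear P i -> xi k}, forall x, u (d i x) = cx_d xi k (t (d i x)).
Proof.
move=> fp; elim: i k u => [|i IHi] k u ik.
  rewrite add0n in ik; subst k => /lifts0 uP.
  have [x dx|x|t tP] := @projective_lift _ (P 0) _ _ _ (cx_d xi n) (cx_d xi n.+1)
    (u - (p \o e : {linear _ -> _})) (@res_projective _ _ _ _ _ resX _).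
  - exact: ex_xi.
  - rewrite hom_subE linearB /= -[cx_d _ _ (u x)](iso_funK (ns_right xi)) uP fp iso_funK.
    exact: subrr.
  exists t => x; rewrite -tP hom_subE /= (res_ed resX) linear0 subr0 //.
move=> [v [vP uv]].
have [|t tP] := IHi k.+1 v _ vP; first by rewrite addnS -addSn.
have lt_kn : (k < n.+1)%N by rewrite -ik ltnS leq_addl.
have [x dx|x|t' t'P] := @projective_lift _ (P i.+1) _ _ _ (cx_d xi k) (cx_d xi k.+1)
    (u - (t \o d i : {linear _ -> _})) (@res_projective _ _ _ _ _ resX _).
- exact: ex_xi.
- by rewrite hom_subE linearB /= uv tP subrr.
by exists t' => x; rewrite -t'P hom_subE /= (res_dd resX) linear0 subr0.
Qed.

Lemma lifts_factor f (p : {linear X -> xi n.+1}) (u : {linear P n.+1 -> xi 0}) :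
    (forall x, f x = ns_right xi (cx_d xi n.+1 (p x))) -> lifts f u ->
  exists g : {linear P n -> xi 0}, forall x, u x = g (d n x).
Proof.
move=> fp [v [vP uv]]; have [t tP] := lifts_factor_aux fp (addn0 n) vP.
by exists t => x; apply: (n_exact_inj ctM exxi); rewrite uv tP.
Qed.

(** The contraction is carried down the resolution: Ext^{i+1}(X, xi_{k+1}) = 0 makes the error in
    each component a coboundary, until in degree zero it becomes a map out of X. *)
Lemma lifts_coboundary_aux f i k (u : {linear P i.+1 -> xi k}) (g : {linear P i -> xi k}) :
    (i + k)%N = n -> lifts f u -> (forall x, cx_d xi k (u x) = cx_d xi k (g (d i x))) ->
  exists p : {linear X -> xi n.+1}, forall x, f x = ns_right xi (cx_d xi n.+1 (p x)).
Proof.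
elim: i k u g => [|i IHi] k u g ik [v [vP uv]] ug.
  rewrite add0n in ik; subst k; move/lifts0: vP => vP.
  have [x|p pP] := res_factor resX (f := v - (cx_d xi n \o g : {linear _ -> _})).
    by rewrite hom_subE /= -uv ug subrr.
  exists p => x; have [_ e_onto _ _] := resX; have [y <-] := e_onto x.
  by rewrite -vP -pP hom_subE linearB /= dd0 // subr0.
have lt_kn : (k < n.+1)%N by rewrite -ik ltnS leq_addl.
have ext : ext_vanishes i.+1 X (xi k.+1).
  apply: (ext_M ctM) => //; first by apply: M_xi; apply: ltnW.
  by rewrite /= -ik addSn !ltnS leq_addr.
have [x|h hP] := ext _ _ _ resX (v - (cx_d xi k \o g : {linear _ -> _})).
  by rewrite hom_subE /= -uv ug subrr.
apply: (IHi k.+1 v h) => //; first by rewrite addnS -addSn.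
move=> x; rewrite -hP hom_subE linearB /= dd0 // subr0 //.
Qed.

(** Vanishing Ext groups into the middle terms supply the components of the lift one after another;
    the last composite kills the boundaries and descends to a map X -> N. *)
Lemma lifts_of_coboundary_aux i k (u : {linear P i.+1 -> xi k}) (v : {linear P i -> xi k.+1}) :
    (i + k)%N = n -> (forall x, cx_d xi k (u x) = v (d i x)) ->
  exists f : {linear X -> N}, lifts f u.
Proof.
elim: i k u v => [|i IHi] k u v ik uv.
  rewrite add0n in ik; subst k.
  have [x|f fP] := res_factor resX (f := ns_right xi \o (cx_d xi n.+1 \o v : {linear _ -> _})).
    by rewrite /= -uv dd0 // linear0.
  by exists f, v; split=> //; apply/lifts0 => x; rewrite -fP.
have lt_kn : (k < n.+1)%N by rewrite -ik ltnS leq_addl.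
have lt_kn1 : (k.+1 < n.+1)%N by rewrite -ik addSn !ltnS leq_addl.
have ext : ext_vanishes i.+1 X (xi k.+2).
  apply: (ext_M ctM) => //; first exact: M_xi.
  by rewrite /= -ik addSn !ltnS leq_addr.
have [x|v' v'P] := ext _ _ _ resX (cx_d xi k.+1 \o v).
  by rewrite /= -uv dd0.
have [|f fP] := IHi k.+1 v v' _ v'P; first by rewrite addnS -addSn.
by exists f, v.
Qed.
End OneSequence.

Lemma lifts_morph L L' N N' (xi : nseq n.+1 L N) (xi' : nseq n.+1 L' N')
    (l : {linear L -> L'}) (r : {linear N -> N'}) (h : forall i, {linear xi i -> xi' i})
    (f : {linear X -> N}) i k (u : {linear P i -> xi k}) :
  is_nseq_morph l r h -> (i + k)%N = n.+1 -> lifts f u -> lifts (r \o f) (h k \o u).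
Proof.
move=> [h_chain h_left h_right]; elim: i k u => [|i IHi] k u ik.
  rewrite add0n in ik; subst k => /lifts0 uP; apply/lifts0 => x.
  by rewrite /= -h_chain // h_right uP.
move=> [v [vP uv]]; exists (h k.+1 \o v); split.
  by apply: IHi => //; rewrite addnS -addSn.
by move=> x; rewrite /= -h_chain ?uv // -ltnS -ik ltnS leq_addl.
Qed.
End Lifts.

Lemma lifts_res_lift X (P : nat -> lmodType S) (d : forall i, {linear P i.+1 -> P i}) (e : {linear P 0 -> X})
    X' (P' : nat -> lmodType S) (d' : forall i, {linear P' i.+1 -> P' i}) (e' : {linear P' 0 -> X'})
    L N (xi : nseq n.+1 L N) (f : {linear X -> N}) (g : {linear X' -> X})
    i k (u : {linear P i -> xi k}) (a : {linear P' i -> P i}) :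
  (i + k)%N = n.+1 -> lifts d e f u -> res_lift d' e' d e g a ->
  lifts d' e' (f \o g) (u \o a).
Proof.
elim: i k u a => [|i IHi] k u a ik.
  rewrite add0n in ik; subst k => /lifts0 uP aP; apply/lifts0 => x.
  by rewrite /= uP aP.
move=> [v [vP uv]] [b [bP ab]]; exists (v \o b); split.
  by apply: IHi => //; rewrite addnS -addSn.
by move=> x; rewrite /= uv ab.
Qed.
End Classes.

(** * Auslander-Reiten data *)

Section Coresolution.
Variable S : nzRingType.
Implicit Types C V W X Y Z : lmodType S.
Hypothesis noeth : forall V, fin_gen V -> noetherian V.
Variables (n : nat) (I : nat -> lmodType S) (delta : forall b, {linear I b.+1 -> I b}).
Variables (T : lmodType S) (iota : {linear T -> I n.+1}).
Hypotheses (injI : forall b, inj_mod (I b)) (iota_inj : injective iota).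
Hypothesis iotaP : forall y, delta n y = 0 <-> exists x, iota x = y.
Hypothesis deltaP : forall b y, (b < n)%N -> delta b y = 0 <-> exists x, delta b.+1 x = y.

(** T is the kernel at the start of a complex I_{n+1} -> ... -> I_0 of injectives, exact at I_n,
    ..., I_1. Exactness of Hom(V, I) at I_{b+1} thus expresses Ext^{n-b}(V, T) = 0; the lemmas below
    match it with the vanishing defined by projective resolutions of V. *)
Definition hom_coexact V b : Prop := forall f : {linear V -> I b.+1},
  (forall x, delta b (f x) = 0) ->
  exists g : {linear V -> I b.+2}, forall x, f x = delta b.+1 (g x).

Let delta_dd b x : (b < n)%N -> delta b (delta b.+1 x) = 0.
Proof. by move=> lt_bn; apply/deltaP => //; exists x. Qed.

Let iota_lift W (f : {linear W -> I n.+1}) : (forall x, delta n (f x) = 0) ->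
  exists g : {linear W -> T}, forall x, iota (g x) = f x.
Proof. by move=> df; apply: factor_inj => // x; apply/iotaP. Qed.

Section Resolved.
Variables (C : lmodType S) (P : nat -> lmodType S)
  (d : forall i, {linear P i.+1 -> P i}) (e : {linear P 0 -> C}).
Hypothesis resC : proj_resolution d e.

Let lift_proj i b (f : {linear P i -> I b.+1}) : (b < n)%N ->
  (forall x, delta b (f x) = 0) ->
  exists g : {linear P i -> I b.+2}, forall x, f x = delta b.+1 (g x).
Proof.
move=> lt_bn; apply: projective_lift; first exact: res_projective resC _.
by move=> w /deltaP; apply.
Qed.

Let extend i b (f : {linear P i.+1 -> I b}) : (forall x, f (d i.+1 x) = 0) ->
  exists g : {linear P i -> I b}, forall x, f x = g (d i x).
Proof.
move=> fd; apply: inj_mod_extend => // x; have [_ _ _ dP] := resC.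
by move=> /dP[y <-].
Qed.

(** A chase in the double complex Hom(P, I): extend [f] by injectivity, push the error one step
    along the coresolution, and correct it there by induction on the resolution degree. In degree
    zero the error lives on C, where exactness is assumed. *)
Lemma coresolution_ext i : (forall b, (b < n)%N -> hom_coexact C b) ->
  forall b (f : {linear P i.+1 -> I b.+1}), (i < b <= n)%N ->
  (forall x, f (d i.+1 x) = 0) -> (forall x, delta b (f x) = 0) ->
  exists g : {linear P i -> I b.+1},
    (forall x, f x = g (d i x)) /\ forall x, delta b (g x) = 0.
Proof.
move=> exC; elim: i => [|i IHi] [//|b] f /andP[lt_ib lt_bn] fd df.
  have [g0 g0P] := extend fd.
  have [x|k kP] := res_factor resC (f := delta b.+1 \o g0); first by rewrite /= -g0P df.
  have [x|k' k'P] := exC b lt_bn k.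
    by have [_ e_onto _ _] := resC; have [y <-] := e_onto x; rewrite -kP /= delta_dd.
  exists (g0 - (k' \o e : {linear _ -> _})); split=> x.
    by rewrite hom_subE /= (res_ed resC) linear0 subr0.
  by rewrite hom_subE linearB /= -k'P -kP /= subrr.
have [g0 g0P] := extend fd.
have [|x|x|g' [g'P dg']] := IHi b (delta b.+1 \o g0).
- by rewrite ltnS in lt_ib; rewrite lt_ib ltnW.
- by rewrite /= -g0P df.
- by rewrite /= delta_dd.
have [l lP] := lift_proj lt_bn dg'.
exists (g0 - (l \o d i : {linear _ -> _})); split=> x.
  by rewrite hom_subE /= (res_dd resC) linear0 subr0.
by rewrite hom_subE linearB /= -lP -g'P /= subrr.
Qed.

(** The same chase in the opposite direction: a map is lifted along the coresolution until it takes
    values in T, where Ext(C, T) = 0 applies. *)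
Lemma coresolution_hom_aux k : (forall i, (i < n)%N -> ext_vanishes i.+1 C T) ->
  forall i b (f : {linear P i.+1 -> I b.+1}), (b + k)%N = n -> (i.+1 + k <= n)%N ->
  (forall x, f (d i.+1 x) = 0) -> (forall x, delta b (f x) = 0) ->
  exists g : {linear P i -> I b.+1},
    (forall x, f x = g (d i x)) /\ forall x, delta b (g x) = 0.
Proof.
move=> extC; elim: k => [|k IHk] i b f bk le_ik fd df.
  rewrite addn0 in bk; subst b; rewrite addn0 in le_ik.
  have [u uP] := iota_lift df.
  have [x|v vP] := extC i le_ik _ _ _ resC u.
    by apply: iota_inj; rewrite uP fd linear0.
  exists (iota \o v); split=> x; first by rewrite /= -vP uP.
  by apply/iotaP; exists (v x).
have lt_bn : (b < n)%N by rewrite -bk addnS ltnS leq_addr.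
have [f1 f1P] := lift_proj lt_bn df.
have [||x|x|g1 [g1P dg1]] := IHk i.+1 b.+1 (f1 \o d i.+1).
- by rewrite addSn -addnS.
- by rewrite addSn -addnS.
- by rewrite /= (res_dd resC) linear0.
- by rewrite /= -f1P fd.
have [x|h hP] := @extend i b.+2 (f1 - g1); first by rewrite hom_subE -g1P /= subrr.
exists (delta b.+1 \o h); split=> x; last exact: delta_dd.
by rewrite /= -hP hom_subE linearB dg1 subr0 f1P.
Qed.
End Resolved.

Lemma ext_of_coexact C i : (forall b, (b < n)%N -> hom_coexact C b) -> (i < n)%N ->
  ext_vanishes i.+1 C T.
Proof.
move=> exC lt_in P d e resC u ud.
have [|x|x|g [gP dg]] := coresolution_ext resC exC (i := i) (b := n) (f := iota \o u).
- by rewrite lt_in leqnn.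
- by rewrite /= ud linear0.
- by apply/iotaP; exists (u x).
have [h hP] := iota_lift dg.
by exists h => x; apply: iota_inj; rewrite hP -gP.
Qed.

Lemma coexact_of_ext C : fin_gen C -> (forall i, (i < n)%N -> ext_vanishes i.+1 C T) ->
  forall b, (b < n)%N -> hom_coexact C b.
Proof.
move=> fgC extC b lt_bn f df; have [P [d [e resC]]] := resolution_ex noeth fgC.
have [||x|f1 f1P] := @projective_lift _ (P 0) _ _ _ (delta b.+1) (delta b) (f \o e).
- exact: res_projective resC _.
- by move=> w /deltaP; apply.
- exact: df.
have [||x|x|g1 [g1P dg1]] :=
    coresolution_hom_aux resC (k := n - b.+1) extC (i := 0) (b := b.+1) (f := f1 \o d 0).
- by rewrite subnKC.
- by rewrite add1n -subSn // subSS leq_subr.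
- by rewrite /= (res_dd resC) linear0.
- by rewrite /= -f1P /= (res_ed resC) linear0.
have [x|h hP] := res_factor resC (f := f1 - g1); first by rewrite hom_subE -g1P /= subrr.
exists h => x; have [_ e_onto _ _] := resC; have [y <-] := e_onto x.
by rewrite -hP hom_subE linearB dg1 subr0 -f1P.
Qed.
End Coresolution.

(** * The form attached to a translate *)

Section ARData.
Variables (R : comNzRingType) (Lam : algType R) (E : lmodType R).
Hypotheses (artR : artinian R) (fgLam : fin_gen (S := R) Lam) (dualE : is_dualizing E).
Local Notation S := (Lam^c).
Local Notation J := (J Lam E).
Local Notation Jmap := (@Jmap R Lam E _ _).
Implicit Types C V W X Y Z T : lmodType S.

Lemma artin_noeth V : fin_gen V -> noetherian V.
Proof. exact: fin_gen_noetherian. Qed.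

Lemma artin_cogen V (U : submodule V) : fin_gen V ->
  exists (I : lmodType S) (f : {linear V -> I}),
    [/\ fin_gen I, inj_mod I & forall v, f v = 0 <-> U v].
Proof.
move=> fgV; have [m [f fP]] := cogenerated artR fgLam dualE U fgV.
exists (J m), f; split=> //; first exact: fin_gen_J.
by move=> V' W i g; apply: J_injective.
Qed.

Lemma fin_gen_hom V W : fin_gen V -> fin_gen W -> noetherian ({linear V -> W} : lmodType R).
Proof.
move=> /fin_genP[s sP] fgW.
have noethW : noetherian (res W) by apply/(commutative_noetherian artR)/fin_gen_res.
have [N [ev [noethN ev0]]] : exists (N : lmodType R) (ev : {linear {linear V -> W} -> N}),
    noetherian N /\ forall f, ev f = 0 -> forall v, v \in s -> f v = 0.
  elim: s {sP} => [|x s [N [ev [noethN ev0]]]].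
    exists (zero_mod R), \0; split=> // U; exists [::]; split=> // v _; exact: thinmx0.
  have lin_x : linear (fun f : {linear V -> W} => f x : res W) by [].
  exists (res W * N)%type, (pair_map (mk_linear lin_x) ev); split.
    apply: (@noetherian_add R (res W) N (res W * N)%type (@inj1 R (res W) N)
      (@inj2 R (res W) N)) noethW noethN _.
    by move=> [w y]; exists w, y; rewrite [LHS]prod_decomp.
  move=> f [fx /ev0 fs] v.
  by rewrite inE => /predU1P[->|/fs].
apply: (noetherian_inj (f := ev)) noethN.
move=> f g /eqP; rewrite -subr_eq0 -linearB => /eqP/ev0 fg.
apply/eqP; rewrite -subr_eq0; apply/eqP; apply: linear_ext => v.
exact: (@lspan_least _ _ (lker_sub (f - g))) (sP v).
Qed.

Variables (n : nat) (M : add_subcat S).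
Hypothesis ctM : is_cluster_tilting n.+1 M.

(* [T] is an n-Auslander-Reiten translate of [X]: the form [ar_form] on       *)
(* Hom(P_(n+1), T) induces isomorphisms between Hom(Y, T) modulo injectives   *)
(* and the dual of Ext^(n+1)(X, Y). *)
Record ar_data X T : Type := ARData {
  ar_P : nat -> lmodType S;
  ar_d : forall i, {linear ar_P i.+1 -> ar_P i};
  ar_e : {linear ar_P 0 -> X};
  ar_res : proj_resolution ar_d ar_e;
  ar_form : {linear {linear ar_P n.+1 -> T} -> E};
  ar_cob : forall g : {linear ar_P n -> T}, ar_form (g \o ar_d n) = 0;
  ar_rep : forall Y (b : {linear {linear ar_P n.+1 -> Y} -> E}),
    (forall g : {linear ar_P n -> Y}, b (g \o ar_d n) = 0) ->
    exists h : {linear Y -> T}, forall u : {linear ar_P n.+1 -> Y}, ar_form (h \o u) = b u;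
  ar_sep : forall Y (h : {linear Y -> T}),
    (forall u : {linear ar_P n.+1 -> Y}, (forall x, u (ar_d n.+1 x) = 0) ->
       ar_form (h \o u) = 0) ->
    exists (I : lmodType S) (i : {linear Y -> I}) (j : {linear I -> T}),
      [/\ M I, inj_mod I & forall y, h y = j (i y)] }.

Lemma M_J m : M (J m).
Proof.
apply: (injective_M ctM); first exact: fin_gen_J.
by move=> V W i f; apply: J_injective.
Qed.

(** The form is the trace pairing with [iota]. A functional killing coboundaries corresponds to a
    map into nu P_{n+1} that dies in nu P_n, so it factors through T. *)
Lemma ar_data_of_coresolution X T (r : nat -> nat) (A : forall i, 'M[S]_(r i.+1, r i))
    (e : {linear free_res S r 0 -> X}) (iota : {linear T -> J (r n.+1)}) :
  proj_resolution (free_d A) e -> injective iota ->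
  (forall y, Jmap (A n) y = 0 <-> exists x, iota x = y) ->
  ar_data X T.
Proof.
move=> resA iota_inj iotaP.
have JA x : Jmap (A n) (iota x) = 0 by apply/iotaP; exists x.
have AA (x : 'cV[S]_(r n)) : A n.+1 *m (A n *m x) = 0.
  rewrite mulmxA (_ : A n.+1 *m A n = 0) ?mul0mx //; apply/row_matrixP => i.
  by rewrite row_mul rowE; have := res_dd resA (i := n) (delta_mx 0 i); rewrite row0.
apply: (@ARData X T _ _ _ resA (jpairing iota)).
- move=> g; rewrite mk_linearE -[LHS]/(jpair iota (g \o rmul (A n))) -pair_Jmap.
  by apply: big1 => i _; rewrite -[RHS](J_ev0 E (unit_col Lam i)); congr (J_ev _ _); apply: JA.
- move=> Y b bd; have [f fP] := pair_onto b.
  have [x|h hP] := factor_inj (g := f) iota_inj; last first.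
    exists h => u; rewrite -fP mk_linearE /jpair; apply: eq_bigr => i _.
    by rewrite -hP.
  apply/iotaP; move: x; apply: (@pair_inj _ _ _ _ _ (Jmap (A n) \o f) \0) => u.
  rewrite pair_Jmap fP [LHS]bd /jpair big1 // => i _; exact: hom_0E.
(* A functional vanishing on cocycles extends along the coboundary map, which exhibits [iota] after
   [h] as [Jmap (A n.+1)] after g; so h factors through the injective nu P_{n+2}. *)
- move=> Y h hu.
  have [u uA|b bP] := extend_functional dualE (f := precomp Y (rmul (A n.+1)))
    (b := jpairing (iota \o h)).
    apply: hu => x; exact: (congr1 (fun k : {linear _ -> _} => k x) uA).
  have [g gP] := pair_onto b.
  have ihg y : iota (h y) = Jmap (A n.+1) (g y).
    move: y; apply: (@pair_inj _ _ _ _ _ (iota \o h) (Jmap (A n.+1) \o g)) => u.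
    by rewrite pair_Jmap gP -[RHS]bP.
  have [x|j jP] := factor_inj (f := iota) (g := Jmap (A n.+1)) iota_inj.
    by apply/iotaP; apply: J_ext => y; rewrite !Jmap_ev AA /J_ev linear0.
  exists (J (r n.+2)), g, j; split; first exact: M_J.
    by move=> V W i f; apply: J_injective.
  by move=> y; apply: iota_inj; rewrite jP ihg.
Qed.
End ARData.

(** * Translates of objects of M, in both directions *)

Section ARExistence.
Variables (R : comNzRingType) (Lam : algType R) (E : lmodType R).
Hypotheses (artR : artinian R) (fgLam : fin_gen (S := R) Lam) (dualE : is_dualizing E).
Local Notation S := (Lam^c).
Local Notation J := (J Lam E).
Local Notation Jmap := (@Jmap R Lam E _ _).
Implicit Types C V W X Y Z T : lmodType S.
Variables (n : nat) (M : add_subcat S).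
Hypothesis ctM : is_cluster_tilting n.+1 M.

Let noeth := @artin_noeth R Lam artR fgLam.
Let J_inj m : inj_mod (J m).
Proof. by move=> V W i f; apply: J_injective. Qed.

Lemma M_left X : fin_gen X ->
  (forall C i, M C -> (0 < i < n.+1)%N -> ext_vanishes i X C) -> M X.
Proof. by move=> fgX extX; apply/(ct_ext_left ctM fgX). Qed.

(** Vanishing of Ext^i(X, M) for 0 < i < n+1 dualises by [dual_exact] to exactness of Hom(M, nu P)
    in the inner degrees. This makes nu P an injective coresolution of T and gives Ext^i(M, T) =
    0. *)
Lemma ar_forward X : M X -> exists T, M T /\ inhabited (ar_data E n M X T).
Proof.
move=> MX; have [r [A [e resA]]] := free_resolution noeth (fin_gen_M ctM MX).
pose T := sub_of (lker_sub (Jmap (A n))).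
have fgT : fin_gen T by apply: fin_gen_submod => //; apply: fin_gen_J.
have coex V b : M V -> (b < n)%N -> hom_coexact (I := fun b => J (r b) : lmodType S) (fun b => Jmap (A b)) V b.
  move=> MV lt_bn f fA; apply: (dual_exact dualE (B := A b)) fA => u uA.
  have [||w wP] := ext_M ctM MX MV _ resA (i := b.+1) (f := u) => //.
  by exists w => x; rewrite wP.
have exJ b y : (b < n)%N -> Jmap (A b) y = 0 <-> exists x, Jmap (A b.+1) x = y.
  move=> lt_bn; split=> [yA|[x <-]].
    have [z|g gP] := coex 'rV[S]_1 b (free_M ctM 1) lt_bn (elem y).
      by rewrite elem_comp yA /= scaler0.
    by exists (g 1%:M); rewrite -gP elem1.
  apply: J_ext => z; rewrite !Jmap_ev mulmxA (_ : A b.+1 *m A b = 0).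
    by rewrite mul0mx /J_ev linear0.
  apply/row_matrixP => i; rewrite row_mul rowE row0.
  exact: (res_dd resA (i := b) (delta_mx 0 i)).
have iotaP y : Jmap (A n) y = 0 <-> exists x : T, sub_incl x = y.
  split=> [yA|[x <-]]; last exact: sub_valP x.
  exact: sub_inclE.
exists T; split.
  apply: (M_right ctM fgT) => C [//|i] MC lt_in.
  apply: (@ext_of_coexact _ n (fun b => J (r b) : lmodType S) (fun b => Jmap (A b)) T sub_incl) => //.
  - exact: sub_incl_inj.
  - by move=> b lt_bn; apply: coex.
constructor; apply: (ar_data_of_coresolution artR fgLam dualE ctM resA (iota := sub_incl)) => //.
exact: sub_incl_inj.
Qed.

(** Start with an embedding of T into some [J m] and the matrix of its cokernel, continued by free
    syzygies on the resolution side. Each further cokernel prepends one matrix and shifts the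
    indices, so k counts the coresolution steps made. *)
Lemma ar_coresolution T k : M T -> exists (r : nat -> nat) (A : forall i, 'M[S]_(r i.+1, r i))
    (iota : {linear T -> J (r k.+1)}),
  [/\ injective iota, forall y, Jmap (A k) y = 0 <-> exists x, iota x = y,
      forall b y, (b < k)%N -> Jmap (A b) y = 0 <-> exists x, Jmap (A b.+1) x = y &
      forall i (x : 'rV_(r i.+1)), (k <= i)%N -> x *m A i = 0 <-> exists y, x = y *m A i.+1].
Proof.
move=> MT; elim: k => [|k [r [A [iota [iota_inj iotaP JA AA]]]]].
  have [m [iota iota0]] := cogenerated artR fgLam dualE (lker_sub (idfun : {linear T -> T})) (fin_gen_M ctM MT).
  have iota_inj : injective iota.
    move=> x y /eqP; rewrite -subr_eq0 -linearB => /eqP/iota0/eqP.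
    by rewrite subr_eq0 => /eqP.
  have [p [B BP]] := J_cokernel artR fgLam dualE iota.
  have [r [A0 [A [BA A0A AA]]]] := free_syzygies noeth (rmul B).
  exists (cons_size p (cons_size m r)), (cons_mx (r := cons_size m r) B (cons_mx A0 A)), iota.
  split=> // -[|[|i]] x _; [exact: BA | exact: A0A | exact: AA].
have [p [B BP]] := J_cokernel artR fgLam dualE (Jmap (A 0)).
exists (cons_size p r), (cons_mx B A), iota; split=> // [[|b] y lt_bk|[//|i] x].
- exact: BP.
- exact: JA.
- exact: AA.
Qed.

(** The matrices of a coresolution of T by modules [J m] also define a complex of free modules. Ext
    vanishing into T makes Hom(M, -) exact on the coresolution, and [dual_exact_inv] turns this into
    exactness of Hom(-, M) on the free side. So the free complex resolves the cokernel X of its last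
    map, and Ext(X, M) vanishes in the required degrees. *)
Lemma ar_backward T : M T -> exists X, M X /\ inhabited (ar_data E n M X T).
Proof.
move=> MT; have [r [A [iota [iota_inj iotaP JA AA]]]] := ar_coresolution n MT.
have coex V b : M V -> (b < n)%N -> hom_coexact (I := fun b => J (r b) : lmodType S) (fun b => Jmap (A b)) V b.
  move=> MV lt_bn.
  apply: (@coexact_of_ext _ noeth n (fun b => J (r b) : lmodType S) (fun b => Jmap (A b)) T iota) => //.
  - exact: fin_gen_M ctM _ MV.
  - by move=> i lt_in; apply: (ext_M ctM).
have exP V b : M V -> (b < n)%N -> forall u : {linear 'rV[S]_(r b.+1) -> V},
    (forall x, u (x *m A b.+1) = 0) ->
    exists w : {linear 'rV[S]_(r b) -> V}, forall x, u x = w (x *m A b).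
  by move=> MV lt_bn; apply: (dual_exact_inv artR dualE (B := A b)); apply: coex.
have AAb i (x : 'rV_(r i.+1)) : x *m A i = 0 <-> exists y, x = y *m A i.+1.
  have [lt_in|/AA//] := ltnP i n; split=> [xA|[y ->]].
    have [m [f fP]] := cogenerated artR fgLam dualE (limage (rmul (A i.+1))) (fin_gen_free _ (r i.+1)).
    have [y|w wP] := exP _ i (M_J artR fgLam dualE ctM m) lt_in f.
      by apply/fP; exists y.
    by have /fP[y yx] : f x = 0 by [rewrite wP xA linear0]; exists y; rewrite -yx.
  rewrite -mulmxA (_ : A i.+1 *m A i = 0) ?mulmx0 //.
  suff AA0 (z : 'cV[S]_(r i)) : A i.+1 *m A i *m z = 0.
    by apply/matrixP => j k; have := AA0 (delta_mx k 0); rewrite -colE => /colP/(_ j); rewrite !mxE.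
  apply: contrapT => Az; have [phi] := cogenerator artR dualE (V := res 'cV[S]_(r i.+2)) Az; apply.
  have : Jmap (A i) (Jmap (A i.+1) phi) = 0 by apply/JA => //; exists phi.
  move=> /(congr1 (fun psi => J_ev psi z)); rewrite !Jmap_ev mulmxA; apply.
(* The cokernel of [A 0] is realised as the image of a map with that kernel. *)
have [m [f fP]] := cogenerated artR fgLam dualE (limage (rmul (A 0))) (fin_gen_free _ (r 0)).
have [e eP] := @factor_sub _ _ (limage f) _ f (fun x => ex_intro _ x erefl).
pose X := sub_of (limage f).
have e_onto x : exists y, e y = x.
  by have [y yx] := sub_valP x; exists y; apply: sub_val_inj; rewrite -eP.
have resA : proj_resolution (free_d A) e.
  apply: free_resP => // y; split=> [ey|[q ->]].
    by have /fP[q qy] : f y = 0 by [rewrite eP ey linear0]; exists q; rewrite -qy.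
  by apply: sub_val_inj; rewrite -eP linear0; apply/fP; exists q.
have fgX : fin_gen X by apply: (fin_gen_image (f := e)) => //; apply: fin_gen_free.
exists X; split.
  apply: M_left => // C [//|i] MC lt_in.
  by apply: (ext_vanishes_res resA) => u uA; apply: exP.
constructor; exact: (ar_data_of_coresolution artR fgLam dualE ctM resA iota_inj).
Qed.
End ARExistence.

Section LinearComposition.
Variable S : nzRingType.
Implicit Types U V W X : lmodType S.
Local Notation "f \; g" := (g \o f : {linear _ -> _}) (at level 60, right associativity, only parsing).

Lemma comp_linA U V W X (f : {linear W -> X}) (g : {linear V -> W}) (h : {linear U -> V}) :
  (f \o g) \o h = f \o (g \o h) :> {linear _ -> _}.
Proof. exact: linear_ext. Qed.

Lemma comp_linDl U V W (f g : {linear V -> W}) (h : {linear U -> V}) :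
  (f + g) \o h = (h \; f) + (h \; g) :> {linear _ -> _}.
Proof. exact: linear_ext. Qed.

Lemma comp_linBl U V W (f g : {linear V -> W}) (h : {linear U -> V}) :
  (f - g) \o h = (h \; f) - (h \; g) :> {linear _ -> _}.
Proof. exact: linear_ext. Qed.

Lemma comp_linDr U V W (h : {linear V -> W}) (f g : {linear U -> V}) :
  h \o (f + g) = (f \; h) + (g \; h) :> {linear _ -> _}.
Proof. by apply: linear_ext => x; rewrite /= linearD. Qed.
End LinearComposition.

Section Factoring.
Variables (S : nzRingType) (I : add_subcat S).
Implicit Types P V W X : lmodType S.

Definition factors V W (f : {linear V -> W}) : Prop :=
  exists P (a : {linear V -> P}) (b : {linear P -> W}), I P /\ forall x, f x = b (a x).

Lemma factors0 V W (f : {linear V -> W}) : (forall x, f x = 0) -> factors f.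
Proof.
move=> f0; exists (zero_mod S), \0, \0; split=> [|x]; last by rewrite f0.
by apply: subcat_zero => x; apply: thinmx0.
Qed.

Lemma factorsD V W (f g : {linear V -> W}) : factors f -> factors g -> factors (f + g).
Proof.
move=> [P [a [b [IP fE]]]] [Q [c [d [IQ gE]]]].
exists (P * Q)%type, (pair_map a c), (copair_map b d).
by split=> [|x]; [apply: subcat_prod | rewrite hom_addE fE gE].
Qed.

Lemma factors_ext V W (f g : {linear V -> W}) : f =1 g -> factors f -> factors g.
Proof. by move=> /linear_ext->. Qed.

Lemma factors_postcomp V W X (f : {linear V -> W}) (g : {linear W -> X}) :
  factors f -> factors (g \o f).
Proof. by move=> [P [a [b [IP fE]]]]; exists P, a, (g \o b); split=> // x; rewrite /= fE. Qed.

End Factoring.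

Lemma r_scaleE (R : comNzRingType) (Lam : algType R) (V W : lmodType Lam^c)
    (f : {linear V -> W}) (r : R) v : f (@r_scale R Lam V r v) = @r_scale R Lam W r (f v).
Proof. exact: linearZ. Qed.

Section FactoringScalars.
Variables (R : comNzRingType) (Lam : algType R) (I : add_subcat Lam^c) (V W : lmodType Lam^c).

Fact factors_zero : factors I (0 : {linear V -> W}).
Proof. exact: factors0. Qed.

Fact factorsZ (r : R) (h : {linear V -> W}) : factors I h -> factors I (r *: h).
Proof. by move=> /(factors_postcomp (@r_scale R Lam W r)); apply: factors_ext. Qed.

Definition factors_sub : submodule {linear V -> W} :=
  Submodule factors_zero (@factorsD _ I V W) factorsZ.
End FactoringScalars.

(** * Quotient categories and the translate *)

Lemma cancel_left (C : category) (X Y Z : C) (a : hom Y Z) (b : hom Z Y) (f : hom X Y) :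
  hom_eq (cat_comp b a) (id_hom Y) -> hom_eq (cat_comp b (cat_comp a f)) f.
Proof.
move=> ba; apply: hom_eq_trans (comp_assoc _ _ _) _.
exact: hom_eq_trans (comp_eq ba (hom_eq_refl f)) (comp_id_left f).
Qed.

Lemma cancel_right (C : category) (X Y Z : C) (a : hom X Y) (b : hom Y X) (f : hom X Z) :
  hom_eq (cat_comp b a) (id_hom X) -> hom_eq (cat_comp (cat_comp f b) a) f.
Proof.
move=> ba; apply: hom_eq_trans (hom_eq_sym (comp_assoc _ _ _)) _.
exact: hom_eq_trans (comp_eq (hom_eq_refl f) ba) (comp_id_right f).
Qed.

Section Equivalences.
Variables (C D : category) (T : functor C D).

Definition full : Prop :=
  forall X Y (g : hom (T X) (T Y)), exists f : hom X Y, hom_eq (fmap T f) g.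

Definition faithful : Prop :=
  forall X Y (f g : hom X Y), hom_eq (fmap T f) (fmap T g) -> hom_eq f g.

Definition dense : Prop :=
  forall Y, exists X (a : hom (T X) Y) (b : hom Y (T X)),
    hom_eq (cat_comp b a) (id_hom (T X)) /\ hom_eq (cat_comp a b) (id_hom Y).

Lemma quasi_inverse_ex : full -> faithful -> dense -> exists T', is_quasi_inverse T T'.
Proof.
move=> fullT faithT denseT.
have [G] : inhabited (forall Y, {X : C & {ab : hom (T X) Y * hom Y (T X) |
    hom_eq (cat_comp ab.2 ab.1) (id_hom (T X)) /\ hom_eq (cat_comp ab.1 ab.2) (id_hom Y)}}).
  constructor=> Y; have [X XP] := cid (denseT Y); exists X.
  have [a aP] := cid XP; have [b bP] := cid aP.
  by exists (a, b).
pose a Y := (sval (projT2 (G Y))).1; pose b Y := (sval (projT2 (G Y))).2.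
have ba Y : hom_eq (cat_comp (b Y) (a Y)) (id_hom _) by case: (svalP (projT2 (G Y))).
have ab Y : hom_eq (cat_comp (a Y) (b Y)) (id_hom _) by case: (svalP (projT2 (G Y))).
pose H Y Y' (g : hom Y Y') := cid (fullT _ _ (cat_comp (b Y') (cat_comp g (a Y)))).
have HP Y Y' (g : hom Y Y') : hom_eq (fmap T (sval (H _ _ g))) (cat_comp (b Y') (cat_comp g (a Y))).
  exact: svalP (H _ _ g).
have Geq Y Y' (g g' : hom Y Y') : hom_eq g g' -> hom_eq (sval (H _ _ g)) (sval (H _ _ g')).
  move=> gg'; apply: faithT; apply: hom_eq_trans (HP _ _ _) _.
  apply: hom_eq_trans (hom_eq_sym (HP _ _ _)); apply: comp_eq; first exact: hom_eq_refl.
  by apply: comp_eq => //; apply: hom_eq_refl.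
have Gid Y : hom_eq (sval (H _ _ (id_hom Y))) (id_hom (projT1 (G Y))).
  apply: faithT; apply: hom_eq_trans (HP _ _ _) _.
  apply: hom_eq_trans (hom_eq_sym (fmap_id T _)).
  by apply: hom_eq_trans (ba Y); apply: comp_eq (hom_eq_refl _) (comp_id_left _).
have Gcomp Y1 Y2 Y3 (g : hom Y2 Y3) (h : hom Y1 Y2) :
    hom_eq (sval (H _ _ (cat_comp g h))) (cat_comp (sval (H _ _ g)) (sval (H _ _ h))).
  apply: faithT; apply: hom_eq_trans (HP _ _ _) _.
  apply: hom_eq_trans _ (hom_eq_sym (fmap_comp T _ _)).
  apply: hom_eq_trans _ (comp_eq (hom_eq_sym (HP _ _ _)) (hom_eq_sym (HP _ _ _))).
  apply: hom_eq_trans _ (comp_assoc _ _ _); apply: comp_eq; first exact: hom_eq_refl.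
  apply: hom_eq_trans (hom_eq_sym (comp_assoc _ _ _)) _.
  apply: hom_eq_trans _ (comp_assoc _ _ _); apply: comp_eq; first exact: hom_eq_refl.
  apply: hom_eq_sym; exact: cancel_left (ab Y2).
exists (@Functor D C (fun Y => projT1 (G Y)) (fun Y Y' g => sval (H Y Y' g)) Geq Gid Gcomp).
split; last first.
  exists a, b; split=> //= Y Y' g.
  apply: hom_eq_trans (comp_eq (hom_eq_refl _) (HP _ _ _)) _.
  exact: cancel_left (ab Y').
have K X := cid (fullT _ _ (a (T X))); have L X := cid (fullT _ _ (b (T X))).
exists (fun X => sval (K X)), (fun X => sval (L X)); split=> [X Y f|X|X] /=; apply: faithT.
- apply: hom_eq_trans (fmap_comp T _ _) _.
  apply: hom_eq_trans _ (hom_eq_sym (fmap_comp T _ _)).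
  apply: hom_eq_trans (comp_eq (svalP (K Y)) (HP _ _ _)) _.
  apply: hom_eq_trans _ (comp_eq (hom_eq_refl _) (hom_eq_sym (svalP (K X)))).
  exact: cancel_left (ab (T Y)).
- apply: hom_eq_trans (fmap_comp T _ _) _.
  apply: hom_eq_trans _ (hom_eq_sym (fmap_id T _)).
  exact: hom_eq_trans (comp_eq (svalP (L X)) (svalP (K X))) (ba (T X)).
- apply: hom_eq_trans (fmap_comp T _ _) _.
  apply: hom_eq_trans _ (hom_eq_sym (fmap_id T _)).
  exact: hom_eq_trans (comp_eq (svalP (K X)) (svalP (L X))) (ab (T X)).
Qed.
End Equivalences.

Section QuotientHoms.
Variables (S : nzRingType) (M I : add_subcat S).
Implicit Types X Y Z : sub_ob M.

Lemma quot_eqP X Y (f g : {linear sval X -> sval Y}) : quot_eq I f g <-> factors I (f - g).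
Proof. by split=> -[P [a [b [IP fE]]]]; exists P, a, b. Qed.

Lemma quot_eqD X Y (f f' g g' : {linear sval X -> sval Y}) :
  quot_eq I f f' -> quot_eq I g g' -> quot_eq I (f \+ g : {linear _ -> _}) (f' \+ g' : {linear _ -> _}).
Proof.
move=> /quot_eqP ff' /quot_eqP gg'; apply/quot_eqP.
apply: factors_ext (factorsD ff' gg') => x.
by rewrite -[LHS]/(f x - f' x + (g x - g' x)) -[RHS]/(f x + g x - (f' x + g' x)) opprD addrACA.
Qed.

Lemma quot_eq_comp X Y Z (h : {linear sval Y -> sval Z}) (f g : {linear sval X -> sval Y}) :
  quot_eq I f g -> @quot_eq _ M I X Z (h \o f : {linear _ -> _}) (h \o g : {linear _ -> _}).
Proof.
move=> /quot_eqP /(factors_postcomp h) fg; apply/quot_eqP.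
by apply: factors_ext fg => x; rewrite -[RHS]/(h (f x) - h (g x)) -linearB.
Qed.
End QuotientHoms.

Lemma dual_ext (R : comNzRingType) (Lam : algType R) (E : lmodType R) (M I : add_subcat Lam^c)
    (X Y : quot_cat M I) (phi : dual_hom E X Y) (f g : {linear sval X -> sval Y}) :
  f =1 g -> phi f = phi g.
Proof. by move=> fg; apply: dual_eq; apply: eq_quot_eq. Qed.

(** * Moving a duality along an equivalence *)

Section DualIsoTransport.
Variables (R : comNzRingType) (Lam : algType R) (E : lmodType R).
Local Notation S := (Lam^c).
Variables (n : nat) (M : add_subcat S) (F : additive_subfunctor n M).
Variables (T : functor (under_cat F) (over_cat F)) (T' : functor (over_cat F) (under_cat F)).
Hypothesis addT : forall (X Y : under_cat F) (f g : {linear sval X -> sval Y}),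
  @hom_eq (over_cat F) (T X) (T Y) (fmap T (f \+ g : {linear _ -> _}))
    ((fmap T f : {linear _ -> _}) \+ (fmap T g : {linear _ -> _}) : {linear _ -> _}).
Hypothesis scaleT : forall (X Y : under_cat F) (r : R) (f : {linear sval X -> sval Y}),
  @hom_eq (over_cat F) (T X) (T Y) (fmap T (@r_scale R Lam (sval Y) r \o f : {linear _ -> _}))
    (@r_scale R Lam (sval (T Y)) r \o (fmap T f : {linear _ -> _}) : {linear _ -> _}).
Hypotheses (fullT : full T) (faithT : faithful T) (quasiT : is_quasi_inverse T T').

(** The functionals are composed with the bijection Hom(T'Y, X) = Hom(Y, TX) given by k |-> T(k) b,
    with b : Y -> TT'Y the inverse of the counit; its inverse comes from fullness and
    faithfulness. *)
Lemma dual_iso_transport :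
  dual_iso E F (quot_functor M (F_inj F)) (comp_functor T (quot_functor M (F_proj F))) ->
  dual_iso E F (comp_functor T' (quot_functor M (F_inj F))) (quot_functor M (F_proj F)).
Proof.
move=> [Phi [inj surj add scale left right]].
have [_ [a [b [anat ba ab]]]] := quasiT.
have bnat (Y Y' : over_cat F) (g : hom Y Y') :
    hom_eq (cat_comp (b Y') g) (cat_comp (fmap T (fmap T' g)) (b Y)).
  apply: hom_eq_trans (hom_eq_sym (cancel_right _ (ab Y))) _.
  apply: comp_eq (hom_eq_refl _); apply: hom_eq_trans (hom_eq_sym (comp_assoc _ _ _)) _.
  apply: hom_eq_trans (comp_eq (hom_eq_refl _) (hom_eq_sym (anat _ _ g))) _.
  exact: cancel_left (ba Y').
pose tr (X Y : sub_ob M) (k : {linear sval (T' Y) -> sval X}) : {linear sval Y -> sval (T X)} :=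
  @cat_comp (over_cat F) _ _ _ (@fmap _ _ T (T' Y) X k) (b Y).
have tr_eq (X Y : sub_ob M) (k k' : {linear sval (T' Y) -> sval X}) :
    quot_eq (F_proj F) k k' -> quot_eq (F_inj F) (tr _ _ k) (tr _ _ k').
  by move=> kk'; apply: (@comp_eq (over_cat F)) (hom_eq_refl _); apply: fmap_eq.
have [D DP] : exists D : forall X Y : sub_ob M, nseq n (sval Y) (sval X) ->
    dual_hom E (T' Y : under_cat F) (X : under_cat F),
    forall X Y xi k, D X Y xi k = Phi X Y xi (tr _ _ k).
  suff D X Y xi : {phi : dual_hom E (T' Y : under_cat F) (X : under_cat F) |
      forall k, phi k = Phi X Y xi (tr _ _ k)}.
    by exists (fun X Y xi => sval (D X Y xi)) => X Y xi; apply: (svalP (D X Y xi)).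
  unshelve eexists; first refine (@DualHom _ _ _ _ _ _ _ (fun k => Phi X Y xi (tr _ _ k)) _ _ _).
  - by move=> k k' kk'; apply: dual_eq; apply: tr_eq.
  - move=> k k'; rewrite -dual_add.
    apply: dual_eq; apply: hom_eq_trans (comp_eq (addT k k') (hom_eq_refl _)) _.
    exact: eq_quot_eq.
  - move=> r k; rewrite -dual_scale.
    apply: dual_eq; apply: hom_eq_trans (comp_eq (scaleT r k) (hom_eq_refl _)) _.
    exact: eq_quot_eq.
  by [].
pose tr' (X Y : sub_ob M) (h : {linear sval Y -> sval (T X)}) :=
  cid (@fullT (T' Y) X (@cat_comp (over_cat F) _ _ _ h (a Y))).
have tr'P (X Y : sub_ob M) (h : {linear sval Y -> sval (T X)}) :
    @hom_eq (over_cat F) _ _ (fmap T (sval (tr' X Y h))) (@cat_comp (over_cat F) _ _ _ h (a Y)).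
  exact: svalP (tr' X Y h).
have trK (X Y : sub_ob M) (h : {linear sval Y -> sval (T X)}) :
    quot_eq (F_inj F) (tr _ _ (sval (tr' X Y h))) h.
  apply: hom_eq_trans (comp_eq (tr'P X Y h) (hom_eq_refl _)) _.
  exact: cancel_right (ab Y).
have tr'K (X Y : sub_ob M) (k : {linear sval (T' Y) -> sval X}) :
    quot_eq (F_proj F) (sval (tr' X Y (tr _ _ k))) k.
  apply: (@faithT (T' Y) X); apply: hom_eq_trans (tr'P _ _ _) _.
  exact: cancel_right (ba Y).
exists D; split.
- move=> X Y xi xi' Fxi Fxi'; rewrite -inj //; split=> [DD h|PP k].
    rewrite -(dual_eq _ (trK X Y h)) -(dual_eq (Phi X Y xi') (trK X Y h)).
    by rewrite -!DP.
  by rewrite !DP.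
- move=> X Y phi.
  suff [psi psiP] : exists psi : dual_hom E (Y : over_cat F) (T X : over_cat F),
      forall h, psi h = phi (sval (tr' X Y h)).
    have [xi Fxi xiP] := surj X Y psi; exists xi => // k.
    by rewrite DP xiP psiP; apply: dual_eq; apply: tr'K.
  unshelve eexists; first refine (@DualHom _ _ _ _ _ _ _ (fun h => phi (sval (tr' X Y h))) _ _ _).
  + move=> h h' hh'; apply: dual_eq; apply: (@faithT (T' Y) X).
    apply: hom_eq_trans (tr'P _ _ _) _; apply: hom_eq_trans _ (hom_eq_sym (tr'P _ _ _)).
    exact: comp_eq hh' (hom_eq_refl _).
  + move=> h h'; rewrite -dual_add; apply: dual_eq; apply: (@faithT (T' Y) X).
    apply: hom_eq_trans (tr'P _ _ _) _; apply: hom_eq_trans _ (hom_eq_sym (addT _ _)).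
    apply: (@hom_eq_trans (over_cat F) _ _ _ _ _ _ (quot_eqD (hom_eq_sym (tr'P X Y h)) (hom_eq_sym (tr'P X Y h')))).
    exact: eq_quot_eq.
  + move=> r h; rewrite -dual_scale; apply: dual_eq; apply: (@faithT (T' Y) X).
    apply: hom_eq_trans (tr'P _ _ _) _; apply: hom_eq_trans _ (hom_eq_sym (scaleT _ _)).
    apply: (@hom_eq_trans (over_cat F) _ _ _ _ _ _ (quot_eq_comp _ (hom_eq_sym (tr'P X Y h)))).
    exact: eq_quot_eq.
  by [].
- by move=> X Y xi1 xi2 xi F1 F2 xiP k; rewrite !DP; apply: add xiP _.
- by move=> X Y r xi xi' Fxi xiP k; rewrite !DP; apply: scale xiP _.
- move=> X X' Y f xi xi' Fxi xiP k; rewrite !DP (left _ _ _ _ _ _ Fxi xiP).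
  apply: dual_eq; apply: hom_eq_trans (comp_assoc _ _ _) _.
  by apply: comp_eq (hom_eq_refl _); apply: hom_eq_sym; apply: fmap_comp.
- move=> X Y Y' g xi xi' Fxi xiP k; rewrite !DP (right _ _ _ _ _ _ Fxi xiP).
  apply: dual_eq; apply: hom_eq_trans (hom_eq_sym (comp_assoc _ _ _)) _.
  apply: hom_eq_trans (comp_eq (hom_eq_refl _) (bnat _ _ g)) _.
  apply: hom_eq_trans (comp_assoc _ _ _) _.
  by apply: comp_eq (hom_eq_refl _); apply: hom_eq_sym; apply: fmap_comp.
Qed.
End DualIsoTransport.

Section DualSeparation.
Variables (R : comNzRingType) (Lam : algType R) (E : lmodType R).
Hypotheses (artR : artinian R) (dualE : is_dualizing E).
Local Notation S := (Lam^c).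
Variables (M I : add_subcat S) (X Y : quot_cat M I).
Implicit Types h k : {linear sval X -> sval Y}.

Lemma dual_of_linear (phi : {linear {linear sval X -> sval Y} -> E}) :
  (forall h, factors I h -> phi h = 0) -> exists psi : dual_hom E X Y, forall h, psi h = phi h.
Proof.
move=> phi0; unshelve eexists; first refine (@DualHom _ _ _ _ _ _ _ phi _ _ _).
- move=> h k /quot_eqP hk; apply/eqP; rewrite -subr_eq0 -linearB; apply/eqP; exact: phi0.
- by move=> h k; rewrite -linearD; congr (phi _); apply: linear_ext.
- by move=> r h; rewrite -linearZ; congr (phi _); apply: linear_ext.
by [].
Qed.

Lemma dual_separates (B : submodule {linear sval X -> sval Y}) k :
  (forall h, factors I h -> B h) -> ~ B k ->
  exists phi : dual_hom E X Y, (forall h, B h -> phi h = 0) /\ phi k <> 0.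
Proof.
move=> IB nBk; have [phi [phiB phik]] := @separation _ _ artR dualE _ B k nBk.
have [h /IB/phiB//|psi psiP] := dual_of_linear (phi := phi).
by exists psi; split=> [h Bh|]; rewrite psiP //; apply: phiB.
Qed.
End DualSeparation.

(** * The relative Auslander-Reiten formula *)

Section RelativeARFormula.
Variables (R : comNzRingType) (Lam : algType R) (E : lmodType R).
Hypotheses (artR : artinian R) (fgLam : fin_gen (S := R) Lam) (dualE : is_dualizing E).
Local Notation S := (Lam^c).
Variables (n : nat) (M : add_subcat S).
Hypothesis ctM : is_cluster_tilting n.+1 M.
Let noeth := @artin_noeth R Lam artR fgLam.
Let cogen := @artin_cogen R Lam E artR fgLam dualE.
Local Notation ar_data := (ar_data E n M).
Variable F : additive_subfunctor n.+1 M.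
Hypotheses (projF : enough_projectives F) (injF : enough_injectives F).

Section Modules.
Implicit Types C I K L N P V W X Y Z T : lmodType S.

Definition cob X T (D : ar_data X T) Y (u : {linear ar_P D n.+1 -> Y}) : Prop :=
  exists g : {linear ar_P D n -> Y}, forall x, u x = g (ar_d D n x).

(* [theta] represents the class in Ext^(n+1)(X, L) of the pullback of [xi] *)
(* along [f]. *)
Definition class X T (D : ar_data X T) L N (xi : nseq n.+1 L N) (f : {linear X -> N})
    (theta : {linear ar_P D n.+1 -> L}) : Prop :=
  lifts (ar_d D) (ar_e D) (xi := xi) f (k := 0) (ns_left xi \o theta).

Section Class.
Variables (X T : lmodType S) (D : ar_data X T).
Hypothesis MX : M X.
Let resX := ar_res D.

Lemma cob_form Y (u : {linear ar_P D n.+1 -> Y}) (h : {linear Y -> T}) :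
  cob u -> ar_form D (h \o u) = 0.
Proof.
move=> [g gP]; rewrite (_ : h \o u = (h \o g) \o ar_d D n :> {linear _ -> _}) ?ar_cob //.
by apply: linear_ext => x /=; rewrite gP.
Qed.

Lemma cob_comp Y Z (u : {linear ar_P D n.+1 -> Y}) (h : {linear Y -> Z}) :
  cob u -> cob (h \o u).
Proof. by move=> [g gP]; exists (h \o g) => x; rewrite /= gP. Qed.

Lemma cob_eq_form Y (u v : {linear ar_P D n.+1 -> Y}) (h : {linear Y -> T}) :
  cob (u - v) -> ar_form D (h \o u) = ar_form D (h \o v).
Proof.
move=> uv; apply/eqP; rewrite -subr_eq0 -linearB; apply/eqP.
rewrite -[RHS](cob_form h uv); congr (ar_form D _).
by apply: linear_ext => x; rewrite /= linearB.
Qed.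

(** Otherwise a functional kills the coboundaries but not [u], and [ar_rep] presents it as the form
    composed with some [h]. *)
Lemma form_separates Y (u : {linear ar_P D n.+1 -> Y}) :
  (forall h : {linear Y -> T}, ar_form D (h \o u) = 0) -> cob u.
Proof.
move=> hu; apply: contrapT => ncob.
have [|b [bU bu]] := @separation _ _ artR dualE _ (limage (precomp Y (ar_d D n))) u.
  by move=> [g gu]; apply: ncob; exists g => x; rewrite -gu.
have [g|h hP] := ar_rep (a := D) (b := b); first by apply: bU; exists g.
by apply: bu; rewrite -hP.
Qed.

(** A map orthogonal to all cocycles factors through an injective by [ar_sep], so [phi] kills it;
    biduality, applied to the finitely generated module of cocycles, then yields [theta]. *)
Lemma form_represents Y (phi : {linear {linear Y -> T} -> E}) : M Y ->
    (forall (I : lmodType S) (i : {linear Y -> I}) (j : {linear I -> T}) (h : {linear Y -> T}),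
       M I -> inj_mod I -> (forall y, h y = j (i y)) -> phi h = 0) ->
  exists theta : {linear ar_P D n.+1 -> Y},
    (forall x, theta (ar_d D n.+1 x) = 0) /\ forall h, phi h = ar_form D (h \o theta).
Proof.
move=> MY phi0; pose Z := lker_sub (precomp Y (ar_d D n.+1)).
pose b (z : sub_of Z) : {linear {linear Y -> T} -> E} := ar_form D \o precomp T (sub_val z).
have [h|||z zP] := @pairing_represent _ _ artR dualE _ _ b _ phi.
- exact: (linearP (ar_form D \o (postcomp _ h \o @sub_val _ _ Z : {linear _ -> _}))).
- apply: fin_gen_submodule; apply: fin_gen_hom => //; last exact: fin_gen_M ctM _ MY.
  exact: res_fin_gen resX _.
- move=> h hz; have [|I [i [j [MI injI hE]]]] := ar_sep (a := D) (h := h).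
    move=> u uP; have uZ : Z u by apply: linear_ext => x; apply: uP.
    exact: (hz (SubOf uZ)).
  exact: phi0 hE.
exists (sub_val z); split=> [x|h]; last exact: zP.
exact: (congr1 (fun k : {linear _ -> _} => k x) (sub_valP z)).
Qed.

Section ClassOne.
Variables (L N : lmodType S) (xi : nseq n.+1 L N).
Implicit Types (f : {linear X -> N}) (u : {linear ar_P D n.+1 -> L}).

Lemma class_ext f f' (u u' : {linear ar_P D n.+1 -> L}) :
  f =1 f' -> u =1 u' -> class xi f u -> class xi f' u'.
Proof. by move=> /linear_ext <- /linear_ext <-. Qed.

Lemma classB f f' (u u' : {linear ar_P D n.+1 -> L}) :
  class xi f u -> class xi f' u' -> class xi (f - f') (u - u').
Proof.
move=> uP u'P; have := liftsB uP u'P; rewrite /class.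
congr (lifts _ _ _ _); apply: linear_ext => x; by rewrite hom_addE /= [RHS]linearB.
Qed.

Lemma cob_of_ns_left (u : {linear ar_P D n.+1 -> L}) :
  cob (ns_left xi \o u) -> cob u.
Proof.
move=> [g gP]; exists (iso_inv (ns_left xi) \o g) => x.
by rewrite /= -gP iso_funK.
Qed.

Hypothesis exxi : is_n_exact n.+1 M xi.

Lemma class_exists f : exists u : {linear ar_P D n.+1 -> L}, class xi f u.
Proof.
have [u uP] := lifts_ex cogen ctM resX exxi f (addn0 n.+1).
exists (iso_inv (ns_left xi) \o u); rewrite /class.
by rewrite (_ : _ \o _ = u :> {linear _ -> _}) //; apply: linear_ext => x; rewrite /= iso_invK.
Qed.

Lemma class_cocycle f u x : class xi f u -> u (ar_d D n.+1 x) = 0.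
Proof.
move=> /(lifts_cocycle ctM resX exxi x) /= ux.
by rewrite -[LHS](iso_funK (ns_left xi)) ux linear0.
Qed.

(** With [class_cob] and [class_of_cob] this is the exact sequence Hom(X, xi_{n+1}) -> Hom(X, N) ->
    Ext(X, L) -> Ext(X, xi_1). *)
Lemma class_factor f (p : {linear X -> xi n.+1}) u :
    (forall x, f x = ns_right xi (cx_d xi n.+1 (p x))) -> class xi f u -> cob u.
Proof.
move=> fp /(lifts_factor cogen ctM resX exxi fp); exact: cob_of_ns_left.
Qed.

Lemma class_uniq f u u' : class xi f u -> class xi f u' -> cob (u - u').
Proof.
move=> uP u'P; apply: (class_factor (p := 0)) (classB uP u'P) => x.
by rewrite hom_subE subrr hom_0E !linear0.
Qed.

Lemma class_cob f u : class xi f u -> cob u ->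
  exists p : {linear X -> xi n.+1}, forall x, f x = ns_right xi (cx_d xi n.+1 (p x)).
Proof.
move=> uP [g gP]; apply: (lifts_coboundary_aux cogen ctM resX MX exxi (addn0 n) uP (g := ns_left xi \o g)).
by move=> x; rewrite /= gP.
Qed.

Lemma class_of_cob (u : {linear ar_P D n.+1 -> L}) :
    cob (cx_d xi 0 \o (ns_left xi \o u : {linear _ -> _})) ->
  exists f, class xi f u.
Proof.
move=> [g gP]; exact: (lifts_of_coboundary_aux cogen ctM resX MX exxi (addn0 n) gP).
Qed.

Lemma class_add_cob f u u' : class xi f u -> cob (u' - u) -> class xi f u'.
Proof.
move=> uP [g gP]; have := liftsD uP (lifts_boundary cogen ctM (ar_d D) (ar_e D) exxi (ns_left xi \o g)).
rewrite /class addr0; congr (lifts _ _ _ _); apply: linear_ext => x.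
rewrite hom_addE /= -gP hom_subE linearB; exact: subrKC.
Qed.

Lemma class_d f u : class xi f u -> cob (cx_d xi 0 \o (ns_left xi \o u : {linear _ -> _})).
Proof. by move=> [v [_ vP]]; exists v => x; rewrite -vP. Qed.
End ClassOne.

Lemma class_morph L L' N N' (xi : nseq n.+1 L N) (xi' : nseq n.+1 L' N')
    (l : {linear L -> L'}) (r : {linear N -> N'}) (h : forall i, {linear xi i -> xi' i})
    (f : {linear X -> N}) (u : {linear ar_P D n.+1 -> L}) :
  is_nseq_morph l r h -> class xi f u -> class xi' (r \o f) (l \o u).
Proof.
move=> hmor uP; have := lifts_morph hmor (addn0 n.+1) uP; rewrite /class.
congr (lifts _ _ _ _); apply: linear_ext => x /=.
by have [_ -> _] := hmor.
Qed.
End Class.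

Lemma class_res_lift X T (D : ar_data X T) X' T' (D' : ar_data X' T') L N
    (xi : nseq n.+1 L N) (f : {linear X -> N}) (g : {linear X' -> X}) u a :
  class (D := D) xi f u ->
  res_lift (ar_d D') (ar_e D') (ar_d D) (ar_e D) g (i := n.+1) a ->
  class (D := D') xi (f \o g) (u \o a).
Proof. by move=> uP aP; apply: (lifts_res_lift (addn0 n.+1) uP aP). Qed.

Lemma M_left_end L N (xi : nseq n.+1 L N) : is_n_exact n.+1 M xi -> M L.
Proof. by move=> [Mxi _ _]; apply: subcat_iso (iso_sym (ns_left xi)) (Mxi _ _). Qed.

Lemma M_right_end L N (xi : nseq n.+1 L N) : is_n_exact n.+1 M xi -> M N.
Proof. by move=> [Mxi _ _]; apply: subcat_iso (ns_right xi) (Mxi _ _). Qed.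

(** Once [l] extends to the first middle terms, the resulting morphism to [zeta] factors through a
    pullback of [zeta]. The factor is the identity on X, and such a morphism is a pushout. *)
Lemma n_pushforward L X Y N (xi : nseq n.+1 L X) (zeta : nseq n.+1 Y N)
    (l : {linear L -> Y}) (h1 : {linear xi 1%N -> zeta 1%N}) :
    is_n_exact n.+1 M xi -> is_n_exact n.+1 M zeta ->
    (forall x, h1 (cx_d xi 0 (ns_left xi x)) = cx_d zeta 0 (ns_left zeta (l x))) ->
  exists (eta : nseq n.+1 Y X) (f : {linear X -> N}),
    is_n_pushout M l xi eta /\ is_n_pullback M f zeta eta.
Proof.
move=> exxi exzeta hd; have [f [h hmor]] := nseq_extend cogen ctM exxi exzeta hd.
have [|eta [etaf]] := n_pullback_ex noeth cogen (ltn0Sn n) ctM f _ exzeta.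
  exact: M_right_end exxi.
move=> /(_ _ _ _ _ exxi hmor)[s smor]; exists eta, f; split=> //.
by apply: (n_pushout_of_morph noeth cogen ctM) smor => //; case: etaf.
Qed.

Lemma class_pullback X T (D : ar_data X T) L N (xi : nseq n.+1 L N) (eta : nseq n.+1 L X)
    (f : {linear X -> N}) (u : {linear ar_P D n.+1 -> L}) :
  is_n_pullback M f xi eta -> class eta idfun u -> class xi f u.
Proof. by move=> [_ [g [gmor _]]] /(class_morph gmor); apply: class_ext. Qed.

Lemma class_pushout X T (D : ar_data X T) L L' N (xi : nseq n.+1 L N) (eta : nseq n.+1 L' N)
    (l : {linear L -> L'}) (f : {linear X -> N}) (u : {linear ar_P D n.+1 -> L}) :
  is_n_pushout M l xi eta -> class xi f u -> class eta f (l \o u).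
Proof. by move=> [_ [g [gmor _]]] /(class_morph gmor); apply: class_ext. Qed.

Lemma class_baer X T (D : ar_data X T) L (xi1 xi2 xi : nseq n.+1 L X)
    (u1 u2 : {linear ar_P D n.+1 -> L}) :
    is_n_exact n.+1 M xi1 -> is_n_exact n.+1 M xi2 -> is_baer_sum M xi1 xi2 xi ->
  class xi1 idfun u1 -> class xi2 idfun u2 -> class xi idfun (u1 + u2).
Proof.
move=> ex1 ex2 [eta [etaP etaQ]] u1P u2P.
have exeta : is_n_exact n.+1 M eta by case: etaP.
have exxi : is_n_exact n.+1 M xi by case: etaQ.
have [u uP] := class_exists D exeta idfun.
have uS := class_pullback etaP uP; have uX := class_pushout etaQ uP.
have fstP : is_nseq_morph (xi := nseq_sum xi1 xi2) (xi' := xi1) fst fst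
  (fun i => fst : {linear (xi1 i * xi2 i)%type -> xi1 i}) by [].
have sndP : is_nseq_morph (xi := nseq_sum xi1 xi2) (xi' := xi2) snd snd
  (fun i => snd : {linear (xi1 i * xi2 i)%type -> xi2 i}) by [].
have [|g1 g1P] := class_uniq ex1 (f := idfun) u1P (u' := fst \o u).
  by apply: class_ext (class_morph fstP uS).
have [|g2 g2P] := class_uniq ex2 (f := idfun) u2P (u' := snd \o u).
  by apply: class_ext (class_morph sndP uS).
apply: (class_add_cob exxi uX); exists (g1 + g2) => x.
rewrite !hom_addE -g1P -g2P !hom_subE /= /copair_map /= opprD addrACA.
by congr (_ + _).
Qed.

Lemma yoneda_class X T (D : ar_data X T) L (xi xi' : nseq n.+1 L X) :
  yoneda_eq M xi xi' -> forall u : {linear ar_P D n.+1 -> L},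
  class xi idfun u <-> class xi' idfun u.
Proof.
elim=> [{}xi {}xi' [exxi exxi' [g gmor]] u|//|{}xi {}xi' _ IH u|x y z _ IH1 _ IH2 u].
- have half (v : {linear ar_P D n.+1 -> L}) : class xi idfun v -> class xi' idfun v.
    by move=> vP; apply: class_ext (class_morph gmor vP).
  split=> [|uP]; first exact: half.
  have [v vP] := class_exists D exxi idfun.
  apply: (class_add_cob exxi vP).
  exact: (class_uniq exxi' uP (half _ vP)).
- by split=> /IH.
- by rewrite IH1.
Qed.

Lemma F_injective_of_inj I : M I -> inj_mod I -> F_injective F I.
Proof.
move=> MI injI; split=> // N L xi /F_n_exact exxi; split=> [|f].
  by case: exxi => _ _ /(_ _ MI).
exact: injI (n_exact_inj ctM exxi).
Qed.

Lemma F_injective_extend I N L (xi : nseq n.+1 L N) (f : {linear L -> I}) :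
  F_injective F I -> F_exact F xi ->
  exists g : {linear xi 1%N -> I}, forall x, f x = g (cx_d xi 0 (ns_left xi x)).
Proof.
move=> [_ injI] /injI[_ /(_ (f \o iso_inv (ns_left xi)))[g gP]].
by exists g => x; rewrite -gP /= iso_funK.
Qed.

Lemma F_projective_lift P N L (xi : nseq n.+1 L N) (f : {linear P -> N}) :
  F_projective F P -> F_exact F xi ->
  exists p : {linear P -> xi n.+1}, forall x, f x = ns_right xi (cx_d xi n.+1 (p x)).
Proof.
move=> [_ projP] /projP[_ /(_ (iso_inv (ns_right xi) \o f))[p pP]].
by exists p => x; rewrite -pP /= iso_invK.
Qed.

Lemma class_F_injective X T (D : ar_data X T) I L N (xi : nseq n.+1 L N)
    (i : {linear L -> I}) (f : {linear X -> N}) (u : {linear ar_P D n.+1 -> L}) :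
  F_injective F I -> F_exact F xi -> class xi f u -> cob (i \o u).
Proof.
move=> injI Fxi /class_d/(cob_comp (Z := I)) uP.
have [g gP] := F_injective_extend i injI Fxi.
by have [w wP] := uP g; exists w => x; rewrite -wP /= gP.
Qed.

(** An F-exact embedding of Y into an F-injective extends over [xi]; the pushout is then also a
    pullback of an F-exact sequence, hence F-exact. *)
Lemma F_pushforward L X Y (xi : nseq n.+1 L X) (l : {linear L -> Y}) :
  F_exact F xi -> M Y ->
  exists2 eta : nseq n.+1 Y X, F_exact F eta & is_n_pushout M l xi eta.
Proof.
move=> Fxi MY; have [N [zeta [Fzeta injzeta]]] := injF MY.
have [h hP] := F_injective_extend (cx_d zeta 0 \o (ns_left zeta \o l : {linear _ -> _})) injzeta Fxi.
have [x|eta [f [etaP etaQ]]] := n_pushforward (F_n_exact Fxi) (F_n_exact Fzeta) (l := l) (h1 := h).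
  by rewrite -hP.
by exists eta => //; apply: F_pullback etaQ.
Qed.

Lemma F_baer_ex L X (xi1 xi2 : nseq n.+1 L X) :
  F_exact F xi1 -> F_exact F xi2 ->
  exists2 xi : nseq n.+1 L X, F_exact F xi & is_baer_sum M xi1 xi2 xi.
Proof.
move=> F1 F2; have [ex1 ex2] := (F_n_exact F1, F_n_exact F2).
have ML := M_left_end ex1; have [N [zeta [Fzeta injzeta]]] := injF ML.
have exS := nseq_sum_exact cogen ctM ex1 ex2.
have [eta [etaP _]] := n_pullback_ex noeth cogen (ltn0Sn n) ctM (@diag_map _ X) (M_right_end ex1) exS.
have [exeta [g [[gd gl _] _]]] := etaP.
have [h1 h1P] := F_injective_extend (cx_d zeta 0 \o ns_left zeta) injzeta F1.
have [h2 h2P] := F_injective_extend (cx_d zeta 0 \o ns_left zeta) injzeta F2.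
have [x|xi [f [xiP xiQ]]] := n_pushforward exeta (F_n_exact Fzeta) (l := @codiag_map _ L)
  (h1 := copair_map h1 h2 \o g 1%N).
  by rewrite /= gd // gl /= /copair_map /= -h1P -h2P !linearD.
have xi_baer : is_baer_sum M xi1 xi2 xi by exists eta.
by exists xi => //; apply: F_baer_sum xi_baer.
Qed.

(** Both sequences map to an F-exact [zeta] beginning with an embedding of L into an F-injective.
    Equality of classes means that the right ends f and f' differ by a map lifting to the last
    middle term of [zeta], so a homotopy makes them equal. Both sequences then map to the pullback
    of [zeta] along f, which links them by two Yoneda steps. *)
Lemma class_yoneda X T (D : ar_data X T) L (xi xi' : nseq n.+1 L X)
    (u : {linear ar_P D n.+1 -> L}) :
  F_exact F xi -> F_exact F xi' -> class xi idfun u -> class xi' idfun u ->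
  yoneda_eq M xi xi'.
Proof.
move=> Fxi Fxi' uP u'P; have [exxi exxi'] := (F_n_exact Fxi, F_n_exact Fxi').
have [ML MX] := (M_left_end exxi, M_right_end exxi).
have [N [zeta [Fzeta injzeta]]] := injF ML; have exzeta := F_n_exact Fzeta.
have [h hP] := F_injective_extend (cx_d zeta 0 \o ns_left zeta) injzeta Fxi.
have [h' h'P] := F_injective_extend (cx_d zeta 0 \o ns_left zeta) injzeta Fxi'.
have [f [g gmor]] := nseq_extend cogen ctM (l := idfun) (h1 := h) exxi exzeta (fun x => esym (hP x)).
have [f' [g' g'mor]] := nseq_extend cogen ctM (l := idfun) (h1 := h') exxi' exzeta (fun x => esym (h'P x)).
have [|p pP] := class_cob MX exzeta (classB (class_morph gmor uP) (class_morph g'mor u'P)).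
  by exists 0 => x; rewrite hom_subE subrr.
have [x|k kmor] := nseq_homotopy cogen (ltn0Sn n) ctM (k := p) (f' := f) exxi' exzeta g'mor.
  by rewrite -pP hom_subE addrC subrK.
have [eta [etaP etaU]] := n_pullback_ex noeth cogen (ltn0Sn n) ctM f MX exzeta.
have exeta : is_n_exact n.+1 M eta by case: etaP.
have [s smor] := etaU _ _ _ _ exxi gmor; have [s' s'mor] := etaU _ _ _ _ exxi' kmor.
apply: rst_trans (rst_step _ _ _ _ _) (rst_sym _ _ _ _ (rst_step _ _ _ _ _)); first by split; last by exists s.
by split; last by exists s'.
Qed.

(* A functional on Hom(Y, T) which vanishes on the maps factoring through *)
(* F-injectives comes from a class theta in Ext(X, Y) killed by the *)
(* embedding of Y into an F-injective, hence from a pullback of an F-exact *)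
(* sequence. *)
Lemma F_represents X T (D : ar_data X T) Y (phi : {linear {linear Y -> T} -> E}) :
    M X -> M Y ->
    (forall I (i : {linear Y -> I}) (j : {linear I -> T}) (h : {linear Y -> T}),
       F_injective F I -> (forall y, h y = j (i y)) -> phi h = 0) ->
  exists2 xi : nseq n.+1 Y X, F_exact F xi &
    forall u : {linear ar_P D n.+1 -> Y}, class xi idfun u ->
    forall h, phi h = ar_form D (h \o u).
Proof.
move=> MX MY phi0.
have [I i j h MI injI hE|v [_ vP]] := form_represents D (phi := phi) MY.
  exact: phi0 (F_injective_of_inj MI injI) hE.
have [N [zeta [Fzeta injzeta]]] := injF MY; have exzeta := F_n_exact Fzeta.
have [|f fP] := class_of_cob MX exzeta (u := v).
  apply: (form_separates) => h.
  rewrite -(phi0 _ (cx_d zeta 0 \o ns_left zeta) h (h \o (cx_d zeta 0 \o ns_left zeta)) injzeta) // vP.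
  by congr (ar_form D _); apply: linear_ext.
have [xi [xiP _]] := n_pullback_ex noeth cogen (ltn0Sn n) ctM f MX exzeta.
exists xi => [|u uP h]; first exact: F_pullback xiP.
rewrite vP; apply: cob_eq_form; apply: (class_uniq exzeta fP).
exact: class_pullback xiP uP.
Qed.

(** * Maps between translates *)

Definition ar_lift X T (D : ar_data X T) X' T' (D' : ar_data X' T') (f : {linear X -> X'})
    (a : {linear ar_P D n.+1 -> ar_P D' n.+1}) : Prop :=
  res_lift (ar_d D) (ar_e D) (ar_d D') (ar_e D') f (i := n.+1) a.

Definition cocycle X T (D : ar_data X T) Y (u : {linear ar_P D n.+1 -> Y}) : Prop :=
  forall x, u (ar_d D n.+1 x) = 0.

(* [g] is the map T -> T' dual to the action of f on Ext^(n+1)(-, T). *)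
Definition is_tau X T (D : ar_data X T) X' T' (D' : ar_data X' T')
    (f : {linear X -> X'}) (g : {linear T -> T'}) : Prop :=
  forall a : {linear ar_P D n.+1 -> ar_P D' n.+1}, ar_lift f a ->
  forall u : {linear ar_P D' n.+1 -> T}, cocycle u ->
  ar_form D' (g \o u) = ar_form D (u \o a).

Section TwoData.
Variables (X T : lmodType S) (D : ar_data X T) (X' T' : lmodType S) (D' : ar_data X' T').
Implicit Types (f : {linear X -> X'}) (g : {linear T -> T'}).
Implicit Types (a : {linear ar_P D n.+1 -> ar_P D' n.+1}).

Lemma ar_lift_ex f : exists a, ar_lift f a.
Proof. exact: res_lift_ex (ar_res D) (ar_res D') f n.+1. Qed.

Lemma cocycle_lift f a Y (u : {linear ar_P D' n.+1 -> Y}) :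
  ar_lift f a -> cocycle u -> cocycle (u \o a).
Proof.
move=> aP ud x; have [y /= ->] := res_lift_boundary (ar_res D) (ar_res D') x aP.
exact: ud.
Qed.

Lemma ar_lift_cob f f' a a' Y (u : {linear ar_P D' n.+1 -> Y}) :
  f =1 f' -> ar_lift f a -> ar_lift f' a' -> cocycle u ->
  cob ((u \o a : {linear _ -> _}) - (u \o a' : {linear _ -> _})).
Proof.
move=> ff' aP a'P ud; have [x|g gP] := res_lift_zero_cocycle (ar_res D) (ar_res D') (res_liftB aP a'P) _ ud.
  by rewrite hom_subE ff' subrr.
by exists g => x; rewrite -gP hom_subE /= linearB.
Qed.

Lemma ar_lift_form f f' a a' (u : {linear ar_P D' n.+1 -> T}) :
  f =1 f' -> ar_lift f a -> ar_lift f' a' -> cocycle u ->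
  ar_form D (u \o a) = ar_form D (u \o a').
Proof.
move=> ff' aP a'P ud; have := cob_eq_form idfun (ar_lift_cob ff' aP a'P ud).
by congr (ar_form D _ = ar_form D _); apply: linear_ext.
Qed.

Lemma is_tauP f f' g a : f =1 f' -> ar_lift f a ->
    (forall u : {linear ar_P D' n.+1 -> T}, cocycle u ->
       ar_form D' (g \o u) = ar_form D (u \o a)) ->
  is_tau D D' f' g.
Proof. by move=> ff' aP gP a' a'P u ud; rewrite gP //; apply: ar_lift_form ff' aP a'P ud. Qed.

(** The functional sending u to the form of u composed with a lift of [f] vanishes on coboundaries,
    so [ar_rep] for D' represents it. *)
Lemma is_tau_ex f : exists g, is_tau D D' f g.
Proof.
have [a aP] := ar_lift_ex f.
have [b|g gP] := @ar_rep _ _ _ _ _ _ _ D' T (ar_form D \o precomp T a).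
  case: (aP) => c [_ cP].
  rewrite -[RHS](ar_cob (a := D) (b \o c)); congr (ar_form D _).
  by apply: linear_ext => x; rewrite /= cP.
by exists g; apply: is_tauP aP _ => // u _; rewrite gP.
Qed.

Lemma is_tau_factors f g g' (J : add_subcat S) :
  (forall I, M I -> inj_mod I -> J I) ->
  is_tau D D' f g -> is_tau D D' f g' -> factors J (g - g').
Proof.
move=> injJ gP g'P; have [a aP] := ar_lift_ex f.
have [u ud|I [i [j [MI injI hE]]]] := @ar_sep _ _ _ _ _ _ _ D' T (g - g').
  by rewrite comp_linBl linearB (gP _ aP) // (g'P _ aP) // subrr.
by exists I, i, j; split=> //; apply: injJ.
Qed.

Lemma is_tauD f f' g g' : is_tau D D' f g -> is_tau D D' f' g' -> is_tau D D' (f + f') (g + g').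
Proof.
move=> gP g'P; have [[a aP] [a' a'P]] := (ar_lift_ex f, ar_lift_ex f').
apply: (is_tauP (a := a + a')) => [//||u ud]; first exact: res_liftD.
by rewrite comp_linDl comp_linDr !linearD (gP _ aP) // (g'P _ a'P).
Qed.

Lemma is_tauZ r f g : is_tau D D' f g -> is_tau D D' (r *: f) (r *: g).
Proof.
move=> gP; have [a aP] := ar_lift_ex f.
have Zlift i (b : {linear ar_P D i -> ar_P D' i}) :
    res_lift (ar_d D) (ar_e D) (ar_d D') (ar_e D') f (i := i) b ->
    res_lift (ar_d D) (ar_e D) (ar_d D') (ar_e D') (r *: f) (i := i) (r *: b).
  elim: i b => [|i IHi] b /= => [bP x|[c [cP bc]]].
    by apply: etrans (r_scaleE (ar_e D') r (b x)) _; rewrite bP.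
  exists (r *: c); split=> [|x]; first exact: IHi.
  by apply: etrans (r_scaleE (ar_d D' i) r (b x)) _; rewrite bc.
apply: (is_tauP (a := r *: a)) => [//||u ud]; first exact: Zlift.
have -> : (r *: g) \o u = r *: (g \o u : {linear _ -> _}) :> {linear _ -> _} by exact: linear_ext.
have -> : u \o (r *: a) = r *: (u \o a : {linear _ -> _}) :> {linear _ -> _}.
  by apply: linear_ext => x; apply: (r_scaleE u r (a x)).
by rewrite !linearZ (gP _ aP).
Qed.

Lemma is_tau_class f g L (xi : nseq n.+1 L X') (h : {linear L -> T})
    (u : {linear ar_P D' n.+1 -> L}) (v : {linear ar_P D n.+1 -> L}) :
  is_n_exact n.+1 M xi -> is_tau D D' f g ->
  class xi idfun u -> class xi f v -> ar_form D' (g \o (h \o u)) = ar_form D (h \o v).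
Proof.
move=> exxi gP uP vP; have [a aP] := ar_lift_ex f.
rewrite (gP _ aP) => [|x]; last by rewrite /= (class_cocycle exxi x uP) linear0.
rewrite comp_linA; apply: cob_eq_form.
apply: (class_uniq exxi (f := f)) vP.
by apply: class_ext (class_res_lift uP aP).
Qed.
End TwoData.

Lemma is_tau_id X T (D : ar_data X T) : is_tau D D idfun idfun.
Proof.
apply: (is_tauP (f := idfun) (a := idfun)) => // [|u ud]; first exact: res_lift_id.
by congr (ar_form D _); apply: linear_ext.
Qed.

Lemma is_tau_comp X1 T1 (D1 : ar_data X1 T1) X2 T2 (D2 : ar_data X2 T2) X3 T3 (D3 : ar_data X3 T3)
    (f : {linear X1 -> X2}) (f' : {linear X2 -> X3}) (g : {linear T1 -> T2}) (g' : {linear T2 -> T3}) :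
  is_tau D1 D2 f g -> is_tau D2 D3 f' g' -> is_tau D1 D3 (f' \o f) (g' \o g).
Proof.
move=> gP g'P; have [[a aP] [a' a'P]] := (ar_lift_ex D1 D2 f, ar_lift_ex D2 D3 f').
apply: (is_tauP (f := f' \o f) (a := a' \o a)) => // [|u ud]; first exact: res_lift_comp aP a'P.
rewrite comp_linA (g'P _ a'P) => [|x]; last by rewrite /= ud linear0.
by rewrite comp_linA (gP _ aP) ?comp_linA //; apply: cocycle_lift a'P ud.
Qed.

(** A map L -> T pairs with Ext(P, L). Since P is F-projective, no nonzero class dies in the first
    middle term of an F-exact sequence, so the pairing extends to that term and is represented by a
    map from it to T, up to maps through injectives. *)
Lemma F_injective_translate P T (D : ar_data P T) : M T -> F_projective F P -> F_injective F T.
Proof.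
move=> MT projP; have MP : M P by case: projP.
split=> // N L xi Fxi; have exxi := F_n_exact Fxi; split=> [|i0].
  by case: exxi => _ _ /(_ _ MT).
pose i : {linear L -> T} := i0 \o ns_left xi.
pose dl : {linear L -> xi 1%N} := cx_d xi 0 \o ns_left xi.
pose PP := ar_P D.
(* A pair (u, w) in the kernel exhibits the image of u in the first middle term as a coboundary.
   Then u is the class of a pullback along some q : P -> N; q lifts by F-projectivity, and u is
   itself a coboundary. *)
pose f : {linear ({linear PP n.+1 -> L} * {linear PP n -> xi 1%N})%type -> {linear PP n.+1 -> xi 1%N}} :=
  copair_map (postcomp (PP n.+1) dl) (precomp (xi 1%N) (ar_d D n)).
have [[u w] /= uw0|b bP] := extend_functional dualE (f := f)
    (b := ar_form D \o (postcomp _ i \o fst : {linear _ -> _})).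
  have [|q qP] := class_of_cob MP exxi (u := u).
    exists (- w) => x; rewrite hom_oppE; apply/eqP; rewrite -addr_eq0; apply/eqP.
    exact: (congr1 (fun k : {linear _ -> _} => k x) uw0).
  have [p pP] := F_projective_lift q projP Fxi.
  exact: cob_form (class_factor exxi pP qP).
have [w|h hP] := @ar_rep _ _ _ _ _ _ _ D (xi 1%N) b.
  have <- : f (0, w) = w \o ar_d D n.
    by apply: linear_ext => x; rewrite -[LHS]/(dl 0 + w (ar_d D n x)) linear0 add0r.
  by rewrite -bP -[LHS]/(ar_form D (postcomp (PP n.+1) i 0)) !linear0.
(* The maps i and h dl pair equally with all u, so their difference factors through an injective,
   which again extends over [xi]. *)
have [u ud|I [j [k [MI injI jk]]]] := @ar_sep _ _ _ _ _ _ _ D L (i - (h \o dl : {linear _ -> _})).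
  rewrite comp_linBl (comp_linA h) linearB hP; apply/eqP; rewrite subr_eq0; apply/eqP.
  apply: etrans (bP (u, 0)) _; congr (b _); apply: linear_ext => x.
  by rewrite -[LHS]/(dl (u x) + 0) addr0.
have [j' j'P] := F_injective_extend j (F_injective_of_inj MI injI) Fxi.
exists (h + (k \o j' : {linear _ -> _})) => x; rewrite hom_addE /=.
have := jk (iso_inv (ns_left xi) x); rewrite j'P hom_subE /= !iso_invK => /eqP.
by rewrite subr_eq addrC => /eqP.
Qed.

Lemma F_inj_M I : M I -> inj_mod I -> F_inj F I.
Proof. by move=> MI injI; have := F_injective_of_inj MI injI. Qed.

(* The dual of the F-classes in Ext(X, Y) is Hom(Y, T) modulo F-injectives. *)
Lemma F_classes_separate X T (D : ar_data X T) Y (k : {linear Y -> T}) : M X -> M Y ->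
    (forall (xi : nseq n.+1 Y X) (u : {linear ar_P D n.+1 -> Y}), F_exact F xi ->
       class xi idfun u -> ar_form D (k \o u) = 0) ->
  factors (F_inj F) k.
Proof.
move=> MX MY k0; apply: contrapT => nk.
have f0 : factors (F_inj F) (0 : {linear Y -> T}) by exact: factors0.
have fZ (r : R) (h : {linear Y -> T}) : factors (F_inj F) h -> factors (F_inj F) (r *: h).
  by move=> /(factors_postcomp (@r_scale R Lam T r)); apply: factors_ext.
pose B := Submodule (V := {linear Y -> T}) f0 (@factorsD _ (F_inj F) Y T) fZ.
have [phi [phiB phik]] := @separation _ _ artR dualE _ (factors_sub (F_inj F) Y T) k nk.
have [I i j h injI hE|xi Fxi xiP] := F_represents D (phi := phi) MX MY.
  by apply: phiB; exists I, i, j.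
have [u uP] := class_exists D (F_n_exact Fxi) idfun.
by apply: phik; rewrite (xiP _ uP) (k0 _ _ Fxi uP).
Qed.

(** Pull back along [f] an F-exact sequence ending in X' with F-projective term next to it. When [g]
    factors through an F-injective, the form kills the pulled-back class against every map to T; so
    the class vanishes and [f] lifts to the F-projective term. *)
Lemma tau_faithful X T (D : ar_data X T) X' T' (D' : ar_data X' T') (f : {linear X -> X'})
    (g : {linear T -> T'}) : M X -> M X' ->
  is_tau D D' f g -> factors (F_inj F) g -> factors (F_proj F) f.
Proof.
move=> MX MX' gP [I [i [j [injI gij]]]].
have [K [xi [Fxi projxi]]] := projF MX'; have exxi := F_n_exact Fxi.
have [v vP] := class_exists D exxi f.
have [u uP] := class_exists D' exxi idfun.
have [|p pP] := class_cob MX exxi vP.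
  apply: (form_separates) => h.
  rewrite -(is_tau_class h exxi gP uP vP).
  have -> : g \o (h \o u) = j \o ((i \o h) \o u) :> {linear _ -> _}.
    by apply: linear_ext => x; rewrite /= gij.
  exact: cob_form (class_F_injective (i \o h) injI Fxi uP).
exists (xi n.+1), p, (ns_right xi \o cx_d xi n.+1); split=> // x; exact: pP.
Qed.

(** If [f] factors through an F-projective P, then modulo injectives [g] factors through the
    translate of P, which is F-injective. *)
Lemma tau_factors X T (D : ar_data X T) X' T' (D' : ar_data X' T') (f : {linear X -> X'})
    (g : {linear T -> T'}) : M X' ->
  is_tau D D' f g -> factors (F_proj F) f -> factors (F_inj F) g.
Proof.
move=> MX' gP [P [a [b [projP fab]]]]; have MP : M P by case: projP.
have [TP [MTP [DP]]] := ar_forward artR fgLam dualE ctM MP.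
have [[g1 g1P] [g2 g2P]] := (is_tau_ex D DP a, is_tau_ex DP D' b).
have gg : factors (F_inj F) (g - (g2 \o g1 : {linear _ -> _})).
  apply: (is_tau_factors F_inj_M gP); move=> c cP; apply: (is_tau_comp g1P g2P).
  by have -> : b \o a = f :> {linear _ -> _} by apply: linear_ext => x; rewrite /= -fab.
have : factors (F_inj F) (g2 \o g1).
  by exists TP, g1, g2; split=> //; apply: F_injective_translate DP MTP projP.
by move=> /(factorsD gg); apply: factors_ext => x; rewrite hom_addE hom_subE subrK.
Qed.

(** Transposing [g] on the universal class of X', that of an F-exact sequence with F-projective
    term, yields a class over X. This class is a pullback of the sequence along the sought map f. *)
Lemma tau_full X T (D : ar_data X T) X' T' (D' : ar_data X' T') (g : {linear T -> T'}) :
    M X -> M X' -> M T ->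
  exists f g0, is_tau D D' f g0 /\ factors (F_inj F) (g - g0).
Proof.
move=> MX MX' MT.
have [K [xi [Fxi projxi]]] := projF MX'; have exxi := F_n_exact Fxi.
have [u uP] := class_exists D' exxi idfun.
(* The functional h |-> form(g h u) kills maps through F-injectives because F-exact classes die in
   F-injectives; hence an F-exact [eta] represents it. *)
have [I i j h injI hE|eta Feta etaP] := F_represents D
  (phi := ar_form D' \o (precomp T' u \o postcomp K g : {linear _ -> _})) MX (M_left_end exxi).
  rewrite /= (_ : _ \o _ = (g \o j) \o (i \o u) :> {linear _ -> _}).
    exact: cob_form (class_F_injective i injI Fxi uP).
  by apply: linear_ext => x; rewrite /= hE.
have [v vP] := class_exists D (F_n_exact Feta) idfun.
have {}etaP (h : {linear K -> T}) : ar_form D' (g \o (h \o u)) = ar_form D (h \o v).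
  by rewrite -(etaP _ vP) /=; congr (ar_form D' _); apply: linear_ext.
(* [v] dies in the first middle term of [xi] because [u] does, so it is the class of [xi] pulled
   back along some f. *)
have [|f fP] := class_of_cob MX exxi (u := v).
  apply: (form_separates) => h.
  pose dl : {linear K -> xi 1%N} := cx_d xi 0 \o ns_left xi.
  have -> : h \o (cx_d xi 0 \o (ns_left xi \o v)) = (h \o dl) \o v :> {linear _ -> _}.
    exact: linear_ext.
  rewrite -etaP -[RHS](cob_form (g \o h) (class_d uP)).
  by congr (ar_form D' _); apply: linear_ext.
have [g0 g0P] := is_tau_ex D D' f; exists f, g0; split=> //.
(* F-projectivity gives a morphism from [xi] to any F-exact [zeta] ending in X', so the class of
   [zeta] is l u, and on such classes g and g0 agree. *)
apply: (F_classes_separate (D := D') MX' MT) => zeta w Fzeta wP; have exzeta := F_n_exact Fzeta.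
have [p pP] := F_projective_lift (ns_right xi \o cx_d xi n.+1) projxi Fzeta.
have [l [s smor]] := nseq_coextend cogen ctM (r := idfun) (p := p) exxi exzeta (fun x => esym (pP x)).
have lu : class zeta idfun (l \o u) by apply: class_ext (class_morph smor uP).
rewrite (cob_eq_form (g - g0) (class_uniq exzeta wP lu)).
by rewrite comp_linBl linearB etaP (is_tau_class l exxi g0P uP fP) subrr.
Qed.
End Modules.

(** * The translate as a functor, its duality and its uniqueness *)

Section TranslateFunctor.
Local Notation ob := (sub_ob M).
Implicit Types X Y : ob.

(* A choice of tau X with the data identifying its duality with Ext(X, -). *)
Variable D : forall X, {T : ob & ar_data (sval X) (sval T)}.
Let tob X := projT1 (D X).
Let tD X := projT2 (D X).

Definition tmap X Y (f : {linear sval X -> sval Y}) : {linear sval (tob X) -> sval (tob Y)} :=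
  sval (cid (is_tau_ex (tD X) (tD Y) f)).

Lemma tmapP X Y (f : {linear sval X -> sval Y}) : is_tau (tD X) (tD Y) f (tmap f).
Proof. exact: svalP (cid (is_tau_ex (tD X) (tD Y) f)). Qed.
Arguments tmapP {X Y} f.

Lemma tmap_uniq X Y (f : {linear sval X -> sval Y}) g :
  is_tau (tD X) (tD Y) f g -> quot_eq (F_inj F) (tmap f) g.
Proof. by move=> gP; apply/quot_eqP; apply: is_tau_factors (F_inj_M) (tmapP f) gP. Qed.

Lemma is_tauB X Y (f f' : {linear sval X -> sval Y}) g g' :
  is_tau (tD X) (tD Y) f g -> is_tau (tD X) (tD Y) f' g' -> is_tau (tD X) (tD Y) (f - f') (g - g').
Proof.
move=> gP /(is_tauZ (r := -1)) g'P; have := is_tauD gP g'P.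
by rewrite !scaleN1r.
Qed.

Lemma tmap_eq X Y (f g : {linear sval X -> sval Y}) :
  quot_eq (F_proj F) f g -> quot_eq (F_inj F) (tmap f) (tmap g).
Proof.
move=> /quot_eqP fg; apply/quot_eqP.
exact: (tau_factors (svalP Y) (is_tauB (tmapP f) (tmapP g))) fg.
Qed.

Definition tau : functor (under_cat F) (over_cat F).
Proof.
refine (@Functor (under_cat F) (over_cat F) tob tmap tmap_eq _ _).
  by move=> X; apply: tmap_uniq; apply: is_tau_id.
by move=> X Y Z f g; apply: tmap_uniq; apply: is_tau_comp (tmapP g) (tmapP f).
Defined.

Lemma tau_full_functor : full tau.
Proof.
move=> X Y g; have [f [g0 [g0P gg0]]] :=
  tau_full (tD X) (tD Y) g (svalP X) (svalP Y) (svalP (tob X)).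
exists f; apply: (quot_eq_trans (tmap_uniq g0P)).
by apply: quot_eq_sym; apply/quot_eqP.
Qed.

Lemma tau_faithful_functor : faithful tau.
Proof.
move=> X Y f g /quot_eqP fg; apply/quot_eqP.
exact: (tau_faithful (svalP X) (svalP Y) (is_tauB (tmapP f) (tmapP g))) fg.
Qed.

Lemma tau_dense : dense tau.
Proof.
move=> T; have [X [MX [DX]]] := ar_backward artR fgLam dualE ctM (svalP T).
pose X' : ob := exist _ X MX; exists X'.
have [a aP] := is_tau_ex (tD X') DX idfun.
have [b bP] := is_tau_ex DX (tD X') idfun.
have idT (Z W : lmodType S) (DZ : ar_data Z W) (g : {linear W -> W}) :
    is_tau DZ DZ (idfun \o idfun : {linear _ -> _}) g -> factors (F_inj F) (g - (idfun : {linear W -> W})).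
  have -> : idfun \o idfun = idfun :> {linear Z -> Z} by exact: linear_ext.
  by move=> gP; apply: is_tau_factors (F_inj_M) gP (is_tau_id (D := DZ)).
exists a, b; split; apply/quot_eqP; apply: idT.
  exact: is_tau_comp aP bP.
exact: is_tau_comp bP aP.
Qed.

Lemma tau_add X Y (f g : {linear sval X -> sval Y}) :
  quot_eq (F_inj F) (tmap (f \+ g : {linear _ -> _})) (tmap f \+ tmap g : {linear _ -> _}).
Proof. by apply: tmap_uniq; have := is_tauD (tmapP f) (tmapP g). Qed.

Lemma tau_scale X Y (r : R) (f : {linear sval X -> sval Y}) :
  quot_eq (F_inj F) (tmap (@r_scale R Lam (sval Y) r \o f : {linear _ -> _}))
    (@r_scale R Lam (sval (tob Y)) r \o tmap f : {linear _ -> _}).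
Proof. by apply: tmap_uniq; have := is_tauZ (r := r) (tmapP f). Qed.

(** Zero is the default value on sequences that are not F-exact; the cocycle is a chosen one, and
    [pairingE] shows that the choice does not matter. *)
Definition pairing X Y (xi : nseq n.+1 (sval Y) (sval X)) : {linear {linear sval Y -> sval (tob X)} -> E} :=
  if pselect (F_exact F xi) is left Fxi then
    ar_form (tD X) \o precomp _ (sval (cid (class_exists (tD X) (F_n_exact Fxi) idfun)))
  else \0.

Lemma pairingE X Y (xi : nseq n.+1 (sval Y) (sval X)) (u : {linear ar_P (tD X) n.+1 -> sval Y})
    (h : {linear sval Y -> sval (tob X)}) :
  F_exact F xi -> class xi idfun u -> pairing xi h = ar_form (tD X) (h \o u).
Proof.
move=> Fxi uP; rewrite /pairing; case: pselect => // Fxi'.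
case: cid => v /= vP; apply: cob_eq_form.
by have := class_uniq (F_n_exact Fxi) vP uP.
Qed.

Lemma pairing_eq X Y (xi : nseq n.+1 (sval Y) (sval X)) (h h' : {linear sval Y -> sval (tob X)}) :
  quot_eq (F_inj F) h h' -> pairing xi h = pairing xi h'.
Proof.
move=> /quot_eqP[I [i [j [injI hij]]]]; apply/eqP; rewrite -subr_eq0 -linearB; apply/eqP.
have [Fxi|nFxi] := pselect (F_exact F xi); last by rewrite /pairing; case: pselect.
have [u uP] := class_exists (tD X) (F_n_exact Fxi) idfun.
rewrite (pairingE _ Fxi uP) (_ : _ \o _ = j \o (i \o u) :> {linear _ -> _}).
  exact: cob_form (class_F_injective i injI Fxi uP).
by apply: linear_ext => x; rewrite /= -hij.
Qed.

Definition pairing_dual (X Y : sub_cat M) (xi : nseq n.+1 (sval Y) (sval X)) :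
  dual_hom E (quot_functor M (F_inj F) Y) (comp_functor tau (quot_functor M (F_proj F)) X).
Proof.
refine (@DualHom _ _ _ _ _ _ _ (pairing (X := X) (Y := Y) xi) (@pairing_eq X Y xi) _ _).
  by move=> f g; rewrite -linearD; congr (pairing xi _); apply: linear_ext.
by move=> r f; rewrite -linearZ; congr (pairing xi _); apply: linear_ext.
Defined.

Lemma tau_dual_iso : @is_dual_iso _ _ _ _ _ F _ (quot_functor M (F_inj F))
  (comp_functor tau (quot_functor M (F_proj F))) pairing_dual.
Proof.
have cls X Y (xi : nseq n.+1 (sval Y) (sval X)) (Fxi : F_exact F xi) :=
  class_exists (tD X) (F_n_exact Fxi) idfun.
split=> [X Y xi xi' Fxi Fxi'|X Y phi|X Y xi1 xi2 xi F1 F2 xiP h|X Y r xi xi' Fxi xiP h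
  |X X' Y f xi xi' Fxi xiP h|X Y Y' g xi xi' Fxi xiP h].
- have [[u uP] [v vP]] := (cls _ _ _ Fxi, cls _ _ _ Fxi').
  split=> [PP|xixi' h].
    apply: (class_yoneda Fxi Fxi' uP).
    apply: (class_add_cob (F_n_exact Fxi') vP).
    apply: (form_separates) => h.
    have -> : h \o (u - v) = (h \o u : {linear _ -> _}) - (h \o v : {linear _ -> _}) :> {linear _ -> _}.
      by apply: linear_ext => x; rewrite /= linearB.
    by rewrite linearB -(pairingE h Fxi uP) -(pairingE h Fxi' vP) [X in X - _](PP h) subrr.
  rewrite /= (pairingE h Fxi uP) (pairingE h Fxi' (u := u)) //.
  exact: (iffLR (yoneda_class (D := tD X) xixi' u) uP).
- have lin_phi : linear (phi : {linear sval Y -> sval (tob X)} -> E).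
    by move=> r f g; rewrite -dual_scale -dual_add; apply: dual_ext.
  have [I i j h injI hij|xi Fxi xiP] := F_represents (tD X)
    (phi := mk_linear lin_phi) (svalP X) (svalP Y).
    rewrite mk_linearE -(linear0 (mk_linear lin_phi)) mk_linearE; apply: dual_eq.
    by apply/quot_eqP; exists I, i, j; split=> // y; rewrite hom_subE hom_0E subr0.
  have [u uP] := cls _ _ _ Fxi.
  by exists xi => // h; rewrite /= (pairingE _ Fxi uP) -(xiP _ uP).
- have [[u1 u1P] [u2 u2P]] := (cls _ _ _ F1, cls _ _ _ F2).
  have uP := class_baer (F_n_exact F1) (F_n_exact F2) xiP u1P u2P.
  rewrite /= (pairingE _ F1 u1P) (pairingE _ F2 u2P) (pairingE _ (F_baer_sum F1 F2 xiP) uP).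
  by rewrite comp_linDr linearD.
- have [u uP] := cls _ _ _ Fxi; have vP := class_pushout xiP uP.
  rewrite /= (pairingE _ Fxi uP) (pairingE _ (F_pushout Fxi xiP) vP) -linearZ.
  by congr (ar_form _ _); apply: linear_ext => x; apply: (r_scaleE h r (u x)).
- have [u uP] := cls _ _ _ Fxi; have [v vP] := cls _ _ _ (F_pullback Fxi xiP).
  rewrite /= (pairingE _ Fxi uP) (pairingE _ (F_pullback Fxi xiP) vP).
  rewrite -(is_tau_class h (F_n_exact Fxi) (tmapP f) uP (class_pullback xiP vP)).
  by congr (ar_form _ _); apply: linear_ext.
- have [u uP] := cls _ _ _ Fxi; have vP := class_pushout xiP uP.
  rewrite /= (pairingE _ Fxi uP) (pairingE _ (F_pushout Fxi xiP) vP).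
  by congr (ar_form _ _); apply: linear_ext.
Qed.

(** The cocycles of F-exact sequences form a submodule Z of Hom(P_{n+1}, Y), on which [lam] is a
    well-defined linear functional. Extended to the whole Hom-module by injectivity of E, it is
    represented through [ar_rep]. *)
Lemma pairing_represents X Y (lam : nseq n.+1 (sval Y) (sval X) -> E) :
    (forall xi xi', F_exact F xi -> F_exact F xi' -> yoneda_eq M xi xi' -> lam xi = lam xi') ->
    (forall xi1 xi2 xi, F_exact F xi1 -> F_exact F xi2 -> is_baer_sum M xi1 xi2 xi ->
       lam xi = lam xi1 + lam xi2) ->
    (forall r xi xi', F_exact F xi -> is_n_pushout M (@r_scale R Lam (sval Y) r) xi xi' ->
       lam xi' = r *: lam xi) ->
  exists b : {linear sval Y -> sval (tob X)}, forall xi, F_exact F xi -> lam xi = pairing xi b.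
Proof.
move=> lam_eq lam_add lam_scale; pose P := ar_P (tD X).
pose cls (u : {linear P n.+1 -> sval Y}) (xi : nseq n.+1 (sval Y) (sval X)) :=
  F_exact F xi /\ class xi idfun u.
have clsE u xi xi' : cls u xi -> cls u xi' -> lam xi = lam xi'.
  move=> [Fxi uP] [Fxi' uP']; apply: lam_eq => //.
  exact: (class_yoneda Fxi Fxi' uP uP').
have clsD u v xi1 xi2 : cls u xi1 -> cls v xi2 ->
    exists2 xi, cls (u + v) xi & lam xi = lam xi1 + lam xi2.
  move=> [F1 uP] [F2 vP]; have [xi Fxi xiP] := F_baer_ex F1 F2.
  exists xi; last exact: lam_add xiP.
  by split=> //; apply: (class_baer (F_n_exact F1) (F_n_exact F2) xiP uP vP).
have clsZ r u xi : cls u xi -> exists2 xi', cls (r *: u) xi' & lam xi' = r *: lam xi.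
  move=> [Fxi uP].
  have [xi' Fxi' xiP] := F_pushforward (@r_scale R Lam _ r) Fxi (svalP Y).
  exists xi'; last exact: lam_scale xiP.
  by split=> //; apply: class_ext (class_pushout xiP uP).
have Z0 : exists xi, cls 0 xi.
  have [xi Fxi] := F_nonempty F (svalP X) (svalP Y).
  have [u uP] := class_exists (tD X) (F_n_exact Fxi) idfun.
  have [|xi' xiP _] := clsZ 0 u xi; first by split.
  by exists xi'; move: xiP; rewrite scale0r.
have ZD u v : (exists xi, cls u xi) -> (exists xi, cls v xi) -> exists xi, cls (u + v) xi.
  by move=> [xi1 c1] [xi2 c2]; have [xi xiP _] := clsD _ _ _ _ c1 c2; exists xi.
have ZZ (r : R) u : (exists xi, cls u xi) -> exists xi, cls (r *: u) xi.
  by move=> [xi c]; have [xi' xiP _] := clsZ r _ _ c; exists xi'.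
pose Z := Submodule (V := {linear P n.+1 -> sval Y}) Z0 ZD ZZ.
pose l (z : sub_of Z) := lam (sval (cid (sub_valP z))).
have lE (z : sub_of Z) xi : cls (sub_val z) xi -> l z = lam xi.
  exact: clsE (svalP (cid (sub_valP z))).
have lin_l : linear l.
  move=> r z w; have [c1 c2] := (svalP (cid (sub_valP z)), svalP (cid (sub_valP w))).
  have [xi1 c1' e1] := clsZ r _ _ c1; have [xi c e] := clsD _ _ _ _ c1' c2.
  by rewrite (lE _ xi) ?e ?e1.
have [z z0|g gP] := extend_functional dualE (f := @sub_val _ _ Z) (b := mk_linear lin_l).
  have -> : z = 0 by apply: sub_val_inj; rewrite z0 linear0.
  exact: linear0.
have gE u xi : cls u xi -> g u = lam xi.
  move=> c; have Zu : Z u by exists xi.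
  by rewrite -[u]/(sub_val (SubOf Zu)) -gP mk_linearE (lE _ xi).
have g0 : g 0 = 0 by exact: linear0.
have [xi0 [F0 c0]] := Z0.
(* A coboundary is also a cocycle of the sequence [xi0] representing zero, so the functional
   vanishes on it. *)
have [w|b bP] := @ar_rep _ _ _ _ _ _ _ (tD X) (sval Y) g.
  rewrite (gE _ xi0) -?(gE 0 xi0) //; split=> //.
  apply: (class_add_cob (F_n_exact F0) c0).
  by exists w => x; rewrite subr0.
exists b => xi Fxi; have [u uP] := class_exists (tD X) (F_n_exact Fxi) idfun.
by rewrite (pairingE b Fxi uP) bP (gE _ xi).
Qed.

(** Yoneda: b X : U X -> T X represents the functional attached to the identity of U X. Since both
    dualities are perfect, composition with b X is bijective on Hom-groups modulo F-injectives, so b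
    is an isomorphism; naturality is tested on F-classes. *)
Lemma dual_iso_uniq (tau2 : functor (under_cat F) (over_cat F)) :
  dual_iso E F (quot_functor M (F_inj F)) (comp_functor tau2 (quot_functor M (F_proj F))) ->
  nat_iso tau tau2.
Proof.
move=> [Phi' [inj' surj' add' scale' left' right']].
have [inj surj add scale left right] := tau_dual_iso.
pose U X : ob := tau2 X.
have exb X : exists b : {linear sval (U X) -> sval (tob X)},
    forall xi, F_exact F xi -> Phi' X (U X) xi idfun = pairing xi b.
  apply: pairing_represents => [xi xi' Fxi Fxi' /inj'->//|xi1 xi2 xi F1 F2 xiP|r xi xi' Fxi xiP].
    exact: add' xiP _.
  exact: scale' xiP _.
pose b X := sval (cid (exb X)).
have bP X xi : F_exact F xi -> Phi' X (U X) xi idfun = pairing xi (b X).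
  exact: svalP (cid (exb X)) xi.
(* Pushing [xi] forward along [h] moves h into the sequence, for both dualities at once, and leaves
   the identity in its place. *)
have PhiE X Y (xi : nseq n.+1 (sval Y) (sval X)) (h : {linear sval Y -> sval (U X)}) :
    F_exact F xi -> Phi' X Y xi h = pairing xi (b X \o h).
  move=> Fxi; have [eta Feta etaP] := F_pushforward h Fxi (svalP (U X)).
  rewrite -[RHS](right X Y (U X) h _ _ Fxi etaP (b X)) /= -bP //.
  by rewrite (right' X Y (U X) h _ _ Fxi etaP idfun); apply: dual_ext.
have b_inj X Y (h : {linear sval Y -> sval (U X)}) :
    factors (F_inj F) (b X \o h : {linear _ -> _}) -> factors (F_inj F) h.
  move=> bh; apply: contrapT => nh.
  have [//|//|phi [_ phih]] := @dual_separates R Lam E artR dualE M (F_inj F) Y (U X)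
    (factors_sub (F_inj F) (sval Y) (sval (U X))) h.
  have [xi Fxi xiP] := surj' X Y phi.
  apply: phih; rewrite -[phi h]xiP PhiE //.
  rewrite (pairing_eq xi (h' := 0)) ?linear0 //.
  by apply/quot_eqP; rewrite subr0.
(* A map outside the image is separated from it by a functional. The F-exact sequence giving this
   functional is trivial for the second duality, hence Yoneda equivalent to the zero sequence, so
   the functional is zero. *)
have b_surj X Y (k : {linear sval Y -> sval (tob X)}) :
    exists h : {linear sval Y -> sval (U X)}, quot_eq (F_inj F) (b X \o h : {linear _ -> _}) k.
  apply: contrapT => nk.
  pose B (k : {linear sval Y -> sval (tob X)}) :=
    exists h : {linear sval Y -> sval (U X)}, quot_eq (F_inj F) (b X \o h : {linear _ -> _}) k.
  have BI h : factors (F_inj F) h -> B h.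
    move=> Ih; exists 0; apply: quot_eq_sym; apply/quot_eqP; apply: factors_ext Ih => x.
    by rewrite hom_subE /= linear0 subr0.
  have BD h h' : B h -> B h' -> B (h + h').
    move=> [g gP] [g' g'P]; exists (g + g').
    by rewrite comp_linDr; apply: quot_eqD gP g'P.
  have BZ r h : B h -> B (r *: h).
    move=> [g gP]; exists (r *: g).
    apply: quot_eq_trans (quot_eq_comp (@r_scale R Lam (sval (tob X)) r) gP).
    by apply: eq_quot_eq => x; apply: (r_scaleE (b X) r (g x)).
  have B0 : B 0 by apply: BI; apply: factors0.
  have [|//|phi [phiB phik]] := @dual_separates R Lam E artR dualE M (F_inj F) Y (tob X) (Submodule B0 BD BZ) k.
    exact: BI.
  have [|zero zeroP] := @dual_of_linear R Lam E M (F_inj F) Y (tob X) 0; first by [].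
  have [xi Fxi xiP] := surj X Y phi; have [xi0 F0 xi0P] := surj X Y zero.
  have xixi0 : yoneda_eq M xi xi0.
    apply/inj' => // h; rewrite !PhiE // -[LHS]/(pairing_dual xi _) xiP.
    rewrite -[RHS]/(pairing_dual xi0 _) xi0P zeroP; apply: phiB.
    by exists h; apply: eq_quot_eq.
  apply: phik; rewrite -[LHS]xiP (iffRL (inj X Y xi xi0 Fxi F0) xixi0) xi0P; exact: zeroP.
have exc X : exists c : {linear sval (tob X) -> sval (U X)},
    quot_eq (F_inj F) (b X \o c : {linear _ -> _}) idfun by exact: b_surj.
pose c X := sval (cid (exc X)).
have bc X : @hom_eq (over_cat F) _ _ (@cat_comp (over_cat F) (tau X) (tau2 X) (tau X) (b X) (c X)) (id_hom _).
  exact: svalP (cid (exc X)).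
have cb X : @hom_eq (over_cat F) _ _
    (@cat_comp (over_cat F) (tau2 X) (tau X) (tau2 X) (c X) (b X)) (id_hom _).
  apply/quot_eqP; apply: b_inj.
  have /quot_eqP : hom_eq (@cat_comp (over_cat F) _ _ (tau X) (b X)
      (@cat_comp (over_cat F) (tau2 X) (tau X) (tau2 X) (c X) (b X))) (b X).
    apply: hom_eq_trans (comp_assoc _ _ _) _.
    exact: hom_eq_trans (comp_eq (bc X) (hom_eq_refl _)) (comp_id_left _).
  by apply: factors_ext => x; rewrite -[RHS]/(b X (c X (b X x) - x)) linearB.
have b_nat X Y (f : @hom (under_cat F) X Y) :
    @hom_eq (over_cat F) _ _ (@cat_comp (over_cat F) _ (tau2 Y) (tau Y) (b Y) (fmap tau2 f))
      (@cat_comp (over_cat F) (tau2 X) (tau X) (tau Y) (fmap tau f) (b X)).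
  (* Both composites are paired with an F-exact sequence ending in Y; naturality of the two
     dualities under pullback along [f] identifies the values. *)
  apply/quot_eqP; apply: (F_classes_separate (D := tD Y) (svalP Y) (svalP (U X))).
  move=> xi u Fxi uP; rewrite -(pairingE _ Fxi uP) linearB.
  apply/eqP; rewrite subr_eq0; apply/eqP.
  have [eta [etaP _]] := n_pullback_ex noeth cogen (ltn0Sn n) ctM (f : {linear sval X -> sval Y}) (svalP X) (F_n_exact Fxi).
  have Feta := F_pullback Fxi etaP.
  rewrite -[LHS](PhiE Y (U X) xi) // -[RHS](left Y X (U X) f xi eta Fxi etaP (b X)) /= -bP //.
  by rewrite (left' Y X (U X) f xi eta Fxi etaP idfun); apply: dual_ext.
exists c, b; split=> // X Y f.
apply: hom_eq_trans (hom_eq_sym (cancel_right _ (bc X))) _.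
apply: comp_eq (hom_eq_refl _).
apply: hom_eq_trans (hom_eq_sym (comp_assoc _ _ _)) _.
apply: hom_eq_trans (comp_eq (hom_eq_refl _) (hom_eq_sym (b_nat X Y f))) _.
exact: cancel_left (cb Y).
Qed.

End TranslateFunctor.
End RelativeARFormula.

Theorem theorem4p3 (R : comNzRingType) (Lam : algType R) (E : lmodType R)
    (n : nat) (M : add_subcat Lam^c) (F : additive_subfunctor n M) :
  artinian R -> fin_gen (S := R) Lam -> is_dualizing E ->
  (1 <= n)%N -> is_cluster_tilting n M ->
  enough_projectives F -> enough_injectives F ->
  exists tau : functor (under_cat F) (over_cat F),
    is_F_translate E tau /\
    forall tau' : functor (under_cat F) (over_cat F),
      is_F_translate E tau' -> nat_iso tau tau'.
Proof.
(* The index is at least one and is replaced by its successor form, in which the preceding results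
   are stated. *)
move=> artR fgLam dualE; case: n F => // n F _ ctM projF injF.
have [D] : inhabited (forall X : sub_ob M, {T : sub_ob M & ar_data E n M (sval X) (sval T)}).
  constructor=> X; have [T [MT TD]] := cid (ar_forward artR fgLam dualE ctM (svalP X)).
  have [d _] : {d : ar_data E n M (sval X) T | True} by apply: cid; case: TD => d; exists d.
  by exists (exist _ T MT).
pose tau0 := tau artR fgLam dualE ctM F D.
have fullT := tau_full_functor (D := D) projF injF : full tau0.
have faithT := tau_faithful_functor (D := D) projF : faithful tau0.
have [tau' quasiT] := quasi_inverse_ex fullT faithT (tau_dense artR fgLam dualE ctM D).
have dualT : dual_iso E F (quot_functor M (F_inj F)) (comp_functor tau0 (quot_functor M (F_proj F))).
  by exists (pairing_dual artR fgLam dualE ctM F D); apply: tau_dual_iso.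
exists tau0; split.
  exists tau'; split=> //.
  apply: (@dual_iso_transport _ _ _ _ _ _ tau0 tau' _ _ fullT faithT quasiT dualT) => X Y.
    exact: tau_add.
  exact: tau_scale.
by move=> tau2 [tau2' [_ _ dual2]]; apply: dual_iso_uniq.
Qed.
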